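(* Let $\rho\in(0,1]$, $T>0$, $t_0\in(0,T)$, let $g\in C[0,T]$ satisfy $g(t)\neq 0$ for all $t\in[0,T]$, and let $\psi\in D(A)$. Then the inverse problem of finding a pair $\{u(t),f\}$ with $$D_t^\rho u(t)+Au(t)=f\,g(t),\quad t\in(0,T],\qquad u(T)=u(0),\qquad u(t_0)=\psi$$ has a unique solution (in the sense defined in the context), and it is given by $$f=\sum_{k=1}^\infty f_k v_k,\qquad u(t)=\sum_{k=1}^\infty f_k\left[b_{k,\rho}(t)+\frac{b_{k,\rho}(T)}{1-E_{\rho}(-\lambda_kT^\rho)}E_{\rho}(-\lambda_kt^\rho)\right]v_k,$$ where, with $\psi_k=(\psi,v_k)$, $$f_k=\frac{\psi_k\,(1-E_\rho(-\lambda_kT^\rho))}{(1-E_\rho(-\lambda_kT^\rho))\,b_{k,\rho}(t_0)+E_\rho(-\lambda_kt_0^\rho)\,b_{k,\rho}(T)}.$$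
   Context: $H$ is a separable Hilbert space with scalar product $(\cdot,\cdot)$ and norm $\|\cdot\|$. $A$ is a self-adjoint positive operator in $H$ with domain $D(A)$ whose inverse is compact; $\{v_k\}_{k\ge1}$ is a complete orthonormal system of eigenfunctions of $A$ with eigenvalues $0<\lambda_1\le\lambda_2\le\cdots\to+\infty$, $Av_k=\lambda_kv_k$. The function $g$ is a given real-valued scalar function. The Caputo derivative of order $\rho\in(0,1)$ of $h:\mathbb{R}_+\to H$ is $$D_t^\rho h(t)=\frac{1}{\Gamma(1-\rho)}\int_0^t\frac{h'(\xi)}{(t-\xi)^\rho}\,d\xi,\quad t>0,$$ provided the right-hand side exists; for $\rho=1$, $D_t^1h=\frac{dh}{dt}$. The Mittag-Leffler functions are $E_{\rho,\mu}(z)=\sum_{k=0}^\infty\frac{z^k}{\Gamma(\rho k+\mu)}$ and $E_\rho(z)=E_{\rho,1}(z)$ (so $E_1(z)=E_{1,1}(z)=e^z$). Also $$b_{k,\rho}(t)=\int_0^t(t-s)^{\rho-1}E_{\rho,\rho}(-\lambda_k(t-s)^\rho)\,g(s)\,ds.$$ A solution of the inverse problem is a pair $\{u(t),f\}$ with $f\in H$, $u\in C([0,T];H)$ and $D_t^\rho u,\ Au\in C((0,T];H)$ satisfying the equation at each $t\in(0,T]$ and the conditions $u(T)=u(0)$ and $u(t_0)=\psi$.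
   Formalization: For ρ<1 the Caputo derivative is taken with h'(ξ)dξ read as dh(ξ) (Riemann–Stieltjes, improper at ξ=t), since for merely continuous g the function u may be nowhere differentiable; it agrees with the classical value where that exists. *)

(* Defs.v *)
From HB Require Import structures.
From mathcomp Require Import all_boot all_order all_algebra complex sesquilinear.
From mathcomp Require Import all_classical all_reals all_analysis.

Set Implicit Arguments.
Unset Strict Implicit.
Unset Printing Implicit Defensive.

Import Order.TTheory GRing.Theory Num.Theory.
Import numFieldNormedType.Exports.

Local Open Scope classical_set_scope.
Local Open Scope ring_scope.

(* A Hilbert space may be real or complex: [RorC R false] is R and
   [RorC R true] is R[i]. *)
Definition RorC (R : realType) (cplx : bool) : numFieldType :=
  if cplx then (R[i] : numFieldType) else (R : numFieldType).

Definition RorC_real (R : realType) (cplx : bool) : R -> RorC R cplx :=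
  match cplx return R -> RorC R cplx with
  | true => fun x => x%:C%C
  | false => fun x => x
  end.

Definition RorC_conj (R : realType) (cplx : bool) :
    RorC R cplx -> RorC R cplx :=
  match cplx return RorC R cplx -> RorC R cplx with
  | true => fun z : R[i] => z^*%C
  | false => fun x => x
  end.

Section SpecialFunctions.
Variable R : realType.
Notation mu := (@lebesgue_measure R).

Definition Gamma (x : R) : R :=
  (\int[mu]_(t in `]0%R, +oo[) (t `^ (x - 1) * expR (- t)))%R.

Definition mittag_leffler (rho nu z : R) : R :=
  limn (series (fun k : nat => z ^+ k / Gamma (rho * k%:R + nu))).

Definition duhamel (rho lam : R) (g : R -> R) (t : R) : R :=
  (\int[mu]_(s in `[0%R, t])
     ((t - s) `^ (rho - 1) * mittag_leffler rho rho (- lam * (t - s) `^ rho)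
      * g s))%R.

End SpecialFunctions.

Section HilbertSpace.
Variables (R : realType) (cplx : bool).
Notation K := (RorC R cplx).
Variable H : completeNormedModType K.
Implicit Types (dot : {dot H for @RorC_conj R cplx}) (D : set H) (A : H -> H).

Definition scalar_product_of_norm dot : Prop :=
  forall x : H, `|x| ^+ 2 = dot x x.

Definition separable : Prop := exists2 S : set H, countable S & dense S.

(* An unbounded operator with domain [D] is a total function of which only the
   values on [D] matter. *)
Definition linear_operator D A : Prop :=
  D 0 /\ forall (a : K) (x y : H), D x -> D y ->
    D (a *: x + y) /\ A (a *: x + y) = a *: A x + A y.

(* The right-hand side says that (y, z) is in the graph of A, the left-hand
   side that it is in the graph of the adjoint of A. *)
Definition self_adjoint dot D A : Prop :=
  dense D /\ forall y z : H,
    (forall x, D x -> dot (A x) y = dot x z) <-> (D y /\ A y = z).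

Definition positive_operator dot D A : Prop :=
  forall x, D x -> x != 0 -> 0 < dot (A x) x.

Definition compact_operator (S : H -> H) : Prop :=
  compact (closure (S @` [set y | `|y| <= 1])).

Definition has_compact_inverse D A : Prop :=
  exists S : H -> H, [/\ forall y, D (S y) /\ A (S y) = y,
    forall x, D x -> S (A x) = x & compact_operator S].

Definition complete_orthonormal dot (v : nat -> H) : Prop :=
  (forall j k, dot (v j) (v k) = (j == k)%:R) /\
  (forall x, (forall k, dot x (v k) = 0) -> x = 0).

Definition tagged_partition (a b : R) (x y : seq R) : Prop :=
  [/\ itv_partition a b x, size y = size x &
    forall i, (i < size x)%N -> nth 0 (a :: x) i <= nth 0 y i <= nth 0 x i].

Definition stieltjes_sum (phi : R -> R) (h : R -> H) (a : R) (x y : seq R) : H :=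
  \sum_(i < size x)
    RorC_real cplx (phi (nth 0 y i)) *: (h (nth 0 x i) - h (nth 0 (a :: x) i)).

(* l is the Riemann-Stieltjes integral of phi dh over [a, b]. *)
Definition is_stieltjes (phi : R -> R) (h : R -> H) (a b : R) (l : H) : Prop :=
  forall eps : R, 0 < eps -> exists2 delta : R, 0 < delta &
    forall x y : seq R, tagged_partition a b x y ->
      (forall i, (i < size x)%N -> nth 0 x i - nth 0 (a :: x) i < delta) ->
      `|stieltjes_sum phi h a x y - l| < RorC_real cplx eps.

(* [is_caputo T rho h t w]: the Caputo derivative of order rho of h at t exists
   and is w, for h defined on [0, T] and t in ]0, T].  In
     1 / Gamma (1 - rho) * \int_0^t (t - xi)^(- rho) h'(xi) dxi
   the term h'(xi) dxi is read as dh(xi), the integral being improper at xi = t.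
   For h continuous at 0 with a Riemann integrable derivative on the compact
   subintervals of ]0, t[ this is the improper Riemann integral of
   (t - xi)^(- rho) h'(xi).  The values of h' cannot be required pointwise:
   when g is merely continuous the functions [duhamel rho lam g] may be nowhere
   differentiable.
   For rho = 1 the derivative is taken within [0, T], hence it is one-sided
   at T. *)
Definition is_caputo (T rho : R) (h : R -> H) (t : R) (w : H) : Prop :=
  if rho == 1 then
    RorC_real cplx (s - t)^-1 *: (h s - h t) @[s --> within `[0, T] t^'] --> w
  else
    exists2 I : R -> H,
      forall b, 0 < b < t -> is_stieltjes (fun xi => (t - xi) `^ (- rho)) h 0 b (I b)
    & RorC_real cplx (Gamma (1 - rho))^-1 *: I b @[b --> t^'-] --> w.

(* Only the values of u on [0, T] matter. *)
Definition is_solution D A (rho T t0 : R) (g : R -> R) (psi : H)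
    (u : R -> H) (f : H) : Prop :=
  {within `[0, T], continuous u} /\
  (exists w : R -> H,
    [/\ {within `]0, T], continuous w},
        forall t, 0 < t <= T -> is_caputo T rho u t (w t),
        forall t, 0 < t <= T -> D (u t),
        {within `]0, T], continuous (fun t => A (u t))} &
        forall t, 0 < t <= T -> w t + A (u t) = RorC_real cplx (g t) *: f]) /\
  u T = u 0 /\ u t0 = psi.

End HilbertSpace.

Section Formula.
Variables (R : realType) (rho T t0 : R) (g : R -> R) (lam : nat -> R).

Definition E_rho (k : nat) (t : R) : R :=
  mittag_leffler rho 1 (- lam k * t `^ rho).

Definition coef_denominator (k : nat) : R :=
  (1 - E_rho k T) * duhamel rho (lam k) g t0
  + E_rho k t0 * duhamel rho (lam k) g T.

Definition f_coef (cplx : bool) (H : completeNormedModType (RorC R cplx))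
    (dot : {dot H for @RorC_conj R cplx}) (v : nat -> H) (psi : H)
    (k : nat) : RorC R cplx :=
  dot psi (v k) * RorC_real cplx (1 - E_rho k T)
  / RorC_real cplx (coef_denominator k).

Definition u_mode (k : nat) (t : R) : R :=
  duhamel rho (lam k) g t
  + duhamel rho (lam k) g T / (1 - E_rho k T) * E_rho k t.

End Formula.

(* Main.v *)
(** Write b_k for the Duhamel integral of g at lambda_k, J for the fractional
    integral of order rho and E_k(t) for E_rho(- lambda_k t^rho).  Then
    b_k = J (g - lambda_k b_k), and E_k = 1 - lambda_k b where b is the Duhamel
    integral of the constant 1.  The Caputo derivative of c + J w is w for
    continuous w, and a Caputo derivative is nonnegative at a maximum point.  The
    resulting maximum principle gives uniqueness for the scalar Cauchy problem,
    0 <= E_k < 1 on ]0, T], and b_k >= m (1 - E_k) / lambda_k if g >= m.  As g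
    has constant sign and |g| >= m > 0, the k-th denominator has absolute value at
    least m (1 - E_k(T)) / lambda_k, so |f_k| <= |(A psi, v_k)| / m.  Hence f, u(t),
    A u(t) and the Caputo derivative of u are images of A psi under operators that
    are diagonal in (v_k), with eigenvalues bounded uniformly in k and t; for such
    operators, limits and Stieltjes sums can be taken on each eigenvalue
    separately.  Conversely, the coordinates of any solution solve the scalar
    problem, hence are determined by those of psi. *)

(* Since [g] is only continuous, the Stieltjes integrals have to be computed without differentiating
   b_k. Integration by parts puts the derivative on the weight (t - xi)^(- rho). For a fractional
   integral J w, the boundary term and the remaining integral then merge into an average of w
   against a fixed kernel in the variable (b - s) / (t - b). It concentrates at t as b tends to t,
   which recovers w t, and it is bounded by a multiple of sup |w|. Positivity comes from the maximum
   principle and not from the series, whose terms alternate in sign. The lower bounds for b_k at t0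
   and T carry the factors 1 - E_k(t0) and 1 - E_k(T), and (1 - E_k(T)) (1 - E_k(t0)) + E_k(t0) (1 -
   E_k(T)) = 1 - E_k(T), which makes the bound on the denominator independent of t0. Uniform bounds
   on eigenvalues suffice for limits because a fixed vector has a small Bessel tail: only finitely
   many modes have to converge together. *)
Require Import Defs.
From mathcomp Require Import all_boot all_order all_algebra complex sesquilinear.
From mathcomp Require Import all_classical all_reals all_analysis.
From mathcomp Require Import ring lra measurable_realfun.

Import Order.TTheory GRing.Theory Num.Theory.
Import numFieldNormedType.Exports.

Local Open Scope classical_set_scope.
Local Open Scope ring_scope.

Set Implicit Arguments.
Unset Strict Implicit.
Unset Printing Implicit Defensive.

(** * Affine changes of variable in Lebesgue integrals *)

Section Affine.
Variable R : realType.
Notation mu := (@lebesgue_measure R).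
Local Open Scope ereal_scope.

Lemma measurable_affine (a b : R) : measurable_fun [set: R] (fun x => a * x + b)%R.
Proof.
by apply: measurable_funD => //; exact: measurable_funM.
Qed.

(** The right-hand side is a scaled pushforward measure, so by uniqueness of Lebesgue measure
    half-open intervals suffice. For negative [a] the preimage of such an interval is closed at the
    other end, hence the two cases. *)
Lemma lebesgue_measure_affine (a b : R) (A : set R) : a != 0%R ->
  measurable A ->
  mu A = (`|a|)%:E * mu ((fun x => a * x + b)%R @^-1` A).
Proof.
move=> a0 mA.
have mphi : measurable_fun [set: measurableTypeR R]
    (fun x : measurableTypeR R => (a * x + b)%R : measurableTypeR R).
  exact: (measurable_affine a b).
have a0' : (0 <= `|a|)%R by [].
pose nu0 : {measure set (measurableTypeR R) -> \bar R} :=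
  measure_function_pushforward__canonical__measure_function_Measure mu mphi.
pose nu := mscale (NngNum a0') nu0.
rewrite -[RHS]/(nu A).
apply: lebesgue_measure_unique => // X [[x y]] /= xy <-.
have : (a < 0)%R \/ (0 < a)%R by case: (ltgtP a 0%R) a0 => // *; [left|right].
case => [an|ap].
  rewrite /nu /nu0 /mscale /= /pushforward.
  rewrite (_ : _ @^-1` _ = `[((y - b) / a)%R, ((x - b) / a)%R[%classic); last first.
    apply/seteqP; split => z /=; rewrite !in_itv /= ler_ndivrMr // ltr_ndivlMr // -!lerBrDr -?ltrBlDr mulrC; lra.
  rewrite !lebesgue_measure_itv /= !lte_fin.
  rewrite ltr_nM2r ?invr_lt0 // ltrD2r; case: ifPn => _; last by rewrite mule0.
  rewrite ltr0_norm // -!EFinB -EFinM; congr EFin; field; exact: a0.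
rewrite /nu /nu0 /mscale /= /pushforward.
rewrite (_ : _ @^-1` _ = `]((x - b) / a)%R, ((y - b) / a)%R]%classic); last first.
  apply/seteqP; split => z /=; rewrite !in_itv /= ler_pdivlMr // ltr_pdivrMr // mulrC; lra.
rewrite !lebesgue_measure_itv /= !lte_fin.
rewrite ltr_pM2r ?invr_gt0 // ltrD2r; case: ifPn => _; last by rewrite mule0.
rewrite gtr0_norm // -!EFinB -EFinM; congr EFin; field; exact: a0.
Qed.

Lemma measurable_comp_affine (a b : R) (f : R -> \bar R) :
  measurable_fun [set: R] f -> measurable_fun [set: R] (fun x => f (a * x + b)%R).
Proof. by move=> mf; apply: (measurableT_comp mf); exact: measurable_affine. Qed.

Lemma ge0_integral_affine (a b : R) (f : R -> \bar R) : a != 0%R ->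
  measurable_fun [set: R] f -> (forall x, 0 <= f x) ->
  \int[mu]_x f x = (`|a|)%:E * \int[mu]_x f (a * x + b)%R.
Proof.
move=> a0 mf f0.
have mphi : measurable_fun [set: measurableTypeR R]
    (fun x : measurableTypeR R => (a * x + b)%R : measurableTypeR R).
  exact: (measurable_affine a b).
have a0' : (0 <= `|a|)%R by [].
pose nu0 : {measure set (measurableTypeR R) -> \bar R} :=
  measure_function_pushforward__canonical__measure_function_Measure mu mphi.
pose nu := mscale (NngNum a0') nu0.
transitivity (\int[nu]_x f x).
  apply: eq_measure_integral => A mA _; exact: lebesgue_measure_affine.
rewrite ge0_integral_mscale //=; congr (_ * _).
by rewrite ge0_integral_pushforward.
Qed.

Lemma integrable_affine (a b : R) (f : R -> R) : a != 0%R ->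
  mu.-integrable setT (EFin \o f) ->
  mu.-integrable setT (EFin \o (fun x => f (a * x + b)%R)).
Proof.
move=> a0 /integrableP[mf fi]; apply/integrableP; split.
  exact: (measurable_comp_affine a b mf).
move: fi; rewrite (@ge0_integral_affine a b (fun x => `|(EFin \o f) x|)) //; last first.
  exact: measurableT_comp.
rewrite /= => h; rewrite ltNge leye_eq; apply/negP => /eqP e.
by move: h; rewrite e gt0_muley ?ltxx // lte_fin normr_gt0.
Qed.

(** Convolutions use it for reflections ([a = -1]), translations ([a = 1]) and dilations. The
    nonnegative case is applied to the positive and negative parts. *)
Lemma integral_affine (a b : R) (f : R -> R) : a != 0%R ->
  mu.-integrable setT (EFin \o f) ->
  (\int[mu]_x f x = `|a| * \int[mu]_x f (a * x + b))%R.
Proof.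
move=> a0 fi.
have fi' := integrable_affine b a0 fi.
have /integrableP[mf _] := fi.
suff E : \int[mu]_x (EFin \o f) x =
    (`|a|)%:E * \int[mu]_x (EFin \o (fun x => f (a * x + b)%R)) x.
  by rewrite /Rintegral E fineM ?(integrable_fin_num measurableT fi').
rewrite integralE [in RHS]integralE.
rewrite (ge0_integral_affine b a0 (measurable_funepos mf)) //.
rewrite (ge0_integral_affine b a0 (measurable_funeneg mf)) //.
rewrite [X in X - _ = _](_ : _ = (`|a|)%:E *
    \int[mu]_x (EFin \o (fun x => f (a * x + b)%R))^\+ x); last first.
  by congr (_ * _); apply: eq_integral => x _; rewrite !funeposE.
rewrite [X in _ - X = _](_ : _ = (`|a|)%:E *
    \int[mu]_x (EFin \o (fun x => f (a * x + b)%R))^\- x); last first.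
  by congr (_ * _); apply: eq_integral => x _; rewrite !funenegE.
apply/esym/muleBr => //.
exact/fin_num_adde_defr/(integrable_pos_fin_num measurableT fi').
Qed.
End Affine.

(** * The fundamental theorem of calculus for nonnegative integrands singular at the end points *)

Section SingularFTC.
Variable R : realType.
Notation mu := (@lebesgue_measure R).

(** The integrand may blow up at both ends, so the usual theorem is applied on compact intervals
    that increase to []a, b[]; nonnegativity gives monotone convergence of the integrals. *)
Lemma integral_ge0_FTC2_oo (F f : R -> R) (a b : R) : a < b ->
  F x @[x --> a^'+] --> F a -> F x @[x --> b^'-] --> F b ->
  (forall x, a < x < b -> is_derive x 1 F (f x)) ->
  (forall x, a < x < b -> {for x, continuous f}) ->
  (forall x, a < x < b -> 0 <= f x) ->
  (\int[mu]_(x in `]a, b[) (f x)%:E = (F b - F a)%:E)%E.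
Proof.
move=> ab Fa Fb dF cf f0.
(* The shift by 3 keeps [r n] at most a third of the length, so that each [I n] is nondegenerate. *)
pose r n : R := (b - a) / n.+3%:R.
have r0 n : 0 < r n by rewrite divr_gt0 // subr_gt0.
have r3 n : r n *+ 2 < b - a.
  have : r n <= (b - a) / 3.
    by rewrite /r ler_pM2l ?subr_gt0 // lef_pV2 ?posrE // ler_nat.
  by lra.
have cr : r @ \oo --> 0.
  rewrite -[0](mulr0 (b - a)); apply: cvgM; first exact: cvg_cst.
  rewrite (_ : (fun n => _) = [sequence harmonic (n + 2)%N]_n); last first.
    by apply/funext => n; rewrite /= addn2.
  by rewrite cvg_shiftn; exact: cvg_harmonic.
pose I n : set R := `[a + r n, b - r n]%classic.
have UI : `]a, b[%classic = \bigcup_n I n.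
  apply/seteqP; split => x /=; rewrite in_itv /=; last first.
    by case=> n _; rewrite /I /= in_itv /= => /andP[h1 h2]; have := r0 n; lra.
  move=> /andP[ax xb].
  have /cvgrPdist_lt /(_ _ (_ : 0 < Num.min (x - a) (b - x))) := cr.
  rewrite lt_min !subr_gt0 ax xb => /(_ isT) [N _ /(_ N (leqnn N))].
  rewrite sub0r normrN gtr0_norm // lt_min => /andP[h1 h2].
  by exists N => //; rewrite /I /= in_itv /=; lra.
have rn n m : (n <= m)%N -> r m <= r n.
  by move=> nm; rewrite /r ler_pM2l ?subr_gt0 // lef_pV2 ?posrE // ler_nat.
have mf : measurable_fun `]a, b[ f.
  apply: open_continuous_measurable_fun => //.
  by move=> x; rewrite inE /= in_itv /=; exact: cf.
have H1 : (\int[mu]_(x in I i) (f x)%:E @[i --> \oo] -->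
   \int[mu]_(x in \bigcup_i I i) (f x)%:E)%E.
  apply: ge0_nondecreasing_set_cvg_integral.
  - move=> n m /rn nm; rewrite subsetEset => x; rewrite /I /= !in_itv /=; lra.
  - by move=> i; exact: measurable_itv.
  - move=> i; apply/measurable_EFinP; apply: measurable_funS mf => // x.
    by rewrite /I /= !in_itv /=; have := r0 i; lra.
  - move=> i x; rewrite /I /= !in_itv /= => h; rewrite lee_fin f0 //.
    by have := r0 i; lra.
have Fder x : a < x < b -> derivable F x 1 by move=> /dF [].
have Fcont x : a < x < b -> {for x, continuous F}.
  by move=> /Fder /derivable1_diffP /differentiable_continuous.
have H2 n : (\int[mu]_(x in I n) (f x)%:E = (F (b - r n))%:E - (F (a + r n))%:E)%E.
  apply: continuous_FTC2.
  - by have := r3 n; lra.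
  - apply: continuous_in_subspaceT => x; rewrite inE /= in_itv /= => h.
    by apply: cf; have := r0 n; have := r3 n; lra.
  - split.
    + move=> x; rewrite in_itv /= => h.
      by apply: Fder; have := r0 n; have := r3 n; lra.
    + by apply: cvg_at_right_filter; apply: Fcont; have := r0 n; have := r3 n; lra.
    + by apply: cvg_at_left_filter; apply: Fcont; have := r0 n; have := r3 n; lra.
  - move=> x; rewrite in_itv /= => h; rewrite derive1E.
    by apply: derive_val; apply: dF; have := r0 n; have := r3 n; lra.
rewrite UI; apply: (cvg_unique _ H1) => //.
rewrite (_ : (fun i => _) = (fun n => (F (b - r n) - F (a + r n))%:E)); last first.
  by apply/funext => n; rewrite H2.
apply: cvg_EFin; first exact: nearW.
apply: cvgB.
  move/cvg_at_leftP : Fb; apply; split; first by move=> n; rewrite ltrBlDr ltrDl.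
  by rewrite -[X in _ --> X]subr0; apply: cvgB => //; exact: cvg_cst.
move/cvg_at_rightP : Fa; apply; split; first by move=> n; rewrite ltrDl.
by rewrite -[X in _ --> X]addr0; apply: cvgD => //; exact: cvg_cst.
Qed.

Lemma powR_continuous (a x : R) : 0 < x ->
  {for x, continuous (fun y : R => y `^ a)}.
Proof.
move=> x0; apply: differentiable_continuous; apply/derivable1_diffP.
by have [] := is_derive1_powR a x0.
Qed.

Lemma integral_powR (a t : R) : 0 < a -> 0 < t ->
  (\int[mu]_(x in `]0%R, t[) (x `^ (a - 1))%:E = (t `^ a / a)%:E)%E.
Proof.
move=> a0 t0.
transitivity (t `^ a / a - 0 `^ a / a)%:E; last first.
  by rewrite powR0 ?gt_eqF // mul0r subr0.
apply: (@integral_ge0_FTC2_oo (fun x => x `^ a / a)) => //.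
- rewrite powR0 ?gt_eqF //; apply: cvgM; last exact: cvg_cst.
  exact: powR_cvg0.
- apply: cvg_at_left_filter; apply: cvgM; last exact: cvg_cst.
  exact: powR_continuous.
- move=> x /andP[x0 _]; have := is_derive1_powR a x0 => h.
  rewrite [X in is_derive _ _ _ X](_ : _ = a^-1 * (a * x `^ (a - 1))); last first.
    by rewrite mulrA mulVf ?mul1r ?gt_eqF.
  rewrite (_ : (fun x => _) = a^-1 *: (fun x => x `^ a)); last first.
    by apply/funext => y; rewrite mulrC.
  exact: is_deriveZ.
- by move=> x /andP[x0 _]; exact: powR_continuous.
- by move=> x _; exact: powR_ge0.
Qed.
End SingularFTC.

(** * Gamma and Beta functions *)

Section GammaFunction.
Variable R : realType.
Notation mu := (@lebesgue_measure R).

(** The indicator of the positive half-line is built in, so that convolutions and substitutions take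
    place on the whole line. *)
Definition gamma_ker (a x : R) : R := (0 < x)%R%:R * (x `^ (a - 1) * expR (- x)).

Lemma gamma_ker_ge0 (a x : R) : 0 <= gamma_ker a x.
Proof. by rewrite /gamma_ker mulr_ge0 // mulr_ge0 ?powR_ge0 ?expR_ge0. Qed.

Lemma measurable_pos : measurable_fun [set: R] (fun x : R => (0 < x)%R%:R : R).
Proof.
rewrite (_ : (fun x => _) = \1_(`]0, +oo[ : set R)); last first.
  by apply/funext => x; rewrite indicE mem_setE in_itv /= andbT.
exact: measurable_indic.
Qed.

Lemma measurable_powRl (a : R) : measurable_fun [set: R] (fun x : R => x `^ a).
Proof. exact: measurable_powR. Qed.

Lemma measurable_gamma_ker (a : R) : measurable_fun [set: R] (gamma_ker a).
Proof.
apply: measurable_funM; first exact: measurable_pos.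
apply: measurable_funM; first exact: measurable_powRl.
by apply: measurableT_comp => //; exact: measurable_funB.
Qed.

Lemma integrable_pos_powR (a t : R) : 0 < a -> 0 < t ->
  mu.-integrable setT (EFin \o (fun x => (0 < x < t)%R%:R * x `^ (a - 1))).
Proof.
move=> a0 t0.
rewrite (_ : _ \o _ = ((fun x => (x `^ (a - 1))%:E) \_ `]0%R, t[)%E); last first.
  apply/funext => x; rewrite patchE /= mem_setE in_itv /=.
  by case: ifP => _; rewrite ?mul1r ?mul0r.
apply/integrable_restrict => //; rewrite setTI; apply/integrableP; split.
  by apply/measurable_EFinP/measurable_funTS; exact: measurable_powRl.
under eq_integral do rewrite /= ger0_norm ?powR_ge0 //.
by rewrite integral_powR // ltry.
Qed.

(** From ln y < y at y = x / (2 a) one gets a ln x <= a ln (2 a) + x / 2: half of the exponential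
    decay absorbs the power. *)
Lemma powR_expR_le (a x : R) : 0 < a -> 1 <= x ->
  x `^ (a - 1) * expR (- x) <= expR (a * ln (2 * a)) * expR (- (2^-1 * x)).
Proof.
move=> a0 x1; have x0 : 0 < x by lra.
rewrite /powR gt_eqF // -!expRD ler_expR.
have l0 : 0 <= ln x by rewrite ln_ge0.
have : ln (x / (2 * a)) < x / (2 * a) by apply: ln_sublinear; rewrite divr_gt0 // mulr_gt0.
rewrite ln_div ?posrE ?mulr_gt0 // => h.
have : a * (ln x - ln (2 * a)) < a * (x / (2 * a)) by rewrite ltr_pM2l.
have -> : a * (x / (2 * a)) = 2^-1 * x by field; rewrite gt_eqF.
by nra.
Qed.

Lemma integrable_gamma_ker (a : R) : 0 < a ->
  mu.-integrable setT (EFin \o gamma_ker a).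
Proof.
move=> a0.
pose d1 (x : R) : R := (0 < x < 1)%R%:R * x `^ (a - 1).
(* The factor 2 cancels the rate 1/2 in front of the exponential density. *)
pose c : R := expR (a * ln (2 * a)) * 2.
pose d (x : R) : R := d1 x + c * exponential_pdf (2^-1) x.
apply: (@le_integrable _ _ _ mu _ measurableT _ (EFin \o d)).
- by apply/measurable_EFinP; exact: measurable_gamma_ker.
- move=> x _ /=; rewrite !lee_fin ger0_norm ?gamma_ker_ge0 //.
  apply: le_trans (ler_norm _).
  rewrite /gamma_ker /d /d1 /c.
  case: ltP => x0 /=; last first.
    by rewrite !mul0r add0r !mulr_ge0 ?expR_ge0 // exponential_pdf_ge0.
  rewrite mul1r exponential_pdfE ?(ltW x0) //=.
  have [x1|x1] := ltP x 1.
    rewrite mul1r; apply: ler_wpDr.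
      by rewrite !mulr_ge0 ?expR_ge0.
    rewrite -[leRHS]mulr1 ler_wpM2l ?powR_ge0 // -expR0 ler_expR; lra.
  rewrite mul0r add0r; apply: le_trans (powR_expR_le a0 x1) _.
  rewrite -mulrA ler_wpM2l ?expR_ge0 // mulrA mulfV // mul1r.
  by rewrite mulNr.
- rewrite (_ : _ \o _ = ((EFin \o d1) \+
    (fun x => c%:E * (EFin \o exponential_pdf (2^-1)) x))%E) //.
  apply: integrableD => //; first exact: integrable_pos_powR.
  by apply: integrableZl => //; exact: integrable_exponential_pdf.
Qed.

Lemma GammaE (a : R) : Gamma a = \int[mu]_x gamma_ker a x.
Proof.
rewrite /Gamma Rintegral_mkcond; congr fine; apply: eq_integral => x _; congr EFin.
rewrite patchE /gamma_ker mem_setE in_itv /= andbT.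
by case: ifP; rewrite ?mul1r ?mul0r.
Qed.

Lemma Gamma_EFin (a : R) : 0 < a ->
  (\int[mu]_x (gamma_ker a x)%:E = (Gamma a)%:E)%E.
Proof.
move=> a0; rewrite GammaE /Rintegral fineK //.
exact: (integrable_fin_num _ (integrable_gamma_ker a0)).
Qed.
Lemma Gamma_ge (a m N : R) : 0 < a -> 0 < N -> 0 <= m ->
  (forall x, N <= x <= N + 1 -> m <= x `^ (a - 1) * expR (- x)) -> m <= Gamma a.
Proof.
move=> a0 N0 m0 h; rewrite -lee_fin -Gamma_EFin //.
have -> : m%:E = (\int[mu]_(x in `[N, (N + 1)%R]) m%:E)%E.
  rewrite integral_cst //= lebesgue_measure_itv /= lte_fin ltrDl ltr01.
  by rewrite -EFinB [N + 1]addrC addrK mule1.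
apply: (@le_trans _ _ (\int[mu]_(x in `[N, (N + 1)%R]) (gamma_ker a x)%:E)%E).
  apply: ge0_le_integral => //.
  - by apply/measurable_EFinP/measurable_funTS; exact: measurable_gamma_ker.
  - move=> x; rewrite /= in_itv /= => xN; rewrite lee_fin /gamma_ker.
    have -> : 0 < x by case/andP: xN => [? _]; lra.
    by rewrite mul1r h.
apply: ge0_subset_integral => //.
  by apply/measurable_EFinP; exact: measurable_gamma_ker.
by move=> x _; rewrite lee_fin gamma_ker_ge0.
Qed.

(** As [N] is arbitrary, Gamma outgrows every geometric sequence, which is all that the
    Mittag-Leffler series require. On [N, N + 1], x^(a - 1) = x^a / x >= N^a / (N + 1), whatever the
    sign of a - 1. *)
Lemma Gamma_growth (a N : R) : 0 < a -> 0 < N ->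
  N `^ a * (expR (- (N + 1)) / (N + 1)) <= Gamma a.
Proof.
move=> a0 N0; apply: (@Gamma_ge a _ N) => //.
  by rewrite mulr_ge0 ?powR_ge0 // divr_ge0 ?expR_ge0 //; lra.
move=> x /andP[x1 x2]; have x0 : 0 < x by lra.
rewrite mulrA -mulrAC; apply: ler_pM.
- by rewrite divr_ge0 ?powR_ge0 //; lra.
- exact: expR_ge0.
- rewrite ler_pdivrMr; last lra.
  have := mulr_powRB1 (ltW x0) a0 => e.
  have : N `^ a <= x `^ a by apply: ge0_ler_powR; rewrite ?nnegrE; lra.
  rewrite -e => /le_trans; apply; rewrite mulrC ler_wpM2l ?powR_ge0 //; lra.
- by rewrite ler_expR; lra.
Qed.

Lemma Gamma_gt0 (a : R) : 0 < a -> 0 < Gamma a.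
Proof.
move=> a0; apply: lt_le_trans (Gamma_growth a0 ltr01).
by rewrite mulr_gt0 ?powR_gt0 // divr_gt0 ?expR_gt0 // addr_gt0.
Qed.

Lemma Gamma1 : Gamma (1 : R) = 1.
Proof.
have : (\int[mu]_x (exponential_pdf 1 x)%:E = 1)%E by exact: integral_exponential_pdf.
move=> e; transitivity (fine (\int[mu]_x (exponential_pdf 1 x)%:E)%E); last by rewrite e.
rewrite GammaE /Rintegral; congr fine; apply: ae_eq_integral => //.
- by apply/measurable_EFinP; exact: measurable_gamma_ker.
- by apply/measurable_EFinP; exact: measurable_exponential_pdf.
exists [set 0]; split => //; first exact: lebesgue_measure_set1.
move=> x /= /not_implyP[_]; apply: contra_notP => /eqP x0.
rewrite /gamma_ker; case: ltP => xp; last first.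
  by rewrite mul0r lt0_exponential_pdf // lt_neqAle x0.
by rewrite exponential_pdfE ?ltW //= subrr powRr0 !mul1r mulN1r.
Qed.

(** The Riemann-Liouville kernel without its factor 1 / Gamma(a). For [a = 1] it is the Heaviside
    function. *)
Definition pow_ker (a x : R) : R := (0 < x)%R%:R * x `^ (a - 1).

Lemma pow_ker_ge0 (a x : R) : 0 <= pow_ker a x.
Proof. by rewrite /pow_ker mulr_ge0 // powR_ge0. Qed.

Lemma pow_kerE (a x : R) : 0 < x -> pow_ker a x = x `^ (a - 1).
Proof. by rewrite /pow_ker => ->; rewrite mul1r. Qed.

Lemma pow_ker0 (a x : R) : x <= 0 -> pow_ker a x = 0.
Proof. by rewrite /pow_ker; case: ltP => //; rewrite mul0r. Qed.

Lemma measurable_pow_ker (a : R) : measurable_fun [set: R] (pow_ker a).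
Proof.
apply: measurable_funM; first exact: measurable_pos.
exact: measurable_powRl.
Qed.

Lemma pow_kerZ (a t x : R) : 0 < t -> pow_ker a (t * x) = t `^ (a - 1) * pow_ker a x.
Proof.
move=> t0; rewrite /pow_ker pmulr_rgt0 //; case: ltP => x0; last by rewrite !mul0r mulr0.
by rewrite !mul1r powRM // ltW.
Qed.

Lemma gamma_kerE (a x : R) : gamma_ker a x = pow_ker a x * expR (- x).
Proof. by rewrite /gamma_ker /pow_ker mulrA. Qed.
Definition pow_conv (a b t : R) : \bar R :=
  (\int[mu]_x (pow_ker a (t - x) * pow_ker b x)%:E)%E.

Lemma pow_conv_ge0 a b t : (0 <= pow_conv a b t)%E.
Proof. by apply: integral_ge0 => x _; rewrite lee_fin mulr_ge0 ?pow_ker_ge0. Qed.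

Lemma measurable_pow_conv_integrand a b t : measurable_fun [set: R]
  (fun x => (pow_ker a (t - x) * pow_ker b x)%:E).
Proof.
apply/measurable_EFinP; apply: measurable_funM; last exact: measurable_pow_ker.
apply: measurableT_comp; first exact: measurable_pow_ker.
exact: measurable_funB.
Qed.

Lemma pow_conv_scale (a b t : R) : 0 < t ->
  (pow_conv a b t = (t `^ (a + b - 1))%:E * pow_conv a b 1)%E.
Proof.
move=> t0; have tn0 : t != 0 by rewrite gt_eqF.
pose f x : \bar R := (pow_ker a (t - x) * pow_ker b x)%:E.
have f0 x : (0 <= f x)%E by rewrite lee_fin mulr_ge0 ?pow_ker_ge0.
rewrite /pow_conv (@ge0_integral_affine _ t 0 f tn0 (@measurable_pow_conv_integrand a b t) f0).
have -> : (\int[mu]_x f (t * x + 0)%R = \int[mu]_x ((t `^ (a - 1) * t `^ (b - 1))%:E *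
    (pow_ker a (1 - x) * pow_ker b x)%:E))%E.
  apply: eq_integral => x _; rewrite /f addr0 -EFinM.
  have -> : t - t * x = t * (1 - x) by ring.
  by rewrite !pow_kerZ // mulrACA.
rewrite ge0_integralZl //; last 3 first.
- exact: measurable_pow_conv_integrand.
- by move=> x _; rewrite lee_fin mulr_ge0 ?pow_ker_ge0.
- by rewrite lee_fin mulr_ge0 ?powR_ge0.
rewrite muleA -EFinM; congr (_%:E * _)%E.
rewrite gtr0_norm // -[X in X * _](powRr1 (ltW t0)) -!powRD; try by rewrite tn0 implybT.
by congr (_ `^ _); ring.
Qed.

(** The two exponentials multiply to exp(- u), which leaves the integral; the power kernels that
    remain scale in [u]. *)
Lemma gamma_ker_conv a b u :
  (\int[mu]_x (gamma_ker a (u - x) * gamma_ker b x)%:E =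
   (gamma_ker (a + b) u)%:E * pow_conv a b 1)%E.
Proof.
rewrite gamma_kerE; have [u0|u0] := ltP 0 u; last first.
  rewrite pow_ker0 // mul0r mul0e; apply: integral0_eq => x _.
  rewrite /gamma_ker; case: (ltP 0 x) => x0; last by rewrite mul0r mulr0.
  by rewrite (_ : (0 < u - x) = false) ?mul0r //; apply/negbTE; rewrite -leNgt; lra.
rewrite pow_kerE // mulrC EFinM -muleA -pow_conv_scale // /pow_conv.
rewrite -ge0_integralZl //; last 2 first.
- exact: measurable_pow_conv_integrand.
- by move=> x _; rewrite lee_fin mulr_ge0 ?pow_ker_ge0.
apply: eq_integral => x _; rewrite -EFinM !gamma_kerE; congr EFin.
by rewrite mulrACA -expRD mulrC; congr (expR _ * _); ring.
Qed.

(* Both sides of the identity multiplied by Gamma (a + b) are the total mass of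
   the convolution of two Gamma kernels. *)
Lemma Beta_Gamma a b : 0 < a -> 0 < b ->
  (pow_conv a b 1 = (Gamma a * Gamma b / Gamma (a + b))%:E)%E.
Proof.
move=> a0 b0.
have Gab := Gamma_gt0 (addr_gt0 a0 b0).
have : (\int[mu]_u \int[mu]_x (gamma_ker a (u - x) * gamma_ker b x)%:E =
        (Gamma (a + b))%:E * pow_conv a b 1)%E.
  under eq_integral do rewrite gamma_ker_conv.
  rewrite ge0_integralZr //; last 3 first.
  - by apply/measurable_EFinP; exact: measurable_gamma_ker.
  - by move=> x _; rewrite lee_fin gamma_ker_ge0.
  - exact: pow_conv_ge0.
  by rewrite Gamma_EFin ?addr_gt0.
pose F (p : R * R) : \bar R := (gamma_ker a (p.1 - p.2) * gamma_ker b p.2)%:E.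
have mF : measurable_fun [set: R * R] F.
  apply/measurable_EFinP; apply: measurable_funM.
    apply: measurableT_comp; first exact: measurable_gamma_ker.
    exact: measurable_funB.
  apply: measurableT_comp; first exact: measurable_gamma_ker.
  exact: measurable_snd.
have F0 p : (0 <= F p)%E by rewrite lee_fin mulr_ge0 ?gamma_ker_ge0.
have -> := @fubini_tonelli _ _ _ _ _ mu mu F mF F0.
rewrite /F /=.
have H x : (\int[mu]_u (gamma_ker a (u - x) * gamma_ker b x)%:E =
    (gamma_ker b x)%:E * (Gamma a)%:E)%E.
  rewrite -Gamma_EFin //.
  have ma : measurable_fun [set: R] (EFin \o gamma_ker a).
    by apply/measurable_EFinP; exact: measurable_gamma_ker.
  have g0 y : (0 <= (EFin \o gamma_ker a) y)%E by rewrite lee_fin gamma_ker_ge0.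
  rewrite (@ge0_integral_affine _ 1 (- x) _ (oner_neq0 _) ma g0) normr1 mul1e.
  have gb0 : (0 <= (gamma_ker b x)%:E)%E by rewrite lee_fin gamma_ker_ge0.
  rewrite -[RHS](@ge0_integralZl _ _ _ mu setT measurableT _
    (measurable_comp_affine 1 (- x) ma) _ (fun y _ => g0 _) gb0).
  by apply: eq_integral => u _; rewrite /= mul1r -EFinM mulrC.
have mb : measurable_fun [set: R] (EFin \o gamma_ker b).
  by apply/measurable_EFinP; exact: measurable_gamma_ker.
have g0 y : [set: R] y -> (0 <= (EFin \o gamma_ker b) y)%E.
  by rewrite lee_fin gamma_ker_ge0.
have Ga0 : (0 <= (Gamma a)%:E)%E by rewrite lee_fin ltW ?Gamma_gt0.
under eq_integral do rewrite H.
rewrite (@ge0_integralZr _ _ _ mu setT measurableT _ mb _ g0 Ga0).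
rewrite Gamma_EFin // -EFinM; move: (pow_conv_ge0 a b 1).
case: (pow_conv a b 1) => [r _ | |//].
  rewrite -EFinM => -[e]; congr EFin; rewrite [X in X / _]mulrC e.
  by rewrite mulrC mulKf // gt_eqF.
(* Finiteness of the Beta integral is part of the conclusion: an infinite value would equate a
   product of two real Gamma values with +oo. *)
by move=> _; rewrite gt0_muley ?lte_fin.
Qed.

Lemma pow_conv_Gamma (a b t : R) : 0 < a -> 0 < b -> 0 < t ->
  (pow_conv a b t = (t `^ (a + b - 1) * (Gamma a * Gamma b / Gamma (a + b)))%:E)%E.
Proof. by move=> a0 b0 t0; rewrite pow_conv_scale // Beta_Gamma // EFinM. Qed.

Lemma integrable_pow_conv (a b t : R) : 0 < a -> 0 < b -> 
  mu.-integrable setT (EFin \o (fun x => pow_ker a (t - x) * pow_ker b x)).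
Proof.
move=> a0 b0; apply/integrableP; split; first exact: measurable_pow_conv_integrand.
rewrite (_ : (\int[mu]_x _ = pow_conv a b t)%E); last first.
  by apply: eq_integral => x _; rewrite gee0_abs // lee_fin mulr_ge0 ?pow_ker_ge0.
have [t0|t0] := ltP 0 t; first by rewrite pow_conv_Gamma // ltry.
rewrite /pow_conv integral0_eq // => x _; have [x0|x0] := leP x 0.
  by rewrite (pow_ker0 _ x0) mulr0.
by rewrite (@pow_ker0 _ (t - x)) ?mul0r //; lra.
Qed.

Lemma Rintegral_pow_conv (a b t : R) : 0 < a -> 0 < b -> 0 < t ->
  \int[mu]_x (pow_ker a (t - x) * pow_ker b x) =
  t `^ (a + b - 1) * (Gamma a * Gamma b / Gamma (a + b)).
Proof.
move=> a0 b0 t0; rewrite /Rintegral.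
by have := pow_conv_Gamma a0 b0 t0; rewrite /pow_conv => ->.
Qed.
End GammaFunction.

(** * Mittag-Leffler functions *)

Section MittagLeffler.
Variables (R : realType) (rho nu : R).
Hypotheses (rho0 : 0 < rho) (nu0 : 0 < nu).
Notation mu := (@lebesgue_measure R).

Definition ml_term (z : R) (k : nat) : R := z ^+ k / Gamma (rho * k%:R + nu).

Lemma ml_arg_gt0 (k : nat) : 0 < rho * k%:R + nu.
Proof. by apply: ltr_wpDl => //; rewrite mulr_ge0 // ltW. Qed.

Lemma ml_term_ge0 (z : R) k : 0 <= z -> 0 <= ml_term z k.
Proof. by move=> z0; rewrite divr_ge0 ?exprn_ge0 // ltW // Gamma_gt0 // ml_arg_gt0. Qed.

Lemma norm_ml_term (z : R) k : `|ml_term z k| = ml_term `|z| k.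
Proof.
by rewrite /ml_term normrM normrX normfV [`|Gamma _|]gtr0_norm // Gamma_gt0 // ml_arg_gt0.
Qed.

Lemma is_cvg_ml_ge0 (z : R) : 0 <= z -> cvgn (series (ml_term z)).
Proof.
move=> z0.
(* [N] is chosen with N^rho = q, so that [Gamma_growth] bounds the k-th term by a constant times (z
   / q)^k, and z / q <= 1/2. *)
pose q : R := 2 * (z + 1); pose N : R := q `^ rho^-1.
have q0 : 0 < q by rewrite mulr_gt0 // ltr_wpDl.
have N0 : 0 < N by rewrite powR_gt0.
pose c : R := expR (- (N + 1)) / (N + 1).
have c0 : 0 < c by rewrite divr_gt0 ?expR_gt0 // addr_gt0.
have NE k : N `^ (rho * k%:R + nu) = q ^+ k * N `^ nu.
  rewrite powRD; last by rewrite gt_eqF // ml_arg_gt0.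
  by rewrite powRrM /N -[_ `^ rho]powRrM mulVf ?gt_eqF // powRr1 1?ltW // powR_mulrn // ltW.
have d0 : 0 < N `^ nu * c by rewrite mulr_gt0 // powR_gt0.
apply: (@series_le_cvg _ _ (geometric (N `^ nu * c)^-1 2^-1)).
- by move=> k; exact: ml_term_ge0.
- by move=> k; rewrite mulr_ge0 ?exprn_ge0 // invr_ge0 ltW.
- move=> k; rewrite /ml_term /geometric /=.
  have G := Gamma_growth (ml_arg_gt0 k) N0; rewrite NE -/c in G.
  apply: (@le_trans _ _ (z ^+ k / (q ^+ k * N `^ nu * c))).
    apply: ler_wpM2l; first exact: exprn_ge0.
    have g0 : 0 < q ^+ k * N `^ nu * c by rewrite -mulrA mulr_gt0 // exprn_gt0.
    by rewrite lef_pV2 // posrE //; exact: lt_le_trans G.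
  rewrite -mulrA invfM mulrA mulrC ler_wpM2l ?invr_ge0 ?(ltW d0) // -expr_div_n.
  apply: lerXn2r; rewrite ?nnegrE ?divr_ge0 ?(ltW q0) //.
  by rewrite ler_pdivrMr // /q mulKf //; lra.
- apply: is_cvg_geometric_series; rewrite ger0_norm //; lra.
Qed.

Lemma is_cvg_ml (z : R) : cvgn (series (ml_term z)).
Proof.
apply: normed_cvg; rewrite (_ : [normed _] = series (ml_term `|z|)).
  exact: is_cvg_ml_ge0.
by apply/funext => n; rewrite /series /=; apply: eq_bigr => k _; exact: norm_ml_term.
Qed.

Lemma cvg_ml (z : R) : series (ml_term z) @ \oo --> mittag_leffler rho nu z.
Proof. exact: is_cvg_ml. Qed.

Lemma ml_partial_le (z Z : R) n : `|z| <= Z ->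
  `|series (ml_term z) n| <= mittag_leffler rho nu Z.
Proof.
move=> zZ; have Z0 : 0 <= Z by apply: le_trans zZ.
apply: (@le_trans _ _ (series (ml_term Z) n)).
  rewrite /series /=; apply: le_trans (ler_norm_sum _ _ _) _.
  apply: ler_sum => k _; rewrite norm_ml_term ler_wpM2r //.
    by rewrite invr_ge0 ltW // Gamma_gt0 // ml_arg_gt0.
  by rewrite lerXn2r // nnegrE.
apply: nondecreasing_cvgn_le; last exact: is_cvg_ml.
by apply: nondecreasing_series => k _ _; exact: ml_term_ge0.
Qed.

Lemma ml_le (z Z : R) : `|z| <= Z -> `|mittag_leffler rho nu z| <= mittag_leffler rho nu Z.
Proof.
move=> zZ.
have h : `|series (ml_term z) n| @[n --> \oo] --> `|mittag_leffler rho nu z|.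
  by apply: cvg_norm; exact: cvg_ml.
rewrite -(cvg_lim _ h) //; apply: limr_le; first by apply/cvg_ex; exists `|mittag_leffler rho nu z|.
by apply: nearW => n; exact: ml_partial_le.
Qed.
End MittagLeffler.

Section MittagLefflerRec.
Variables (R : realType) (rho : R).
Hypotheses (rho0 : 0 < rho).

(** The term k = 0 splits off. At [nu = rho] this becomes the resolvent identity of the kernel, at
    [nu = 1] the link between [E_rho] and the kernel. *)
Lemma ml_rec (nu z : R) : 0 < nu -> mittag_leffler rho nu z =
  (Gamma nu)^-1 + z * mittag_leffler rho (rho + nu) z.
Proof.
move=> nu0; have c1 := @cvg_ml _ _ _ rho0 nu0 z.
have nu0' : 0 < rho + nu by rewrite addr_gt0.
have c2 := @cvg_ml _ _ _ rho0 nu0' z.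
have c3 : (Gamma nu)^-1 + z * series (ml_term rho (rho + nu) z) n @[n --> \oo] -->
    (Gamma nu)^-1 + z * mittag_leffler rho (rho + nu) z.
  by apply: cvgD; [exact: cvg_cst | apply: cvgM; [exact: cvg_cst | exact: c2]].
rewrite -(cvg_shiftn 1) in c1.
apply: (cvg_unique _ c1) => //.
apply: cvg_trans c3; apply: near_eq_cvg; apply: nearW => n.
rewrite /= addn1 /series /= big_nat_recl //.
have -> : ml_term rho nu z 0 = (Gamma nu)^-1.
  by rewrite /ml_term expr0 mulr0 add0r div1r.
congr (_ + _).
rewrite mulr_sumr; apply: eq_bigr => k _; rewrite /ml_term exprS mulrA.
by congr (_ / Gamma _); rewrite -natr1; ring.
Qed.

Lemma ml0 (nu : R) : 0 < nu -> mittag_leffler rho nu 0 = (Gamma nu)^-1.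
Proof. by move=> nu0; rewrite ml_rec // mul0r addr0. Qed.
End MittagLefflerRec.

Lemma powRD_pos (R : realType) (x a b : R) : 0 < x ->
  x `^ (a + b) = x `^ a * x `^ b.
Proof. by move=> x0; rewrite powRD // (gt_eqF x0) implybT. Qed.

(** * Dominated convergence and finite sums for real-valued integrals *)

Section Dominated.
Variable R : realType.
Notation mu := (@lebesgue_measure R).

Lemma Rdominated_cvg (f_ : nat -> R -> R) (f g : R -> R) :
  (forall n, measurable_fun [set: R] (f_ n)) -> measurable_fun [set: R] f ->
  {ae mu, forall x, f_ n x @[n --> \oo] --> f x} ->
  mu.-integrable setT (EFin \o g) -> (forall n x, `|f_ n x| <= g x) ->
  \int[mu]_x f_ n x @[n --> \oo] --> \int[mu]_x f x.
Proof.
move=> mf_ mf cf ig fg.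
have cf' : {ae mu, forall x, [set: R] x -> (f_ n x)%:E @[n --> \oo] --> (f x)%:E}.
  move: cf => [N [mN N0 sub]]; exists N; split => // x /= h; apply: sub => /= h'; apply: h => _.
  by apply: cvg_EFin => //; exact: nearW.
have fg' : {ae mu, forall x n, [set: R] x -> (`|(f_ n x)%:E| <= (g x)%:E)%E}.
  by apply: aeW => x n _; rewrite lee_fin fg.
have mf_' n : measurable_fun [set: R] (EFin \o f_ n) by exact/measurable_EFinP.
have mf' : measurable_fun [set: R] (EFin \o f) by exact/measurable_EFinP.
have [fi _ h] := @dominated_convergence _ _ _ mu setT measurableT
  (fun n => EFin \o f_ n) (EFin \o f) (EFin \o g) mf_' mf' cf' ig fg'.
have fin : (\int[mu]_x (EFin \o f) x)%E \is a fin_num by exact: integrable_fin_num.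
apply: fine_cvg; rewrite fineK //; exact: h.
Qed.

Lemma integrableZ (f : R -> R) (a : R) : mu.-integrable setT (EFin \o f) ->
  mu.-integrable setT (EFin \o (fun x => a * f x)).
Proof.
move=> fi; rewrite (_ : _ \o _ = (fun x => a%:E * (EFin \o f) x)%E) //.
exact: integrableZl.
Qed.

Lemma integrable_sumZ (f : nat -> R -> R) (a : nat -> R) n :
  (forall k, mu.-integrable setT (EFin \o f k)) ->
  mu.-integrable setT (EFin \o (fun x => \sum_(0 <= k < n) a k * f k x)).
Proof.
move=> fi; elim: n => [|n IH].
  rewrite (_ : _ \o _ = cst 0%E); first exact: integrable0.
  by apply/funext => x; rewrite /= big_geq.
rewrite (_ : _ \o _ = ((EFin \o (fun x => (\sum_(0 <= k < n) a k * f k x)%R)) \+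
   (EFin \o (fun x => a n * f n x)%R))%E).
  by apply: integrableD => //; exact: integrableZ.
by apply/funext => x; rewrite /= big_nat_recr.
Qed.

Lemma Rintegral_sumZ (f : nat -> R -> R) (a : nat -> R) n :
  (forall k, mu.-integrable setT (EFin \o f k)) ->
  \int[mu]_x (\sum_(0 <= k < n) a k * f k x) = \sum_(0 <= k < n) a k * \int[mu]_x f k x.
Proof.
move=> fi; elim: n => [|n IH].
  under eq_Rintegral do rewrite big_geq //.
  by rewrite big_geq // Rintegral_cst // mul0r.
under eq_Rintegral do rewrite big_nat_recr //=.
rewrite RintegralD //; last 2 first.
- exact: integrable_sumZ.
- exact: integrableZ.
by rewrite IH big_nat_recr //= RintegralZl.
Qed.
End Dominated.

(** * The Mittag-Leffler kernel and its resolvent identity *)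

Section MLKernel.
Variables (R : realType) (rho lam : R).
Hypotheses (rho0 : 0 < rho) (lam0 : 0 < lam).
Notation mu := (@lebesgue_measure R).

(* Kernel of [duhamel], extended by 0 to the negative half-line. *)
Definition ml_ker (r : R) : R :=
  pow_ker rho r * mittag_leffler rho rho (- lam * r `^ rho).

(** Truncating the series gives a finite combination of power kernels, whose convolutions are known
    by the Beta identity. *)
Definition ml_ker_part (n : nat) (r : R) : R :=
  pow_ker rho r * series (ml_term rho rho (- lam * r `^ rho)) n.

Lemma cvg_ml_ker_part r : ml_ker_part n r @[n --> \oo] --> ml_ker r.
Proof. by apply: cvgM; [exact: cvg_cst | exact: cvg_ml]. Qed.

Lemma ml_ker_partE n r : ml_ker_part n r =
  \sum_(0 <= k < n) (- lam) ^+ k / Gamma (rho * k%:R + rho) * pow_ker (rho * k%:R + rho) r.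
Proof.
rewrite /ml_ker_part /series /= mulr_sumr; apply: eq_bigr => k _.
have [r0|r0] := ltP 0 r; last by rewrite !pow_ker0 // mul0r mulr0.
rewrite /ml_term !pow_kerE // exprMn -(powR_mulrn k (powR_ge0 r rho)) -powRrM.
rewrite mulrC -!mulrA; congr (_ * _); rewrite mulrC -mulrA; congr (_ * _).
have -> : rho * k%:R + rho - 1 = (rho - 1) + rho * k%:R by ring.
by rewrite -powRD_pos.
Qed.

Lemma measurable_ml_ker_part n : measurable_fun [set: R] (ml_ker_part n).
Proof.
rewrite (funext (ml_ker_partE n)).
apply: measurable_sum => k; apply: measurable_funM => //.
exact: measurable_pow_ker.
Qed.

Lemma measurable_ml_ker : measurable_fun [set: R] ml_ker.
Proof.
apply: (measurable_fun_cvg measurable_ml_ker_part) => r _.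
exact: cvg_ml_ker_part.
Qed.

Lemma ml_ker_arg_le r T : 0 <= r <= T -> `|- lam * r `^ rho| <= lam * T `^ rho.
Proof.
move=> /andP[r0 rT]; rewrite normrM normrN (gtr0_norm lam0) ger0_norm ?powR_ge0 //.
rewrite ler_pM2l //; apply: ge0_ler_powR; rewrite ?nnegrE ?(ltW rho0) //.
exact: le_trans rT.
Qed.

(** A crude bound, growing with [lam], that serves only as a dominating function; the bounds uniform
    in [lam] come from the maximum principle. *)
Lemma norm_ml_ker_part_le n r T : r <= T ->
  `|ml_ker_part n r| <= pow_ker rho r * mittag_leffler rho rho (lam * T `^ rho).
Proof.
move=> rT; have [r0|r0] := ltP 0 r; last first.
  by rewrite /ml_ker_part pow_ker0 // !mul0r normr0.
rewrite normrM ger0_norm ?pow_ker_ge0 // ler_wpM2l ?pow_ker_ge0 //.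
by apply: ml_partial_le => //; apply: ml_ker_arg_le; rewrite ltW.
Qed.

Lemma norm_ml_ker_le r T : r <= T ->
  `|ml_ker r| <= pow_ker rho r * mittag_leffler rho rho (lam * T `^ rho).
Proof.
move=> rT; have [r0|r0] := ltP 0 r; last first.
  by rewrite /ml_ker pow_ker0 // !mul0r normr0.
rewrite normrM ger0_norm ?pow_ker_ge0 // ler_wpM2l ?pow_ker_ge0 //.
by apply: ml_le => //; apply: ml_ker_arg_le; rewrite ltW.
Qed.

Lemma ml_ker0 r : r <= 0 -> ml_ker r = 0.
Proof. by move=> r0; rewrite /ml_ker pow_ker0 // mul0r. Qed.

(** Termwise convolution by the Beta identity, then dominated convergence. It is used for [c = rho]
    and for [c = 1]. *)
Lemma pow_ker_conv_ml_ker (c t : R) : 0 < c -> 0 < t ->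
  \int[mu]_s (pow_ker c (t - s) * ml_ker s) =
  Gamma c * t `^ (rho + c - 1) * mittag_leffler rho (rho + c) (- lam * t `^ rho).
Proof.
move=> c0 t0; have rc0 : 0 < rho + c by rewrite addr_gt0.
have mp : measurable_fun [set: R] (fun s => pow_ker c (t - s)).
  by apply: measurableT_comp; [exact: measurable_pow_ker | exact: measurable_funB].
pose M := mittag_leffler rho rho (lam * t `^ rho).
have h : \int[mu]_s (pow_ker c (t - s) * ml_ker_part n s) @[n --> \oo] -->
         \int[mu]_s (pow_ker c (t - s) * ml_ker s).
  apply: (@Rdominated_cvg _ _ _ (fun s => M * (pow_ker c (t - s) * pow_ker rho s))).
  - by move=> n; apply: measurable_funM => //; exact: measurable_ml_ker_part.
  - by apply: measurable_funM => //; exact: measurable_ml_ker.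
  - by apply: aeW => s; apply: cvgM; [exact: cvg_cst | exact: cvg_ml_ker_part].
  - by apply: integrableZ; exact: integrable_pow_conv.
  - move=> n s; rewrite normrM ger0_norm ?pow_ker_ge0 //.
    have [ts|st] := leP t s; first by rewrite pow_ker0 ?subr_le0 // !mul0r mulr0.
    rewrite mulrCA ler_wpM2l ?pow_ker_ge0 // mulrC.
    by apply: norm_ml_ker_part_le; exact: ltW.
apply: (cvg_unique _ h) => //.
have h2 : Gamma c * t `^ (rho + c - 1) * series (ml_term rho (rho + c) (- lam * t `^ rho)) n
   @[n --> \oo] --> Gamma c * t `^ (rho + c - 1) * mittag_leffler rho (rho + c) (- lam * t `^ rho).
  by apply: cvgM; [exact: cvg_cst | exact: cvg_ml].
apply: cvg_trans h2; apply: near_eq_cvg; apply: nearW => n.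
pose a k := (- lam) ^+ k / Gamma (rho * k%:R + rho).
have -> : \int[mu]_s (pow_ker c (t - s) * ml_ker_part n s) =
  \sum_(0 <= k < n) a k * \int[mu]_s (pow_ker c (t - s) * pow_ker (rho * k%:R + rho) s).
  rewrite -(@Rintegral_sumZ _ (fun k s => pow_ker c (t - s) * pow_ker (rho * k%:R + rho) s)).
    apply: eq_Rintegral => s _; rewrite ml_ker_partE mulr_sumr; apply: eq_bigr => k _.
    by rewrite /a mulrCA.
  by move=> k; apply: integrable_pow_conv => //; exact: ml_arg_gt0.
rewrite /series /= mulr_sumr; apply: eq_bigr => k _.
have k0 := ml_arg_gt0 rho0 rho0 k; have kc0 := ml_arg_gt0 rho0 rc0 k.
rewrite Rintegral_pow_conv // /a /ml_term exprMn -(powR_mulrn k (powR_ge0 t rho)) -powRrM.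
have -> : c + (rho * k%:R + rho) - 1 = (rho + c - 1) + rho * k%:R by ring.
have -> : c + (rho * k%:R + rho) = rho * k%:R + (rho + c) by ring.
rewrite (powRD_pos (rho + c - 1)) //.
have := lt0r_neq0 (Gamma_gt0 k0); have := lt0r_neq0 (Gamma_gt0 kc0).
move: (Gamma _) (Gamma _) (Gamma _) (_ ^+ _) (_ `^ _) (_ `^ _) => x y z w p q x0 y0.
by field; rewrite x0 y0.
Qed.

(** The kernel solves k = I - lam I k, where I is the fractional integral kernel and products are
    convolutions: the recurrence at [nu = rho] combined with the convolution formula at
    [c = rho]. *)
Lemma ml_ker_resolvent (t : R) : ml_ker t =
  (Gamma rho)^-1 * pow_ker rho t -
  lam * ((Gamma rho)^-1 * \int[mu]_s (pow_ker rho (t - s) * ml_ker s)).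
Proof.
have G0 := Gamma_gt0 rho0.
have [t0|t0] := ltP 0 t; last first.
  rewrite ml_ker0 // pow_ker0 // mulr0 sub0r.
  under eq_Rintegral => s _.
    rewrite (_ : _ * _ = 0); last first.
      have [s0|s0] := ltP 0 s; last by rewrite ml_ker0 // mulr0.
      by rewrite pow_ker0 ?mul0r //; lra.
    over.
  by rewrite Rintegral_cst // mul0r !mulr0 oppr0.
rewrite pow_ker_conv_ml_ker // /ml_ker ml_rec // pow_kerE //.
have -> : rho + rho - 1 = (rho - 1) + rho by ring.
rewrite (powRD_pos (rho - 1) rho) //; field.
by rewrite gt_eqF.
Qed.

Lemma mittag_leffler1E (t : R) : 0 < t ->
  mittag_leffler rho 1 (- lam * t `^ rho) = 1 - lam * \int[mu]_s (pow_ker 1 (t - s) * ml_ker s).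
Proof.
move=> t0; rewrite pow_ker_conv_ml_ker // ml_rec // Gamma1 addrK.
by rewrite invr1 mul1r !mulNr mulrA.
Qed.
End MLKernel.

(** * Convolutions and the Duhamel integral *)

Section Convolution.
Variable R : realType.
Notation mu := (@lebesgue_measure R).

(* The kernels vanish on ]-oo, 0], and [cut w] is w restricted to ]0, +oo[, so
   that the convolution on the line is an integral over [0, t]. *)
Definition conv (k w : R -> R) (t : R) : R := \int[mu]_s (k (t - s) * w s).

Definition cut (w : R -> R) (s : R) : R := (0 < s)%R%:R * w s.

(** The bound stops at [T] because the constant for [ml_ker] grows with [T]. Where [pow_ker]
    vanishes it forces [k] to vanish too. *)
Definition dominated_ker (k : R -> R) (a C T : R) : Prop :=
  forall x, x <= T -> `|k x| <= C * pow_ker a x.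

Lemma dominated_ker_eq0 k a C T x : dominated_ker k a C T -> x <= T -> x <= 0 -> k x = 0.
Proof.
move=> h xT x0; apply/eqP; rewrite -normr_le0.
by have := h x xT; rewrite pow_ker0 // mulr0.
Qed.

Lemma measurable_shift (k : R -> R) (t : R) : measurable_fun [set: R] k ->
  measurable_fun [set: R] (fun s => k (t - s)).
Proof. by move=> mk; apply: measurableT_comp => //; exact: measurable_funB. Qed.

Lemma measurable_cut (w : R -> R) : measurable_fun [set: R] w ->
  measurable_fun [set: R] (cut w).
Proof. by move=> mw; apply: measurable_funM => //; exact: measurable_pos. Qed.

Lemma norm_cut_le (w : R -> R) C s : (forall x, `|w x| <= C) -> `|cut w s| <= C * pow_ker 1 s.
Proof.
move=> h; rewrite /cut /pow_ker subrr powRr0 mulr1 normrM normr_nat mulrC.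
by rewrite ler_wpM2r.
Qed.

Lemma integrable_conv (k w : R -> R) a b C D t : 0 < a -> 0 < b ->
  measurable_fun [set: R] k -> measurable_fun [set: R] w ->
  dominated_ker k a C t -> (forall x, `|w x| <= D * pow_ker b x) ->
  mu.-integrable setT (EFin \o (fun s => k (t - s) * w s)).
Proof.
move=> a0 b0 mk mw hk hw.
apply: (@le_integrable _ _ _ mu _ measurableT _
  (EFin \o (fun s => (C * D) * (pow_ker a (t - s) * pow_ker b s)))).
- by apply/measurable_EFinP; apply: measurable_funM => //; exact: measurable_shift.
- move=> s _ /=; rewrite !lee_fin; apply: le_trans (ler_norm _).
  have [s0|s0] := leP s 0.
    have -> : w s = 0.
      by apply/eqP; rewrite -normr_le0; have := hw s; rewrite (pow_ker0 _ s0) mulr0.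
    by rewrite mulr0 normr0 (pow_ker0 _ s0) !mulr0.
  rewrite normrM mulrACA; apply: ler_pM => //.
  by apply: hk; lra.
by apply: integrableZ; exact: integrable_pow_conv.
Qed.

Lemma conv_shift (k1 k2 : R -> R) t r :
  mu.-integrable setT (EFin \o (fun s => k1 (t - r - s) * k2 s)) ->
  mu.-integrable setT (EFin \o (fun s => k1 (t - s) * k2 (s - r))) /\
  \int[mu]_s (k1 (t - s) * k2 (s - r)) = conv k1 k2 (t - r).
Proof.
move=> hi.
have e : (fun s => k1 (t - r - (1 * s + - r)) * k2 (1 * s + - r)) =
         (fun s => k1 (t - s) * k2 (s - r)).
  by apply/funext => s; rewrite mul1r; congr (k1 _ * _); ring.
have n0 : (1 : R) != 0 by exact: oner_neq0.
split; first by have := integrable_affine (- r) n0 hi; rewrite e.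
by rewrite /conv (integral_affine (- r) n0 hi) normr1 mul1r e.
Qed.

Lemma convC (k w : R -> R) t :
  mu.-integrable setT (EFin \o (fun s => k (t - s) * w s)) ->
  conv k w t = \int[mu]_s (k s * w (t - s)).
Proof.
move=> hi; have n0 : (-1 : R) != 0 by rewrite oppr_eq0 oner_neq0.
rewrite /conv (integral_affine t n0 hi) normrN1 mul1r.
by apply: eq_Rintegral => s _; rewrite mulN1r; congr (k _ * w _); ring.
Qed.

Lemma integral_EFin_Rintegral (f : R -> R) : mu.-integrable setT (EFin \o f) ->
  (\int[mu]_x (f x)%:E = (\int[mu]_x f x)%R%:E)%E.
Proof. by move=> fi; rewrite /Rintegral fineK // (integrable_fin_num _ fi). Qed.

Lemma conv_pow_ker (a b u : R) : 0 < a -> 0 < b ->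
  conv (pow_ker a) (pow_ker b) u =
  Gamma a * Gamma b / Gamma (a + b) * pow_ker (a + b) u.
Proof.
move=> a0 b0; have [u0|u0] := ltP 0 u.
  by rewrite /conv Rintegral_pow_conv // pow_kerE // mulrC.
rewrite (pow_ker0 _ u0) mulr0 /conv.
under eq_Rintegral => s _.
  rewrite (_ : _ * _ = 0); last first.
    have [s0|s0] := leP s 0; first by rewrite (pow_ker0 _ s0) mulr0.
    by rewrite (@pow_ker0 _ _ (u - s)) ?mul0r //; lra.
  over.
by rewrite Rintegral_cst // mul0r.
Qed.

(** The dominating function for the Fubini argument in [conv_assoc]. The integrand is nonnegative,
    so Tonelli applies: integrating in the first variable leaves a multiple of [pow_ker (a + b)]
    against [pow_ker 1]. *)
Lemma integrable_pow_conv3 (a b t : R) : 0 < a -> 0 < b -> 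
  (mu \x mu)%E.-integrable setT (EFin \o (fun p : R * R =>
     pow_ker a (t - p.1) * pow_ker b (p.1 - p.2) * pow_ker 1 p.2)).
Proof.
move=> a0 b0; set D := fun p : R * R => _.
have mD : measurable_fun [set: R * R] D.
  apply: measurable_funM; last first.
    by apply: measurableT_comp; [exact: measurable_pow_ker | exact: measurable_snd].
  apply: measurable_funM; apply: measurableT_comp; try exact: measurable_pow_ker.
    by apply: measurable_funB.
  exact: measurable_funB.
have D0 p : 0 <= D p.
  by apply: mulr_ge0; [apply: mulr_ge0|]; exact: pow_ker_ge0.
apply/integrable21ltyP; first exact/measurable_EFinP.
set B := Gamma a * Gamma b / Gamma (a + b).
have e r : (\int[mu]_s `|(EFin \o D) (s, r)| =
    (B * (pow_ker (a + b) (t - r) * pow_ker 1 r))%:E)%E.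
  have [h1 h2] := conv_shift (@integrable_pow_conv _ a b (t - r) a0 b0).
  have h3 := integrableZ (pow_ker 1 r) h1.
  transitivity (\int[mu]_s (pow_ker 1 r * (pow_ker a (t - s) * pow_ker b (s - r)))%:E)%E.
    by apply: eq_integral => s _; rewrite gee0_abs ?lee_fin // /D mulrC.
  rewrite (integral_EFin_Rintegral h3) (RintegralZl _ measurableT h1) h2 conv_pow_ker //.
  by congr EFin; rewrite -/B; ring.
under eq_integral do rewrite e.
rewrite integral_EFin_Rintegral ?ltry //.
by apply: integrableZ; apply: integrable_pow_conv => //; exact: addr_gt0.
Qed.

Section Swap.
Variables (k1 k2 w : R -> R) (a b C1 C2 C3 t : R).
Hypotheses (a0 : 0 < a) (b0 : 0 < b) (t0 : 0 < t).
Hypotheses (mk1 : measurable_fun [set: R] k1) (mk2 : measurable_fun [set: R] k2)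
  (mw : measurable_fun [set: R] w).
Hypotheses (hk1 : dominated_ker k1 a C1 t) (hk2 : dominated_ker k2 b C2 t)
  (hw : forall x, `|w x| <= C3 * pow_ker 1 x).

Let F (p : R * R) : R := k1 (t - p.1) * k2 (p.1 - p.2) * w p.2.

Let w0 r : r <= 0 -> w r = 0.
Proof.
by move=> r0; apply/eqP; rewrite -normr_le0; have := hw r; rewrite pow_ker0 // mulr0.
Qed.

Let k10 s : t < s -> k1 (t - s) = 0.
Proof. by move=> st; apply: (dominated_ker_eq0 hk1); (have := t0; lra). Qed.

Let F_le s r :
  `|F (s, r)| <= C1 * C2 * C3 * (pow_ker a (t - s) * pow_ker b (s - r) * pow_ker 1 r).
Proof.
rewrite /F /=.
have [r0|r0] := leP r 0.
  by rewrite w0 // (pow_ker0 _ r0) !mulr0 normr0.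
have [ts|st] := ltP t s.
  by rewrite k10 // !mul0r normr0 (@pow_ker0 _ _ (t - s)) ?mul0r ?mulr0 //; (have := t0; lra).
have [sr|rs] := leP s r.
  have sr0 : s - r <= 0 by (have := t0; lra).
  rewrite (dominated_ker_eq0 hk2 _ sr0) ?mulr0 ?mul0r ?normr0; last (have := t0; lra).
  by rewrite (pow_ker0 _ sr0) mulr0 mul0r mulr0.
rewrite !normrM (_ : _ * _ * _ * _ = (C1 * pow_ker a (t - s)) * (C2 * pow_ker b (s - r)) * (C3 * pow_ker 1 r)); last by ring.
apply: ler_pM; rewrite ?mulr_ge0 //; apply: ler_pM => //.
  by apply: hk1; (have := t0; lra).
by apply: hk2; (have := t0; lra).
Qed.

Let mF : measurable_fun [set: R * R] F.
Proof.
apply: measurable_funM; last by apply: measurableT_comp => //; exact: measurable_snd.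
apply: measurable_funM; apply: measurableT_comp => //; exact: measurable_funB.
Qed.

Let F_prod_integrable : (mu \x mu)%E.-integrable setT (EFin \o F).
Proof.
have hi := integrable_pow_conv3 t a0 b0.
have hZ := integrableZl measurableT (C1 * C2 * C3) hi.
apply: (le_integrable measurableT _ _ hZ); first exact/measurable_EFinP.
move=> [s r] _; rewrite lee_fin.
exact: le_trans (F_le s r) (ler_norm _).
Qed.

Let F1 s : mu.-integrable setT (EFin \o (fun r => F (s, r))) /\
  \int[mu]_r F (s, r) = k1 (t - s) * conv k2 w s.
Proof.
have [ts|st] := ltP t s.
  rewrite (_ : (fun r => F (s, r)) = cst 0); last first.
    by apply/funext => r; rewrite /F /= k10 // !mul0r.
  by rewrite k10 // Rintegral_cst // !mul0r; split=> //; exact: integrable0.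
have hi : mu.-integrable setT (EFin \o (fun r => k2 (s - r) * w r)).
  apply: (integrable_conv b0 ltr01 mk2 mw _ hw) => x xs.
  by apply: hk2; exact: le_trans xs st.
rewrite (_ : (fun r => F (s, r)) = fun r => k1 (t - s) * (k2 (s - r) * w r)); last first.
  by apply/funext => r; rewrite /F /= mulrA.
by split; [exact: integrableZ | rewrite RintegralZl].
Qed.

Let F2 r : mu.-integrable setT (EFin \o (fun s => F (s, r))) /\
  \int[mu]_s F (s, r) = w r * conv k1 k2 (t - r).
Proof.
have [r0|r0] := leP r 0.
  rewrite (_ : (fun s => F (s, r)) = cst 0); last first.
    by apply/funext => s; rewrite /F /= w0 // mulr0.
  by rewrite w0 // Rintegral_cst // !mul0r; split=> //; exact: integrable0.
have hi : mu.-integrable setT (EFin \o (fun s => k1 (t - r - s) * k2 s)).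
  (* The bound on [k2] stops at [t]; beyond it [k1 (t - r - s)] vanishes, so [k2] may be cut off
     there. *)
  pose k2' x := (x <= t)%R%:R * k2 x.
  have -> : (fun s => k1 (t - r - s) * k2 s) = (fun s => k1 (t - r - s) * k2' s).
    apply/funext => s; rewrite /k2'; case: leP => st; first by rewrite mul1r.
    by rewrite (dominated_ker_eq0 hk1) ?mul0r //; (have := t0; lra).
  have mk2' : measurable_fun [set: R] k2'.
    apply: measurable_funM => //.
    rewrite (_ : (fun x => _) = \1_(`]-oo, t] : set R)); first exact: measurable_indic.
    by apply/funext => x; rewrite indicE mem_setE in_itv /=.
  apply: (integrable_conv a0 b0 mk1 mk2' _ (D := C2)).
    by move=> x xt; apply: hk1; (have := t0; lra).
  move=> x; rewrite /k2'; case: (leP x t) => xt; first by rewrite mul1r hk2.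
  rewrite mul0r normr0 mulr_ge0 ?pow_ker_ge0 //.
  have := hk2 (lexx t); rewrite pow_kerE // => h.
  by rewrite -(pmulr_lge0 _ (powR_gt0 (b - 1) t0)); exact: le_trans h.
have [h1 h2] := conv_shift hi.
rewrite (_ : (fun s => F (s, r)) = fun s => w r * (k1 (t - s) * k2 (s - r))); last first.
  by apply/funext => s; rewrite /F /= mulrC.
by split; [exact: integrableZ | rewrite RintegralZl // h2].
Qed.

Lemma conv_assoc : conv k1 (conv k2 w) t = conv (conv k1 k2) w t.
Proof.
have := Fubini F_prod_integrable.
rewrite /conv /Rintegral => h; congr fine.
transitivity (\int[mu]_s \int[mu]_r (F (s, r))%:E)%E.
  by apply: eq_integral => s _; have [h1 <-] := F1 s; rewrite integral_EFin_Rintegral.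
rewrite h; apply: eq_integral => r _; have [h1 h2] := F2 r.
by rewrite (integral_EFin_Rintegral h1) h2 mulrC.
Qed.
End Swap.

Lemma bounded_itv (f : R -> R) (x y : R) : {within `[x, y], continuous f} ->
  exists M : R, 0 <= M /\ forall z, x <= z <= y -> `|f z| <= M.
Proof.
move=> cf; have [xy|yx] := leP x y; last first.
  by exists 0; split => // z; lra.
have cf' : {within `[x, y], continuous (fun z => `|f z|)}.
  by move=> z; apply: cvg_norm; exact: cf.
have [c cI h] := EVT_max xy cf'.
by exists `|f c|; split => // z zI; apply: h; rewrite in_itv /=.
Qed.

Lemma cut_pos w s : 0 < s -> cut w s = w s.
Proof. by rewrite /cut => ->; rewrite mul1r. Qed.

Lemma cut_neg w s : s <= 0 -> cut w s = 0.
Proof. by rewrite /cut; case: ltP => //; rewrite mul0r. Qed.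

Lemma cut_continuous (w : R -> R) (x : R) : x != 0 -> {for x, continuous w} -> {for x, continuous (cut w)}.
Proof.
move=> xn0 cw; suff : cut w y @[y --> x] --> cut w x by [].
have /orP[x0|x0] : (x < 0) || (0 < x) by rewrite -neq_lt.
  rewrite (cut_neg _ (ltW x0)).
  have h0 : (0 : R) @[y --> x] --> (0 : R) by exact: cvg_cst.
  apply: cvg_trans h0.
  apply: near_eq_cvg; near=> y; rewrite cut_neg //.
  by apply: ltW; near: y; exact: lt_nbhsl.
rewrite cut_pos //; apply: cvg_trans cw.
apply: near_eq_cvg; near=> y; rewrite cut_pos //.
by near: y; exact: lt_nbhsr.
Unshelve. all: by end_near. Qed.

(** By [convC] the dependence on [t] is moved into the bounded factor [cut w (t - s)]. It is
    continuous in [t] except at [s = t], where [cut w] may jump, so dominated convergence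
    applies. *)
Lemma conv_continuous (k w : R -> R) (a D : R) : 0 < a ->
  measurable_fun [set: R] k -> (forall T, exists C, dominated_ker k a C T) ->
  continuous w -> (forall x, `|w x| <= D) -> continuous (conv k (cut w)).
Proof.
move=> a0 mk dk cw wD t.
have mw : measurable_fun [set: R] w by exact: continuous_measurable_fun.
apply/(@cvg_nbhsP _ R^o) => u ut.
(* Only a tail of the sequence is kept, so that the kernel bound up to [t + 1] serves for all of its
   terms. *)
have [N uN] : exists N, forall n, u (n + N)%N < t + 1.
  move/cvgrPdist_lt : (ut) => /(_ _ ltr01)[N _ uN]; exists N => n.
  by have := uN _ (leq_addl n N); rewrite /= ltr_norml => /andP[]; lra.
rewrite -(cvg_shiftn N).
have [C hC] := dk (t + 1).
have D0 : 0 <= D by apply: le_trans (wD 0).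
have hi v : v <= t + 1 -> conv k (cut w) v = \int[mu]_s (k s * cut w (v - s)).
  move=> vt; rewrite convC //.
  apply: (integrable_conv a0 ltr01 mk (measurable_cut mw) _ (fun x => norm_cut_le x wD)).
  by move=> x xv; apply: hC; lra.
rewrite hi; last lra.
rewrite (_ : [sequence _]_n = fun n => \int[mu]_s (k s * cut w (u (n + N)%N - s))); last first.
  by apply/funext => n; exact: hi (ltW (uN n)).
apply: (@Rdominated_cvg _ _ _ (fun s => C * D * ((0 < s < t + 1)%R%:R * s `^ (a - 1)))).
- move=> n; apply: measurable_funM => //.
  by apply: (measurable_shift (k := cut w)); exact: measurable_cut.
- apply: measurable_funM => //.
  by apply: (measurable_shift (k := cut w)); exact: measurable_cut.
- exists [set t]; split => //; first exact: lebesgue_measure_set1.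
  move=> s /=; apply: contra_notP => /eqP st; apply: cvgM; first exact: cvg_cst.
  apply: (cvg_comp (fun n => u (n + N)%N - s) (cut w)); last first.
    by apply: cut_continuous; [rewrite subr_eq0 eq_sym | exact: cw].
  apply: cvgB; last exact: cvg_cst.
  by have := ut; rewrite -(cvg_shiftn N).
- apply: integrableZ.
  have [t1|t1] := ltP 0 (t + 1); first exact: integrable_pos_powR.
  rewrite (_ : (fun x => _) = cst 0); first exact: integrable0.
  by apply/funext => s; case: andP => [[]|]; [lra | rewrite mul0r].
- move=> n s; rewrite normrM.
  have ind0 : s < t + 1 -> `|k s| <= C * ((0 < s < t + 1)%R%:R * s `^ (a - 1)).
    by move=> st; have := hC _ (ltW st); rewrite /pow_ker st andbT.
  have ind1 : 0 <= C * ((0 < s < t + 1)%R%:R * s `^ (a - 1)).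
    have [st|ts] := ltP s (t + 1); first by have := ind0 st; rewrite st; exact: le_trans.
    by rewrite andbF mul0r mulr0.
  have [us|su] := leP (u (n + N)%N) s.
    by rewrite cut_neg ?subr_le0 // normr0 mulr0 mulrAC mulr_ge0.
  rewrite mulrAC; apply: ler_pM => //; first by apply: ind0; have := uN n; lra.
  by rewrite cut_pos ?subr_gt0.
Qed.
Lemma integrable_conv_le (k w : R -> R) (a b C D t : R) : 0 < a -> 0 < b -> 0 < t ->
  measurable_fun [set: R] k -> measurable_fun [set: R] w ->
  dominated_ker k a C t -> (forall x, x <= t -> `|w x| <= D * pow_ker b x) ->
  mu.-integrable setT (EFin \o (fun s => k (t - s) * w s)).
Proof.
move=> a0 b0 t0 mk mw hk hw; pose w' x := (x <= t)%R%:R * w x.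
have -> : (fun s => k (t - s) * w s) = (fun s => k (t - s) * w' s).
  apply/funext => s; rewrite /w'; case: leP => st; first by rewrite mul1r.
  by rewrite (dominated_ker_eq0 hk) ?mul0r //; lra.
have mw' : measurable_fun [set: R] w'.
  apply: measurable_funM => //.
  rewrite (_ : (fun x => _) = \1_(`]-oo, t] : set R)); first exact: measurable_indic.
  by apply/funext => x; rewrite indicE mem_setE in_itv /=.
have D0 : 0 <= D.
  have := hw t (lexx t); rewrite pow_kerE // => h.
  by rewrite -(pmulr_lge0 _ (powR_gt0 (b - 1) t0)); exact: le_trans h.
apply: (integrable_conv a0 b0 mk mw' hk (D := D)) => x.
rewrite /w'; case: (leP x t) => xt; first by rewrite mul1r hw.
by rewrite mul0r normr0 mulr_ge0 ?pow_ker_ge0.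
Qed.

Lemma convZD (k1 k2 w : R -> R) (x y t : R) :
  mu.-integrable setT (EFin \o (fun s => k1 (t - s) * w s)) ->
  mu.-integrable setT (EFin \o (fun s => k2 (t - s) * w s)) ->
  conv (fun r => x * k1 r + y * k2 r) w t = x * conv k1 w t + y * conv k2 w t.
Proof.
move=> i1 i2; rewrite /conv -!RintegralZl // -RintegralD //; try exact: integrableZ.
by apply: eq_Rintegral => s _; rewrite mulrDl !mulrA.
Qed.

Lemma convDr (k w1 w2 : R -> R) (x y t : R) :
  mu.-integrable setT (EFin \o (fun s => k (t - s) * w1 s)) ->
  mu.-integrable setT (EFin \o (fun s => k (t - s) * w2 s)) ->
  conv k (fun r => x * w1 r + y * w2 r) t = x * conv k w1 t + y * conv k w2 t.
Proof.
move=> i1 i2; rewrite /conv -!RintegralZl // -RintegralD //; try exact: integrableZ.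
by apply: eq_Rintegral => s _; rewrite mulrDr; congr (_ + _); rewrite mulrCA.
Qed.

Lemma dominated_pow_ker (a T : R) : dominated_ker (pow_ker a) a 1 T.
Proof. by move=> x _; rewrite mul1r ger0_norm ?pow_ker_ge0. Qed.

Section Resolvent.
Variables (rho lam : R) (rho0 : 0 < rho) (lam0 : 0 < lam).

Lemma dominated_ml_ker (T : R) :
  dominated_ker (ml_ker rho lam) rho (mittag_leffler rho rho (lam * T `^ rho)) T.
Proof. by move=> x xT; rewrite mulrC; exact: norm_ml_ker_le. Qed.

Variables (g : R -> R) (D : R) (cg : continuous g) (gD : forall x, `|g x| <= D).

Definition mild (t : R) : R := conv (ml_ker rho lam) (cut g) t.

(** The Riemann-Liouville integral of order [rho], extended by 0 to negative [t]. *)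
Definition frac_int (w : R -> R) (t : R) : R :=
  (Gamma rho)^-1 * conv (pow_ker rho) (cut w) t.

Lemma mild_continuous : continuous mild.
Proof.
apply: (conv_continuous rho0 (measurable_ml_ker lam rho0) _ cg gD) => T.
by exists (mittag_leffler rho rho (lam * T `^ rho)); exact: dominated_ml_ker.
Qed.

Lemma mild0 (t : R) : t <= 0 -> mild t = 0.
Proof.
move=> t0; rewrite /mild /conv (_ : (fun s => _) = cst 0) ?Rintegral_cst ?mul0r //.
apply/funext => s; have [s0|s0] := leP s 0; first by rewrite cut_neg // mulr0.
by rewrite ml_ker0 ?mul0r //; lra.
Qed.

Lemma cut_mild : cut mild = mild.
Proof.
apply/funext => s; have [s0|s0] := leP s 0; first by rewrite cut_neg // mild0.
by rewrite cut_pos.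
Qed.

Let mg : measurable_fun [set: R] g.
Proof. exact: continuous_measurable_fun. Qed.

(** The resolvent identity of the kernel, convolved with [g]; associativity turns the iterated
    convolution into the fractional integral of [mild]. *)
Lemma mild_resolvent (t : R) : 0 < t ->
  mild t = frac_int (fun s => g s - lam * mild s) t.
Proof.
move=> t0; have G0 := Gamma_gt0 rho0.
have mm := measurable_ml_ker lam rho0.
have mp := @measurable_pow_ker R rho.
have mcg := measurable_cut mg.
have hc x := norm_cut_le x gD.
have mb : measurable_fun [set: R] mild by apply: continuous_measurable_fun; exact: mild_continuous.
have [M [M0 hM]] := @bounded_itv mild 0 t (continuous_subspaceT mild_continuous).
have hb x : x <= t -> `|mild x| <= M * pow_ker 1 x.
  move=> xt; have [x0|x0] := leP x 0; first by rewrite mild0 // pow_ker0 // normr0 mulr0.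
  by rewrite pow_kerE // subrr powRr0 mulr1 hM // xt ltW.
have i1 := integrable_conv rho0 ltr01 mp mcg (@dominated_pow_ker rho t) hc.
have i2 := integrable_conv_le rho0 ltr01 t0 mp mb (@dominated_pow_ker rho t) hb.
have i3 := integrable_conv rho0 ltr01 mm mcg (@dominated_ml_ker t) hc.
have -> : frac_int (fun s => g s - lam * mild s) t =
    (Gamma rho)^-1 * (1 * conv (pow_ker rho) (cut g) t + (- lam) * conv (pow_ker rho) mild t).
  rewrite -convDr //; congr (_ * conv _ _ t); apply/funext => s.
  by rewrite /cut -{2}cut_mild /cut; ring.
have A := conv_assoc rho0 rho0 t0 mp mm mcg (@dominated_pow_ker rho t) (@dominated_ml_ker t) hc.
rewrite -[conv (pow_ker rho) mild t]/(conv (pow_ker rho) (conv (ml_ker rho lam) (cut g)) t) A.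
(* The resolvent identity, solved for the convolution. *)
have -> : conv (pow_ker rho) (ml_ker rho lam) =
    (fun r => lam^-1 * pow_ker rho r + (- (Gamma rho / lam)) * ml_ker rho lam r).
  apply/funext => r; rewrite (ml_ker_resolvent rho0 lam0) -/(conv _ _ r).
  by field; rewrite !gt_eqF.
rewrite convZD // -/(mild t); field.
by rewrite !gt_eqF.
Qed.

End Resolvent.

(** The integrands agree on the open interval; the end points, where the power of 0 takes a
    conventional value, are negligible. *)
Lemma duhamelE (rho lam : R) (g : R -> R) (t : R) : 0 < rho ->
  measurable_fun [set: R] g -> duhamel rho lam g t = mild rho lam g t.
Proof.
move=> rho0 mg; rewrite /duhamel /mild /conv.
pose f s := (t - s) `^ (rho - 1) * mittag_leffler rho rho (- lam * (t - s) `^ rho) * g s.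
pose h s := ml_ker rho lam (t - s) * cut g s.
have mh : measurable_fun [set: R] h.
  apply: measurable_funM; last exact: measurable_cut.
  by apply: (measurable_shift (k := ml_ker rho lam)); exact: measurable_ml_ker.
have fh : {in `]0, t[, f =1 h}.
  move=> s; rewrite in_itv /= => /andP[s0 st].
  by rewrite /f /h /ml_ker cut_pos // pow_kerE ?subr_gt0.
have mf : measurable_fun `]0, t[ f.
  apply: (@eq_measurable_fun _ _ _ _ _ h); last exact: measurable_funTS.
  by move=> s; rewrite inE => /= sI; rewrite fh.
rewrite /Rintegral (@eq_integral_itv_bounded _ _ _ h f) //; last exact: measurable_funTS.
rewrite [in LHS]integral_mkcond; congr fine; apply: eq_integral => s _.
rewrite patchE mem_setE in_itv /=; case: ifPn => //.
rewrite negb_and -!ltNge => /orP[s0|ts].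
  by rewrite /h cut_neg ?mulr0 // ltW.
by rewrite /h ml_ker0 ?mul0r //; lra.
Qed.

Lemma E_rho_mild (rho : R) (lam : nat -> R) k (t : R) : 0 < rho -> 0 < lam k -> 0 <= t ->
  E_rho rho lam k t = 1 - lam k * mild rho (lam k) (cst 1) t.
Proof.
move=> rho0 lam0; rewrite le_eqVlt => /predU1P[<-|t0].
  by rewrite /E_rho powR0 ?gt_eqF // mulr0 ml0 // Gamma1 invr1 mild0 // mulr0 subr0.
rewrite /E_rho mittag_leffler1E //; congr (1 - _ * _).
have -> : mild rho (lam k) (cst 1) t = conv (ml_ker rho (lam k)) (pow_ker 1) t.
  congr conv; apply/funext => s; rewrite /cut /pow_ker subrr powRr0 //.
rewrite convC; first by apply: eq_Rintegral => s _; rewrite mulrC.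
apply: (integrable_conv rho0 ltr01 (measurable_ml_ker (lam k) rho0) _ (dominated_ml_ker rho0 lam0 (T := t)) (D := 1)).
  exact: measurable_pow_ker.
by move=> x; rewrite mul1r ger0_norm ?pow_ker_ge0.
Qed.
End Convolution.

(** * Riemann-Stieltjes sums and the maximum principle *)

(** Heine's theorem with only one of the two points confined to the interval, from the covering form
    of compactness. *)
Lemma uniform_continuous_itv (R : realType) (h : R -> R) (a b e : R) :
  continuous h -> 0 < e ->
  exists2 d : R, 0 < d & forall x y, a <= x <= b -> `|y - x| < d -> `|h y - h x| < e.
Proof.
move=> ch e0.
have /compact_near_coveringP cov := @segment_compact R a b.
have [d /= d0 H] : \forall d \near (0 : R)^'+, `[a, b]%classic `<=`
    (fun x => forall y, `|y - x| < d -> `|h y - h x| < e).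
  apply: cov => x _.
  have e2 : 0 < e / 2 by rewrite divr_gt0.
  have /cvgrPdist_lt /(_ _ e2) [r /= r0 hr] := ch x.
  exists (ball x (r / 2), [set d | d < r / 2]); first split => /=.
  - by apply: nbhsx_ballx; rewrite divr_gt0.
  - by apply: nbhs_right_lt; rewrite divr_gt0.
  move=> [x' d] /= [xx' dr] y yx'; rewrite /ball /= in xx'.
  have h1 : `|h x - h x'| < e / 2 by apply: hr => /=; lra.
  have h2 : `|h x - h y| < e / 2.
    apply: hr => /=; rewrite distrC; apply: le_lt_trans (ler_distD x' _ _) _.
    by rewrite [`|x' - x|]distrC; lra.
  apply: le_lt_trans (ler_distD (h x) _ _) _.
  by rewrite [`|h y - h x|]distrC; lra.
exists (d / 2); first by rewrite divr_gt0.
move=> x y xab; apply: (H (d / 2) _ _ x) => //=.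
  by rewrite sub0r normrN ger0_norm ?divr_ge0 ?(ltW d0) //; lra.
by rewrite divr_gt0.
Qed.
Section RealStieltjes.
Variable R : realType.
Notation mu := (@lebesgue_measure R).
Implicit Types (phi h : R -> R) (a b d l : R).

Definition rsum (phi h : R -> R) (a : R) (x y : seq R) : R :=
  \sum_(i < size x) phi (nth 0 y i) * (h (nth 0 x i) - h (nth 0 (a :: x) i)).

Definition fine_mesh (a d : R) (x : seq R) : Prop :=
  forall i, (i < size x)%N -> nth 0 x i - nth 0 (a :: x) i < d.

Definition rstieltjes (phi h : R -> R) (a b l : R) : Prop :=
  forall eps : R, 0 < eps -> exists2 d : R, 0 < d &
    forall x y : seq R, tagged_partition a b x y -> fine_mesh a d x ->
      `|rsum phi h a x y - l| < eps.

Lemma rsum_cons phi h a (x0 y0 : R) (x y : seq R) :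
  rsum phi h a (x0 :: x) (y0 :: y) = phi y0 * (h x0 - h a) + rsum phi h x0 x y.
Proof. by rewrite /rsum /= big_ord_recl. Qed.

Lemma tagged_partition_cons a b (x0 y0 : R) (x y : seq R) :
  tagged_partition a b (x0 :: x) (y0 :: y) <->
  [/\ a < x0, a <= y0 <= x0 & tagged_partition x0 b x y].
Proof.
split=> [[[/= /andP[ax0 p] l] sz H]|[ax0 ay [[p l] sz H]]].
  split => //; first exact: (H 0%N).
  split => //; first by case: sz.
  by move=> i ix; exact: (H i.+1).
split; rewrite /= ?sz //; first by split => //=; rewrite ax0.
by case => [|i] //= ix; exact: H.
Qed.

Lemma tagged_partition_nil a b (y : seq R) : tagged_partition a b [::] y <-> a = b /\ y = [::].
Proof.
by split=> [[[_ /eqP /= ->] /size0nil -> _]|[-> ->]] //.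
Qed.

Lemma tagged_partition_le a b (x y : seq R) : tagged_partition a b x y -> a <= b.
Proof.
elim: x y a => [|x0 x IH] [|y0 y] a.
- by move/tagged_partition_nil => [-> _].
- by move/tagged_partition_nil => [_ //].
- by case=> _ /=.
- by move/tagged_partition_cons => [ax _ /IH xb]; exact: le_trans (ltW ax) xb.
Qed.

Lemma fine_mesh_cons a d (x0 : R) (x : seq R) :
  fine_mesh a d (x0 :: x) <-> x0 - a < d /\ fine_mesh x0 d x.
Proof.
split=> [H|[h H] [|i] //= ix]; last exact: H.
by split; [exact: (H 0%N) | move=> i ix; exact: (H i.+1)].
Qed.

Lemma fine_tagged_partition (a b d : R) : 0 < d -> a <= b ->
  exists x y, tagged_partition a b x y /\ fine_mesh a d x.
Proof.
move=> d0; have d2 : 0 < d / 2 by rewrite divr_gt0.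
have [n] : exists n : nat, b - a < n%:R * (d / 2).
  exists (Num.bound `|(b - a) / (d / 2)|); rewrite -ltr_pdivrMr //.
  by apply: le_lt_trans (ler_norm _) (archi_boundP _).
elim: n a => [|n IH] a; first by rewrite mul0r; lra.
rewrite -natr1 mulrDl mul1r => nb; rewrite le_eqVlt => /predU1P[->|ab].
  by exists [::], [::]; split => //; exact/tagged_partition_nil.
(* The partition advances by [d / 2] until less than [d] remains; what remains is a single cell. *)
have [bd|db] := ltP (b - a) d.
  exists [:: b], [:: b]; split.
    by apply/tagged_partition_cons; split; rewrite ?lexx ?ltW //; exact/tagged_partition_nil.
  by apply/fine_mesh_cons; split.
have [||x [y [p m]]] := IH (a + d / 2); [lra | lra |].
exists (a + d / 2 :: x), (a + d / 2 :: y); split.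
  by apply/tagged_partition_cons; split => //; lra.
by apply/fine_mesh_cons; split => //; lra.
Qed.

Lemma rstieltjes_unique phi h a b l l' : a <= b ->
  rstieltjes phi h a b l -> rstieltjes phi h a b l' -> l = l'.
Proof.
move=> ab H H'; apply/eqP; rewrite -subr_eq0 -normr_le0 leNgt; apply/negP => e0.
have e2 : 0 < `|l - l'| / 2 by rewrite divr_gt0.
have [d d0 Hd] := H _ e2; have [d' d'0 Hd'] := H' _ e2.
have [|x [y [p m]]] := @fine_tagged_partition a b (Num.min d d') _ ab.
  by rewrite lt_min d0.
have m1 : fine_mesh a d x.
  by move=> k ix; apply: lt_le_trans (m k ix) _; rewrite ge_min lexx.
have m2 : fine_mesh a d' x.
  by move=> k ix; apply: lt_le_trans (m k ix) _; rewrite ge_min lexx orbT.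
have h1 := Hd x y p m1; have h2 := Hd' x y p m2.
have : `|l - l'| <= `|l - rsum phi h a x y| + `|rsum phi h a x y - l'| by exact: ler_distD.
by rewrite (distrC l (rsum phi h a x y)) => h3; lra.
Qed.

(** An estimate on each cell adds up over the partition, because the increments of [L] and of [phi]
    telescope. *)
Lemma rsum_approx (phi h L : R -> R) (b e d a : R) (x y : seq R) :
  (forall u s v, a <= u -> u <= s <= v -> v <= b -> v - u < d ->
     `|phi s * (h v - h u) - (L v - L u)| <= e * (phi v - phi u)) ->
  tagged_partition a b x y -> fine_mesh a d x ->
  `|rsum phi h a x y - (L b - L a)| <= e * (phi b - phi a).
Proof.
elim: x y a => [|x0 x IH] [|y0 y] a H.
- by move=> /tagged_partition_nil [-> _] _; rewrite /rsum big_ord0 !subrr normr0 mulr0.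
- by move=> /tagged_partition_nil [_ //].
- by case=> _ /=.
move=> /tagged_partition_cons [ax ay p] /fine_mesh_cons [xd m].
have xb := tagged_partition_le p.
rewrite rsum_cons.
have -> : phi y0 * (h x0 - h a) + rsum phi h x0 x y - (L b - L a) =
  (phi y0 * (h x0 - h a) - (L x0 - L a)) + (rsum phi h x0 x y - (L b - L x0)) by ring.
apply: le_trans (ler_normD _ _) _.
have h1 := H a y0 x0 (lexx _) ay xb xd.
have h2 : `|rsum phi h x0 x y - (L b - L x0)| <= e * (phi b - phi x0).
  by apply: IH => // u s v xu; apply: H; exact: le_trans (ltW ax) xu.
by apply: le_trans (lerD h1 h2) _; rewrite -mulrDr; lra.
Qed.

Lemma rsum_ext phi h h' a b (x y : seq R) : (forall z, a <= z <= b -> h z = h' z) ->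
  tagged_partition a b x y -> rsum phi h a x y = rsum phi h' a x y.
Proof.
elim: x y a => [|x0 x IH] [|y0 y] a H.
- by rewrite /rsum !big_ord0.
- by move=> /tagged_partition_nil [_ //].
- by case=> _ /=.
move=> /tagged_partition_cons [ax ay p]; have xb := tagged_partition_le p.
rewrite !rsum_cons (IH y x0) //; last by move=> z zI; apply: H; lra.
by rewrite !H //; lra.
Qed.

Lemma rstieltjes_ext phi h h' a b l : (forall z, a <= z <= b -> h z = h' z) ->
  rstieltjes phi h a b l -> rstieltjes phi h' a b l.
Proof.
move=> hh H e e0; have [d d0 Hd] := H e e0; exists d => // x y p m.
by rewrite -(rsum_ext _ hh p); exact: Hd.
Qed.
End RealStieltjes.

(** * Stieltjes integrals of a smooth nondecreasing weight against a continuous function *)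

Section SmoothWeight.
Variable R : realType.
Notation mu := (@lebesgue_measure R).
Variables (phi dphi h : R -> R) (t : R).
Hypotheses (dphiE : forall x, x < t -> is_derive x 1 phi (dphi x)).
Hypotheses (cdphi : forall x, x < t -> {for x, continuous dphi}).
Hypotheses (dphi0 : forall x, x < t -> 0 <= dphi x).
Hypotheses (ch : continuous h).

Lemma integrable_weight (f : R -> R) (u v : R) : continuous f -> v < t ->
  mu.-integrable `[u, v] (EFin \o (fun x => dphi x * f x)).
Proof.
move=> cf vt; apply: continuous_compact_integrable; first exact: segment_compact.
apply: continuous_in_subspaceT => x; rewrite inE /= in_itv /= => /andP[_ xv].
by apply: cvgM; [apply: cdphi; exact: le_lt_trans vt | exact: cf].
Qed.

Lemma integrable_weightc (c u v : R) : v < t ->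
  mu.-integrable `[u, v] (EFin \o (fun x => c * dphi x)).
Proof.
move=> vt; rewrite (_ : (fun x => _) = (fun x => dphi x * cst c x)).
  by apply: integrable_weight => // x; exact: cvg_cst.
by apply/funext => x; rewrite mulrC.
Qed.

Lemma integrable_weight1 (u v : R) : v < t -> mu.-integrable `[u, v] (EFin \o dphi).
Proof.
move=> vt; rewrite (_ : dphi = (fun x => 1 * dphi x)); first exact: integrable_weightc.
by apply/funext => x; rewrite mul1r.
Qed.

Lemma Rintegral_weight1 (u v : R) : u <= v < t ->
  \int[mu]_(x in `[u, v]) dphi x = phi v - phi u.
Proof.
rewrite le_eqVlt => /andP[/predU1P[->|uv] vt].
  by rewrite set_itv1 Rintegral_set1 subrr.
rewrite /Rintegral (@continuous_FTC2 _ dphi phi) //.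
- apply: continuous_in_subspaceT => x; rewrite inE /= in_itv /= => /andP[_ xv].
  by apply: cdphi; exact: le_lt_trans vt.
- have c x : x < t -> {for x, continuous phi}.
    by move=> xt; apply: differentiable_continuous; apply/derivable1_diffP; have [] := dphiE xt.
  split.
  + by move=> x; rewrite in_itv /= => /andP[_ xv]; have [] := dphiE (lt_trans xv vt).
  + by apply: cvg_at_right_filter; apply: c; exact: lt_trans vt.
  + by apply: cvg_at_left_filter; apply: c.
- move=> x; rewrite in_itv /= => /andP[_ xv]; rewrite derive1E.
  by apply: derive_val; apply: dphiE; exact: lt_trans vt.
Qed.

Lemma weight_nondecreasing (u v : R) : u <= v < t -> phi u <= phi v.
Proof.
move=> /andP[uv vt]; rewrite -subr_ge0 -Rintegral_weight1 ?uv //.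
apply: Rintegral_ge0 => x; rewrite /= in_itv /= => /andP[_ xv].
by apply: dphi0; exact: le_lt_trans vt.
Qed.

(** The candidate for the Stieltjes integral of [phi] against [h]: the derivative falls on the
    weight, so continuity of [h] is enough. *)
Definition by_parts (a v : R) : R :=
  phi v * h v - phi a * h a - \int[mu]_(x in `[a, v]) (dphi x * h x).

Lemma Rintegral_itv_split (f : R -> R) (a u v : R) : a <= u <= v ->
  mu.-integrable `[a, v] (EFin \o f) ->
  \int[mu]_(x in `[a, v]) f x = \int[mu]_(x in `[a, u]) f x + \int[mu]_(x in `[u, v]) f x.
Proof.
move=> /andP[au uv] fi.
have := @Rintegral_itvB _ f (BLeft a) (BRight v) u fi.
rewrite !bnd_simp => /(_ au uv); rewrite Rintegral_itv_obnd_cbnd.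
  by move=> <-; rewrite addrC subrK.
apply: integrableS fi => // x /=; rewrite !in_itv /= => /andP[ux ->]; rewrite andbT; lra.
Qed.

Lemma by_partsB (a u v : R) : a <= u <= v -> v < t ->
  by_parts a v - by_parts a u =
  phi v * h v - phi u * h u - \int[mu]_(x in `[u, v]) (dphi x * h x).
Proof.
move=> auv vt; rewrite /by_parts (Rintegral_itv_split auv); last exact: integrable_weight.
by ring.
Qed.

Lemma Rintegral_weight_le (c e u v : R) : u <= v < t ->
  (forall x, u <= x <= v -> `|h x - c| <= e) ->
  `|\int[mu]_(x in `[u, v]) (dphi x * h x) - c * (phi v - phi u)| <= e * (phi v - phi u).
Proof.
move=> uvt hc; have /andP[uv vt] := uvt.
rewrite -(Rintegral_weight1 uvt) -RintegralZl //; last exact: integrable_weight1.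
rewrite -RintegralZl //; last exact: integrable_weight1.
have i1 := integrable_weightc c u vt; have i2 := integrable_weightc e u vt.
have i3 := integrable_weight u ch vt.
rewrite -RintegralB //.
have i4 : mu.-integrable `[u, v] (EFin \o (fun x => dphi x * h x - c * dphi x)).
  by have := integrableB _ i3 i1; apply.
apply: le_trans (le_normr_Rintegral _ i4) _ => //.
apply: le_Rintegral => //; first exact: (integrable_norm i4).
move=> x; rewrite /= in_itv /= => xI.
have dx : 0 <= dphi x by apply: dphi0; lra.
by rewrite [c * _]mulrC -mulrBr normrM mulrC (ger0_norm dx) ler_wpM2r ?hc.
Qed.

(** Splitting at the tag [s], the difference is the integral of dphi (h - h u) over [u, s] plus that
    of dphi (h - h v) over [s, v]. *)
Lemma by_parts_approx (a u s v e : R) : a <= u -> u <= s <= v -> v < t ->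
  (forall x, u <= x <= v -> `|h x - h u| <= e /\ `|h x - h v| <= e) ->
  `|phi s * (h v - h u) - (by_parts a v - by_parts a u)| <= e * (phi v - phi u).
Proof.
move=> au /andP[us sv] vt H.
rewrite by_partsB ?au ?(le_trans us sv) //.
rewrite (@Rintegral_itv_split _ u s v) ?us //; last exact: integrable_weight.
have h1 : `|\int[mu]_(x in `[u, s]) (dphi x * h x) - h u * (phi s - phi u)| <= e * (phi s - phi u).
  by apply: Rintegral_weight_le => [|x xI]; [lra | apply: (H x _).1; lra].
have h2 : `|\int[mu]_(x in `[s, v]) (dphi x * h x) - h v * (phi v - phi s)| <= e * (phi v - phi s).
  by apply: Rintegral_weight_le => [|x xI]; [lra | apply: (H x _).2; lra].
move: h1 h2; set A := Rintegral _ _ _; set B := Rintegral _ _ _ => h1 h2.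
rewrite (_ : _ - _ = (A - h u * (phi s - phi u)) + (B - h v * (phi v - phi s))); last by ring.
by apply: le_trans (ler_normD _ _) _; apply: le_trans (lerD h1 h2) _; lra.
Qed.

Lemma by_parts_start (a : R) : by_parts a a = 0.
Proof. by rewrite /by_parts set_itv1 Rintegral_set1 subrr subr0. Qed.

Lemma rstieltjes_by_parts (a b : R) : a <= b < t -> rstieltjes phi h a b (by_parts a b).
Proof.
move=> /andP[ab bt] e e0.
have p0 : 0 <= phi b - phi a by rewrite subr_ge0 weight_nondecreasing ?ab.
(* The summand 1 covers the case [phi b = phi a] and makes the final inequality strict. *)
pose e' := e / (phi b - phi a + 1).
have e'0 : 0 < e' by rewrite divr_gt0 //; lra.
have [d d0 Hd] := @uniform_continuous_itv R h a b e' ch e'0.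
exists d => // x y p m.
have := @rsum_approx _ phi h (by_parts a) b e' d a x y _ p m.
rewrite by_parts_start subr0 => h1.
have : e' * (phi b - phi a) < e.
  by rewrite /e' mulrAC ltr_pdivrMr; [nra | lra].
apply: le_lt_trans; apply: h1 => u s v au usv vb vu.
apply: by_parts_approx => //; first lra.
by move=> z zI; split; apply: ltW; apply: Hd; try lra; rewrite ltr_norml; lra.
Qed.

(** The bound depends neither on the partition nor on a modulus of continuity of [h], hence is
    uniform over all modes. The cell estimate holds with error 2 M on cells of any length. *)
Lemma rsum_bound (a b M : R) (x y : seq R) : b < t -> 0 <= phi a ->
  (forall z, `|h z| <= M) -> tagged_partition a b x y ->
  `|rsum phi h a x y| <= 4 * M * phi b.
Proof.
move=> bt pa hM p; have ab := tagged_partition_le p.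
have M0 : 0 <= M by apply: le_trans (hM 0).
have pab : phi a <= phi b by rewrite weight_nondecreasing ?ab.
(* [rsum_approx] asks for a mesh size; any number above the longest cell will do. *)
have [d d0 m] : exists2 d : R, 0 < d & fine_mesh a d x.
  exists (1 + \sum_(i < size x) `|nth 0 x i - nth 0 (a :: x) i|).
    by rewrite ltr_pwDl // sumr_ge0.
  move=> i ix; rewrite (bigD1 (Ordinal ix)) //=.
  apply: le_lt_trans (ler_norm _) _; rewrite addrCA ltrDl ltr_pwDl // sumr_ge0 //.
have h1 : `|rsum phi h a x y - (by_parts a b - by_parts a a)| <= 2 * M * (phi b - phi a).
  apply: rsum_approx p m => u s v au usv vb _; apply: by_parts_approx => //; first lra.
  by move=> z _; split; apply: le_trans (ler_normB _ _) _; rewrite mulr_natl mulr2n lerD.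
have h2 : `|by_parts a b| <= 2 * M * phi b.
  rewrite /by_parts; set J := Rintegral _ _ _.
  have : `|J - 0 * (phi b - phi a)| <= M * (phi b - phi a).
    by apply: Rintegral_weight_le => [|z _]; rewrite ?ab // subr0.
  rewrite mul0r subr0 => hJ.
  apply: le_trans (ler_normB _ _) _; apply: le_trans (lerD (ler_normB _ _) hJ) _.
  rewrite !normrM (ger0_norm pa) (ger0_norm (le_trans pa pab)).
  by have := hM a; have := hM b; nra.
rewrite by_parts_start subr0 in h1.
rewrite -[rsum _ _ _ _ _](subrK (by_parts a b)).
by apply: le_trans (ler_normD _ _) _; apply: le_trans (lerD h1 h2) _; nra.
Qed.
End SmoothWeight.

(** * Caputo derivatives of real functions and their maximum principle *)

Section RealCaputo.
Variable R : realType.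
Notation mu := (@lebesgue_measure R).

(* [is_caputo] for real-valued functions. *)
Definition rcaputo (T rho : R) (h : R -> R) (t d : R) : Prop :=
  if rho == 1 then
    (s - t)^-1 * (h s - h t) @[s --> within `[0, T] t^'] --> d
  else
    exists2 I : R -> R,
      forall b, 0 < b < t -> rstieltjes (fun xi => (t - xi) `^ (- rho)) h 0 b (I b)
    & (Gamma (1 - rho))^-1 * I b @[b --> t^'-] --> d.

Definition dweight (rho t xi : R) : R := rho * (t - xi) `^ (- rho - 1).

Lemma is_derive_weight (rho t x : R) : x < t ->
  is_derive x 1 (fun xi => (t - xi) `^ (- rho)) (dweight rho t x).
Proof.
move=> xt; have tx : 0 < t - x by rewrite subr_gt0.
have h1 := is_derive1_powR (- rho) tx.
have h2 : is_derive x 1 (fun y => t - y) (-1 : R).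
  rewrite -[X in is_derive _ _ _ X]sub0r; apply: is_deriveB.
have := @is_derive1_comp _ (fun y : R => y `^ (- rho)) (fun y => t - y) _ _ _ h1 h2.
by rewrite /dweight mulrN1 mulNr opprK.
Qed.

Lemma dweight_continuous (rho t x : R) : x < t -> {for x, continuous (dweight rho t)}.
Proof.
move=> xt; suff : dweight rho t y @[y --> x] --> dweight rho t x by [].
apply: cvgM; first exact: cvg_cst.
have h1 : {for (t - x), continuous (fun y : R => y `^ (- rho - 1))}.
  by apply: powR_continuous; rewrite subr_gt0.
apply: (@continuous_comp _ _ _ (fun y : R => t - y) (fun y : R => y `^ (- rho - 1)) x) => //.
by apply: cvgB; [exact: cvg_cst | exact: cvg_id].
Qed.

Lemma dweight_ge0 (rho t x : R) : 0 < rho -> 0 <= dweight rho t x.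
Proof. by move=> r0; rewrite mulr_ge0 ?powR_ge0 // ltW. Qed.

Lemma Gamma_1rho_gt0 (rho : R) : 0 < rho <= 1 -> rho != 1 -> 0 < Gamma (1 - rho).
Proof. by move=> rho01 r1; rewrite Gamma_gt0 // subr_gt0 lt_neqAle r1; case/andP: rho01. Qed.

Lemma at_left_within (T t : R) : 0 < t <= T -> t^'- `=>` within `[0, T] t^'.
Proof.
move=> /andP[t0 tT] P [e /= e0 H]; near=> s.
have st : s < t by near: s; exact: nbhs_left_lt.
have s0 : 0 < s by near: s; exact: nbhs_left_gt.
apply: (H s) => /=.
- near: s; exists e => //= s hs _; exact: hs.
- by rewrite lt_eqF.
- by rewrite in_itv /=; lra.
Unshelve. all: by end_near. Qed.

(* If rho < 1 and d < 0, then I b stays below some negative l / 2 for b >= b0.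
   Take b' close to t and b a maximum point of h on [b0, b'].  Integrating by
   parts, and bounding h by h t on [0, b0] and by h b on [b0, b],
   I b >= phi 0 * (h t - h 0) - phi b0 * (h t - h b) with
   phi xi = (t - xi)^(- rho), which is above l / 2. *)
Lemma rcaputo_max (T rho t d : R) (h : R -> R) : 0 < rho <= 1 -> 0 < t <= T ->
  continuous h -> (forall s, 0 <= s <= t -> h s <= h t) ->
  rcaputo T rho h t d -> 0 <= d.
Proof.
move=> rho01 t0T ch hmax; have /andP[rho0 _] := rho01; have /andP[t0 tT] := t0T.
rewrite /rcaputo; case: ifPn => [_ c|rho1 [I hI c]].
  have c' : (s - t)^-1 * (h s - h t) @[s --> t^'-] --> d.
    by move=> P /c; exact: at_left_within.
  apply: (cvgr_to_ge c'); near=> s.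
  have st : s < t by near: s; exact: nbhs_left_lt.
  have s0 : 0 < s by near: s; exact: nbhs_left_gt.
  by rewrite mulr_le0 // ?invr_le0 ?subr_le0 ?(ltW st) // hmax ?(ltW st) ?(ltW s0).
have G0 := Gamma_1rho_gt0 rho01 rho1.
rewrite leNgt; apply/negP => d0.
pose phi xi := (t - xi) `^ (- rho).
have dphi x : x < t -> is_derive x 1 phi (dweight rho t x) by exact: is_derive_weight.
have cdphi x : x < t -> {for x, continuous (dweight rho t)} by exact: dweight_continuous.
have dphi0 x : x < t -> 0 <= dweight rho t x by move=> _; exact: dweight_ge0.
have p0 x : 0 <= phi x by exact: powR_ge0.
pose l := Gamma (1 - rho) * d.
have l0 : l < 0 by rewrite pmulr_rlt0.
have cI : I b @[b --> t^'-] --> l.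
  rewrite (_ : I = fun b => Gamma (1 - rho) * ((Gamma (1 - rho))^-1 * I b)).
    by apply: cvgM c; exact: cvg_cst.
  by apply/funext => b; rewrite mulrA mulfV ?mul1r ?gt_eqF.
have l2 : l < l / 2 by lra.
have [b0 b0I Hb0] : exists2 b0, 0 < b0 < t & forall b, b0 <= b < t -> I b < l / 2.
  have /(cvgr_lt l)/(_ _ l2) H1 := cI.
  have [e /= e0 He] := H1.
  exists (Num.max (t / 2) (t - e / 2)).
    by rewrite lt_max gt_max; lra.
  move=> b; rewrite ge_max => /andP[/andP[h1 h2] bt]; apply: He => //=.
  by rewrite gtr0_norm; lra.
have [b' b'I Hb'] : exists2 b', b0 < b' < t & phi b0 * (h t - h b') < - l / 2.
  have cm : phi b0 * (h t - h b) @[b --> t^'-] --> phi b0 * (h t - h t).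
    apply: cvg_at_left_filter; apply: cvgM; first exact: cvg_cst.
    by apply: cvgB; [exact: cvg_cst | exact: ch].
  rewrite subrr mulr0 in cm.
  have l3 : 0 < - l / 2 by lra.
  have H1 := cvgr_lt _ cm _ l3.
  have [e /= e0 He] := H1.
  exists (Num.max ((b0 + t) / 2) (t - e / 2)).
    by rewrite lt_max gt_max; lra.
  apply: He => /=; last by rewrite gt_max; lra.
  have : t - e / 2 <= Num.max ((b0 + t) / 2) (t - e / 2) < t.
    by rewrite le_max lexx orbT gt_max; lra.
  by move=> hm; rewrite gtr0_norm; lra.
have b0b' : b0 <= b' by lra.
have [b] := EVT_max b0b' (continuous_subspaceT ch).
rewrite in_itv /= => bI bmax.
have bt : 0 < b < t by lra.
have Ib : I b = by_parts phi (dweight rho t) h 0 b.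
  apply: (rstieltjes_unique _ (hI b bt)); first lra.
  by apply: rstieltjes_by_parts => //; lra.
have i1 : \int[mu]_(x in `[0, b]) (dweight rho t x * h x) <=
    h t * (phi b0 - phi 0) + h b * (phi b - phi b0).
  rewrite (@Rintegral_itv_split _ _ 0 b0 b); [|lra|]; last first.
    by apply: (@integrable_weight _ _ t) => //; lra.
  apply: lerD.
    rewrite -(Rintegral_weight1 dphi cdphi); last lra.
    rewrite -RintegralZl //; last by apply: (@integrable_weight1 _ _ t) => //; lra.
    apply: le_Rintegral => //.
    - by apply: (@integrable_weight _ _ t) => //; lra.
    - by apply: (@integrable_weightc _ _ t) => //; lra.
    - move=> x; rewrite /= in_itv /= => xI; rewrite mulrC ler_wpM2r ?dphi0 ?hmax //; lra.
  rewrite -(Rintegral_weight1 dphi cdphi); last lra.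
  rewrite -RintegralZl //; last by apply: (@integrable_weight1 _ _ t) => //; lra.
  apply: le_Rintegral => //.
  - by apply: (@integrable_weight _ _ t) => //; lra.
  - by apply: (@integrable_weightc _ _ t) => //; lra.
  - move=> x; rewrite /= in_itv /= => xI; rewrite mulrC ler_wpM2r ?dphi0 //; first lra.
    by apply: bmax; rewrite in_itv /=; lra.
have h1 : h b' <= h b by apply: bmax; rewrite in_itv /=; lra.
have h2 : I b < l / 2 by apply: Hb0; lra.
have h3 : phi b0 * (h t - h b) <= phi b0 * (h t - h b') by rewrite ler_wpM2l //; lra.
have h4 : 0 <= phi 0 * (h t - h 0) by rewrite mulr_ge0 // subr_ge0 hmax //; lra.
by move: h2; rewrite Ib /by_parts; nra.
Unshelve. all: by end_near. Qed.
Lemma rsum_lin (phi h1 h2 : R -> R) (p q a : R) (x y : seq R) :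
  rsum phi (fun s => p * h1 s + q * h2 s) a x y =
  p * rsum phi h1 a x y + q * rsum phi h2 a x y.
Proof.
rewrite /rsum !mulr_sumr -big_split /=; apply: eq_bigr => i _; ring.
Qed.

Lemma rstieltjes_lin (phi h1 h2 : R -> R) (p q a b l1 l2 : R) :
  rstieltjes phi h1 a b l1 -> rstieltjes phi h2 a b l2 ->
  rstieltjes phi (fun s => p * h1 s + q * h2 s) a b (p * l1 + q * l2).
Proof.
move=> H1 H2 e e0; pose c := `|p| + `|q| + 1.
have c0 : 0 < c by rewrite ltr_wpDl // addr_ge0.
have ec : 0 < e / c by rewrite divr_gt0.
have [d1 d10 K1] := H1 _ ec; have [d2 d20 K2] := H2 _ ec.
exists (Num.min d1 d2); first by rewrite lt_min d10.
move=> x y part m.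
have m1 : fine_mesh a d1 x.
  by move=> k ix; apply: lt_le_trans (m k ix) _; rewrite ge_min lexx.
have m2 : fine_mesh a d2 x.
  by move=> k ix; apply: lt_le_trans (m k ix) _; rewrite ge_min lexx orbT.
have k1 := K1 x y part m1; have k2 := K2 x y part m2.
rewrite rsum_lin (_ : _ - _ = p * (rsum phi h1 a x y - l1) + q * (rsum phi h2 a x y - l2)); last by ring.
apply: le_lt_trans (ler_normD _ _) _; rewrite !normrM.
have -> : e = (`|p| + `|q| + 1) * (e / c) by rewrite -/c mulrC divfK // gt_eqF.
have := ler_wpM2l (normr_ge0 p) (ltW k1); have := ler_wpM2l (normr_ge0 q) (ltW k2).
by move=> ? ?; rewrite !mulrDl mul1r; lra.
Qed.

Lemma rcaputo_lin (T rho : R) (h1 h2 : R -> R) (p q t d1 d2 : R) :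
  rcaputo T rho h1 t d1 -> rcaputo T rho h2 t d2 ->
  rcaputo T rho (fun s => p * h1 s + q * h2 s) t (p * d1 + q * d2).
Proof.
rewrite /rcaputo; case: ifP => _.
  move=> c1 c2.
  rewrite (_ : (fun s => _) = fun s => p * ((s - t)^-1 * (h1 s - h1 t)) + q * ((s - t)^-1 * (h2 s - h2 t))).
    by apply: cvgD; apply: cvgM => //; exact: cvg_cst.
  by apply/funext => s; ring.
move=> [I1 H1 c1] [I2 H2 c2]; exists (fun b => p * I1 b + q * I2 b).
  by move=> b bt; apply: rstieltjes_lin; [exact: H1 | exact: H2].
rewrite (_ : (fun b => _) = fun b => p * ((Gamma (1 - rho))^-1 * I1 b) + q * ((Gamma (1 - rho))^-1 * I2 b)).
  by apply: cvgD; apply: cvgM => //; exact: cvg_cst.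
by apply/funext => s; ring.
Qed.

Lemma rcaputo_ext (T rho : R) (h h' : R -> R) (t d : R) : 0 < t <= T ->
  (forall s, 0 <= s <= T -> h s = h' s) -> rcaputo T rho h t d -> rcaputo T rho h' t d.
Proof.
move=> t0T hh; rewrite /rcaputo; case: ifP => _.
  apply: cvg_trans; apply: near_eq_cvg.
  have : \forall s \near within `[0, T] t^', `[0, T]%classic s by apply: withinT.
  by apply: filterS => s /=; rewrite in_itv /= => sI; rewrite !hh //; lra.
move=> [I H c]; exists I => // b bt; apply: rstieltjes_ext (H b bt) => z zb.
by apply: hh; lra.
Qed.

(** At a maximum point [c] with [h c > 0] one has [c > 0], since [h 0 <= 0]; there [rcaputo_max]
    makes the derivative nonnegative, against the hypothesis. *)
Lemma caputo_weak_max (T rho : R) (h w : R -> R) : 0 < rho <= 1 ->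
  continuous h -> h 0 <= 0 ->
  (forall t, 0 < t <= T -> rcaputo T rho h t (w t)) ->
  (forall t, 0 < t <= T -> 0 < h t -> w t < 0) ->
  forall t, 0 <= t <= T -> h t <= 0.
Proof.
move=> rho01 ch h0 hw wneg t tT.
have T0 : 0 <= T by lra.
have [c] := EVT_max T0 (continuous_subspaceT ch); rewrite in_itv /= => cI cmax.
apply: (@le_trans _ _ (h c)); first by apply: cmax; rewrite in_itv.
rewrite leNgt; apply/negP => hc.
have c0 : 0 < c.
  have /andP[+ _] := cI; rewrite le_eqVlt => /predU1P[e|//].
  by move: hc; rewrite -e; lra.
have cT : 0 < c <= T by lra.
have := rcaputo_max rho01 cT ch _ (hw c cT).
have := wneg c cT hc => h1 h2.
have : 0 <= w c by apply: h2 => s sI; apply: cmax; rewrite in_itv /=; lra.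
by lra.
Qed.
End RealCaputo.

(** * Caputo derivative of a fractional integral *)

Section CaputoOfIntegral.
Variable R : realType.
Notation mu := (@lebesgue_measure R).

(** The kernel y^(rho - 1) / (1 + y) on the positive half-line, the profile of the approximate
    identity below. Its mass is the constant of the reflection formula for Gamma. *)
Definition stieltjes_ker (rho y : R) : R := pow_ker rho y * (1 + y) `^ (-1).

Lemma stieltjes_ker_ge0 (rho y : R) : 0 <= stieltjes_ker rho y.
Proof. by rewrite mulr_ge0 ?pow_ker_ge0 ?powR_ge0. Qed.

Lemma measurable_stieltjes_ker (rho : R) : measurable_fun [set: R] (stieltjes_ker rho).
Proof.
apply: measurable_funM; first exact: measurable_pow_ker.
by apply: (measurableT_comp (measurable_powRl (-1))); exact: measurable_funD.
Qed.

Lemma Gamma_scale (a x : R) : 0 < a -> 0 < x ->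
  (\int[mu]_y (pow_ker a y * expR (- (x * y)))%:E = (x `^ (- a) * Gamma a)%:E)%E.
Proof.
move=> a0 x0; have xn0 : x != 0 by rewrite gt_eqF.
have m : measurable_fun [set: R] (EFin \o gamma_ker a).
  by apply/measurable_EFinP; exact: measurable_gamma_ker.
have g0 y : (0 <= (EFin \o gamma_ker a) y)%E by rewrite lee_fin gamma_ker_ge0.
have m2 : measurable_fun [set: R] (EFin \o (fun y => pow_ker a y * expR (- (x * y)))).
  apply/measurable_EFinP; apply: measurable_funM; first exact: measurable_pow_ker.
  apply: measurableT_comp => //; apply: measurableT_comp => //; exact: measurable_funM.
have := Gamma_EFin a0.
rewrite (ge0_integral_affine 0 xn0 m g0) (gtr0_norm x0).
have -> : (\int[mu]_y (EFin \o gamma_ker a) (x * y + 0)%R = 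
   (x `^ (a - 1))%:E * \int[mu]_y (pow_ker a y * expR (- (x * y)))%:E)%E.
  rewrite -(ge0_integralZl mu measurableT m2).
  - apply: eq_integral => y _; rewrite /= addr0 gamma_kerE pow_kerZ // -EFinM; congr EFin; ring.
  - by move=> y _; rewrite lee_fin mulr_ge0 ?pow_ker_ge0 ?expR_ge0.
  - by rewrite lee_fin powR_ge0.
rewrite muleA -EFinM mulr_powRB1 ?(ltW x0) //.
move: (\int[mu]_y _)%E => I.
have xa : 0 < x `^ a by rewrite powR_gt0.
case: I => [r| |].
- rewrite -EFinM => -[e]; congr EFin; rewrite -e powRN mulKf // gt_eqF //.
- by rewrite gt0_muley ?lte_fin.
- by rewrite gt0_muleNy ?lte_fin.
Qed.

(** Write 1 / (1 + y) as the integral of exp(- (1 + y) x) over x > 0 and exchange the integrals by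
    Tonelli: the inner one becomes x^(- rho) Gamma(rho), the outer one Gamma(1 - rho). *)
Lemma integral_stieltjes_ker (rho : R) : 0 < rho < 1 ->
  (\int[mu]_y (stieltjes_ker rho y)%:E = (Gamma rho * Gamma (1 - rho))%:E)%E.
Proof.
move=> /andP[r0 r1].
have r10 : 0 < 1 - rho by rewrite subr_gt0.
pose F (p : R * R) : \bar R :=
  (pow_ker rho p.2 * (pow_ker 1 p.1 * expR (- ((1 + p.2) * p.1))))%:E.
have mF : measurable_fun [set: R * R] F.
  apply/measurable_EFinP; apply: measurable_funM.
    by apply: measurableT_comp; [exact: measurable_pow_ker | exact: measurable_snd].
  apply: measurable_funM.
    by apply: measurableT_comp; [exact: measurable_pow_ker | exact: measurable_fst].
  apply: measurableT_comp => //; apply: measurableT_comp => //; apply: measurable_funM => //.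
  by apply: measurable_funD => //.
have F0 p : (0 <= F p)%E.
  rewrite lee_fin; apply: mulr_ge0; first exact: pow_ker_ge0.
  by rewrite mulr_ge0 ?pow_ker_ge0 ?expR_ge0.
have E1 y : (\int[mu]_x F (x, y) = (stieltjes_ker rho y)%:E)%E.
  have [y0|y0] := leP y 0.
    rewrite /stieltjes_ker pow_ker0 // mul0r; apply: integral0_eq => x _.
    by rewrite /F /= pow_ker0 // mul0r.
  have y1 : 0 < 1 + y by lra.
  have m : measurable_fun [set: R] (EFin \o (fun x => pow_ker 1 x * expR (- ((1 + y) * x)))).
    apply/measurable_EFinP; apply: measurable_funM; first exact: measurable_pow_ker.
    apply: measurableT_comp => //; apply: measurableT_comp => //; exact: measurable_funM.
  transitivity ((pow_ker rho y)%:E * \int[mu]_x (pow_ker 1 x * expR (- ((1 + y) * x)))%:E)%E.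
    rewrite -(ge0_integralZl mu measurableT m) //.
      by move=> x _; rewrite lee_fin mulr_ge0 ?pow_ker_ge0 ?expR_ge0.
    by rewrite lee_fin pow_ker_ge0.
  by rewrite Gamma_scale // Gamma1 mulr1 -EFinM.
have E2 x : (\int[mu]_y F (x, y) = (Gamma rho)%:E * (gamma_ker (1 - rho) x)%:E)%E.
  have [x0|x0] := leP x 0.
    rewrite gamma_kerE pow_ker0 // mul0r mule0; apply: integral0_eq => y _.
    by rewrite /F /= (pow_ker0 1 x0) mul0r mulr0.
  have m : measurable_fun [set: R] (EFin \o (fun y => pow_ker rho y * expR (- (x * y)))).
    apply/measurable_EFinP; apply: measurable_funM; first exact: measurable_pow_ker.
    apply: measurableT_comp => //; apply: measurableT_comp => //; exact: measurable_funM.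
  transitivity ((expR (- x))%:E * \int[mu]_y (pow_ker rho y * expR (- (x * y)))%:E)%E.
    rewrite -(ge0_integralZl mu measurableT m).
    - apply: eq_integral => y _; rewrite /F /= -EFinM; congr EFin.
      rewrite (pow_kerE 1 x0) subrr powRr0 mul1r [RHS]mulrCA -expRD; congr (_ * expR _); ring.
    - by move=> y _; rewrite lee_fin mulr_ge0 ?pow_ker_ge0 ?expR_ge0.
    - by rewrite lee_fin expR_ge0.
  rewrite Gamma_scale // gamma_kerE pow_kerE // -!EFinM; congr EFin.
  have -> : 1 - rho - 1 = - rho by ring.
  by ring.
under eq_integral do rewrite -E1.
rewrite -(@fubini_tonelli _ _ _ _ _ mu mu F mF F0).
under eq_integral do rewrite E2.
have m : measurable_fun [set: R] (EFin \o gamma_ker (1 - rho)).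
  by apply/measurable_EFinP; exact: measurable_gamma_ker.
rewrite (ge0_integralZl mu measurableT m).
- by rewrite Gamma_EFin // -EFinM.
- by move=> x _; rewrite lee_fin gamma_ker_ge0.
- by rewrite lee_fin ltW ?Gamma_gt0.
Qed.
(** The derivative of the weight seen from the end point b: with [d = t - b], it is [dweight rho t]
    at [b - y]. As [d > 0], there is no singularity. *)
Definition weight_ker (rho d y : R) : R := (0 < y)%R%:R * (rho * (d + y) `^ (- rho - 1)).

Lemma measurable_weight_ker (rho d : R) : measurable_fun [set: R] (weight_ker rho d).
Proof.
apply: measurable_funM; first exact: measurable_pos.
apply: measurable_funM => //; apply: (measurableT_comp (measurable_powRl _)).
exact: measurable_funD.
Qed.

Lemma dominated_weight_ker (rho d T : R) : 0 < rho -> 0 < d ->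
  dominated_ker (weight_ker rho d) 1 (rho * d `^ (- rho - 1)) T.
Proof.
move=> r0 d0 x _; rewrite /weight_ker; have [x0|x0] := ltP 0 x; last first.
  by rewrite pow_ker0 // mul0r normr0 mulr0.
rewrite mul1r pow_kerE // subrr powRr0 mulr1 normrM (gtr0_norm r0) ger0_norm ?powR_ge0 //.
have -> : - rho - 1 = - (rho + 1) by ring.
rewrite ler_pM2l // !powRN lef_pV2 ?posrE ?powR_gt0 ?addr_gt0 //.
by apply: ge0_ler_powR; rewrite ?nnegrE; lra.
Qed.

(** With c = d + u, the integrand rho s^(rho - 1) (c - s)^(- rho - 1) has the primitive s^rho (c -
    s)^(- rho) / c. *)
Lemma conv_weight_ker (rho d u : R) : 0 < rho -> 0 < d ->
  conv (weight_ker rho d) (pow_ker rho) u =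
  d `^ (- rho) * (pow_ker (rho + 1) u * (d + u) `^ (-1)).
Proof.
move=> r0 d0; have [u0|u0] := leP u 0.
  rewrite (pow_ker0 _ u0) mul0r mulr0 /conv (_ : (fun s => _) = cst 0) ?Rintegral_cst ?mul0r //.
  apply/funext => s; have [s0|s0] := leP s 0; first by rewrite (pow_ker0 _ s0) mulr0.
  by rewrite /weight_ker ltNge (_ : u - s <= 0) ?mul0r //; lra.
pose c := d + u; have c0 : 0 < c by rewrite addr_gt0.
pose f s := s `^ (rho - 1) * (rho * (c - s) `^ (- rho - 1)).
(* Differentiation produces the factor ((c - s) + s) / c = 1. *)
pose F s := c^-1 * (s `^ rho * (c - s) `^ (- rho)).
have dF x : 0 < x < c -> is_derive x 1 F (f x).
  move=> /andP[x0 xc].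
  have h1 := is_derive1_powR rho x0.
  have h2 := is_derive_weight rho xc.
  have h3 : is_derive x 1 F (c^-1 *: (x `^ rho *: dweight rho c x + (c - x) `^ (- rho) *: (rho * x `^ (rho - 1)))).
    by apply: is_deriveZ; apply: is_deriveM.
  apply: is_derive_eq h3 _; rewrite /dweight /f /GRing.scale /=.
  rewrite -[X in X `^ rho](@divr1 _ x) divr1.
  rewrite -(mulr_powRB1 (ltW x0) r0).
  have -> : (c - x) `^ (- rho) = (c - x) * (c - x) `^ (- rho - 1).
    rewrite -[X in X * _](powRr1 (_ : 0 <= c - x)); last lra.
    by rewrite -powRD_pos; [congr (_ `^ _); ring | lra].
  by field; rewrite gt_eqF.
have FTC : (\int[mu]_(x in `]0%R, u[) (f x)%:E = (F u - F 0)%:E)%E.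
  have cF x : 0 < x < c -> {for x, continuous F}.
    by move=> xI; apply: differentiable_continuous; apply/derivable1_diffP; have [] := dF x xI.
  apply: integral_ge0_FTC2_oo => //.
  - rewrite {2}/F powR0 ?gt_eqF // mul0r mulr0.
    have : F x @[x --> 0^'+] --> c^-1 * (0 * (c - 0) `^ (- rho)); last by rewrite mul0r mulr0.
    apply: cvgM; first exact: cvg_cst.
    apply: cvgM; first exact: powR_cvg0.
    apply: cvg_at_right_filter.
    have := is_derive_weight rho c0 => -[h _].
    by move/derivable1_diffP : h => /differentiable_continuous.
  - by apply: cvg_at_left_filter; apply: cF; rewrite u0 /c ltrDr.
  - by move=> x xI; apply: dF; rewrite /c; lra.
  - move=> x xI; suff : f y @[y --> x] --> f x by [].
    apply: cvgM; first by apply: powR_continuous; lra.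
    by apply: (@dweight_continuous R rho c x); rewrite /c; lra.
  - by move=> x _; rewrite /f mulr_ge0 ?powR_ge0 // mulr_ge0 ?powR_ge0 // ltW.
have -> : d `^ (- rho) * (pow_ker (rho + 1) u * (d + u) `^ (-1)) = F u - F 0.
  rewrite /F powR0 ?gt_eqF // mul0r mulr0 subr0 pow_kerE // addrK powR_inv1 ?(ltW c0) //.
  by rewrite /c addrK; ring.
rewrite /conv /Rintegral.
have -> : (\int[mu]_s (weight_ker rho d (u - s) * pow_ker rho s)%:E =
   \int[mu]_(x in `]0%R, u[) (f x)%:E)%E; last by rewrite FTC.
rewrite [in RHS]integral_mkcond; apply: eq_integral => s _.
rewrite patchE mem_setE in_itv /=; case: ifPn.
  move=> /andP[s0 su]; rewrite /weight_ker subr_gt0 su mul1r pow_kerE // mulrC.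
  by rewrite /f /c addrA.
rewrite negb_and -!leNgt => /orP[s0|us]; first by rewrite (pow_ker0 _ s0) mulr0.
by rewrite /weight_ker subr_gt0 ltNge us mul0r mul0r.
Qed.
Section Fractional.
Variables (rho D : R) (w : R -> R).
Hypotheses (rho0 : 0 < rho) (cw : continuous w) (wD : forall x, `|w x| <= D).

Let mw : measurable_fun [set: R] w.
Proof. exact: continuous_measurable_fun. Qed.

Let mcw : measurable_fun [set: R] (cut w).
Proof. exact: measurable_cut. Qed.

Let hcw x : `|cut w x| <= D * pow_ker 1 x.
Proof. exact: norm_cut_le. Qed.

Let D0 : 0 <= D.
Proof. by apply: le_trans (wD 0). Qed.

Lemma frac_int_continuous : continuous (frac_int rho w).
Proof.
have h : continuous (conv (pow_ker rho) (cut w)).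
  apply: (conv_continuous rho0 (@measurable_pow_ker R rho) _ cw wD) => T.
  by exists 1; exact: dominated_pow_ker.
by move=> x; apply: cvgM; [exact: cvg_cst | exact: h].
Qed.

Lemma frac_int_le0 (t : R) : t <= 0 -> frac_int rho w t = 0.
Proof.
move=> t0; rewrite /frac_int /conv (_ : (fun s => _) = cst 0) ?Rintegral_cst ?mul0r ?mulr0 //.
apply/funext => s; have [s0|s0] := leP s 0; first by rewrite cut_neg // mulr0.
by rewrite pow_ker0 ?mul0r //; lra.
Qed.

Let phi (t x : R) := (t - x) `^ (- rho).

(** By associativity and [conv_weight_ker] the integral term is a single convolution with [cut w],
    as is the boundary term. With d = t - b the difference of their kernels is d^(- rho) (u^(rho -
    1) - u^rho / (d + u)) = d^(1 - rho) u^(rho - 1) / (d + u), which u = d y turns into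
    [stieltjes_ker]. *)
Lemma by_parts_frac_int (b t : R) : 0 < b < t ->
  by_parts (phi t) (dweight rho t) (frac_int rho w) 0 b =
  (Gamma rho)^-1 * \int[mu]_y (stieltjes_ker rho y * cut w (b - (t - b) * y)).
Proof.
move=> /andP[b0 bt]; pose d := t - b; have d0 : 0 < d by rewrite subr_gt0.
have dn0 : d != 0 by rewrite gt_eqF.
have mp := @measurable_pow_ker R rho.
have mk := measurable_weight_ker rho d.
have dk := @dominated_weight_ker rho d b rho0 d0.
have A := conv_assoc ltr01 rho0 b0 mk mp mcw dk (@dominated_pow_ker R rho b) hcw.
pose k u := d `^ (- rho) * (pow_ker (rho + 1) u * (d + u) `^ (-1)).
have kE : conv (weight_ker rho d) (pow_ker rho) = k.
  by apply/funext => u; exact: conv_weight_ker.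
have mkk : measurable_fun [set: R] k.
  apply: measurable_funM => //; apply: measurable_funM; first exact: measurable_pow_ker.
  by apply: (measurableT_comp (measurable_powRl _)); exact: measurable_funD.
have dkk : dominated_ker k rho (d `^ (- rho)) b.
  move=> x _; have [x0|x0] := leP x 0.
    by rewrite /k (pow_ker0 _ x0) mul0r mulr0 normr0 pow_ker0 // mulr0.
  rewrite /k !pow_kerE // addrK normrM ger0_norm ?powR_ge0 // ler_wpM2l ?powR_ge0 //.
  rewrite ger0_norm ?mulr_ge0 ?powR_ge0 // powR_inv1; last lra.
  rewrite ler_pdivrMr; last lra.
  by rewrite -(mulr_powRB1 (ltW x0) rho0) mulrC ler_wpM2l ?powR_ge0 //; lra.
have i1 := integrable_conv rho0 ltr01 mp mcw (@dominated_pow_ker R rho b) hcw.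
have i2 := integrable_conv rho0 ltr01 mkk mcw dkk hcw.
have dweightI : \int[mu]_(x in `[0, b]) (dweight rho t x * frac_int rho w x) =
    (Gamma rho)^-1 * conv k (cut w) b.
  have ii : mu.-integrable `[0, b] (EFin \o (fun x => dweight rho t x * frac_int rho w x)).
    apply: (@integrable_weight R (dweight rho t) t) => //.
      by move=> x; exact: dweight_continuous.
    exact: frac_int_continuous.
  rewrite -Rintegral_itv_bndo_bndc; last first.
    by apply: integrableS ii => // x /=; rewrite !in_itv /=; lra.
  rewrite -kE -A Rintegral_mkcond /conv.
  transitivity (\int[mu]_s ((Gamma rho)^-1 * (weight_ker rho d (b - s) * conv (pow_ker rho) (cut w) s))).
    apply: eq_Rintegral => s _; rewrite patchE mem_setE in_itv /=.
    have [s0|s0] := leP 0 s; last first.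
      rewrite (_ : conv _ _ s = Gamma rho * frac_int rho w s); last first.
        by rewrite mulrA mulfV ?mul1r // gt_eqF // Gamma_gt0.
      by rewrite frac_int_le0 ?mulr0 // ltW.
    case: ltP => sb /=; last first.
      by rewrite /weight_ker subr_gt0 ltNge sb mul0r mul0r mulr0.
    rewrite /weight_ker subr_gt0 sb mul1r /frac_int /dweight /d.
    by rewrite (_ : t - b + (b - s) = t - s); [ring | ring].
  rewrite RintegralZl //.
  have mf : measurable_fun [set: R] (frac_int rho w).
    by apply: continuous_measurable_fun; exact: frac_int_continuous.
  have [M [M0 hM]] := @bounded_itv R (frac_int rho w) 0 b (continuous_subspaceT frac_int_continuous).
  have hb x : x <= b -> `|conv (pow_ker rho) (cut w) x| <= (Gamma rho * M) * pow_ker 1 x.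
    move=> xb; rewrite (_ : conv _ _ x = Gamma rho * frac_int rho w x); last first.
      by rewrite mulrA mulfV ?mul1r // gt_eqF // Gamma_gt0.
    have G0 := Gamma_gt0 rho0.
    rewrite normrM (gtr0_norm G0) -mulrA ler_pM2l //.
    have [x0|x0] := leP x 0; first by rewrite frac_int_le0 // pow_ker0 // normr0 mulr0.
    by rewrite pow_kerE // subrr powRr0 mulr1 hM // xb ltW.
  apply: (integrable_conv_le ltr01 ltr01 b0 mk _ dk hb).
  rewrite (_ : conv _ _ = fun x => Gamma rho * frac_int rho w x); first exact: measurable_funM.
  by apply/funext => x; rewrite mulrA mulfV ?mul1r // gt_eqF // Gamma_gt0.
rewrite /by_parts dweightI (@frac_int_le0 0) // mulr0 subr0 /frac_int.
rewrite mulrCA -mulrBr; congr (_ * _).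
rewrite -[X in _ - X]mul1r -mulNr -(convZD _ _ i1 i2).
set kk := fun r => _.
have i3 : mu.-integrable setT (EFin \o (fun s => kk (b - s) * cut w s)).
  have := integrableD measurableT (integrableZ (phi t b) i1) (integrableZ (-1) i2).
  apply: eq_integrable => // s _ /=; rewrite -EFinD; congr EFin.
  by rewrite /kk; ring.
rewrite (convC i3).
have i4 : mu.-integrable setT (EFin \o (fun s => kk s * cut w (b - s))).
  have := integrable_affine b (_ : (-1 : R) != 0) i3; rewrite oppr_eq0 oner_eq0 => /(_ isT).
  apply: eq_integrable => // s _ /=; congr EFin.
  by rewrite mulN1r; congr (kk _ * cut w _); ring.
(* The substitution u = d y; its Jacobian d cancels the degree -1 of the kernel in (d, u). *)
rewrite (integral_affine 0 dn0 i4) (gtr0_norm d0) -RintegralZl //; last exact: integrable_affine i4.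
apply: eq_Rintegral => y _; rewrite addr0 mulrA; congr (_ * _).
rewrite /kk /k /stieltjes_ker /phi -/d; have [y0|y0] := leP y 0.
  by rewrite !pow_ker0 ?mul0r ?mulr0 ?addr0 ?mulr0 //; nra.
rewrite !pow_kerZ // !pow_kerE // !addrK.
have -> : d + d * y = d * (1 + y) by ring.
have y1 : 0 <= 1 + y by lra.
rewrite (powRM _ (ltW d0) y1) (powR_inv1 (ltW d0)) (powR_inv1 y1).
rewrite -(mulr_powRB1 (ltW y0) rho0) -(mulr_powRB1 (ltW d0) rho0) powRN.
rewrite -(mulr_powRB1 (ltW d0) rho0).
have dp : d `^ (rho - 1) != 0 by rewrite gt_eqF ?powR_gt0.
by field; rewrite dp dn0 gt_eqF //; lra.
Qed.
(* The Stieltjes integral over [0, b] of (t - xi)^(- rho) against the fractional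
   integral of w, after the substitution s = b - (t - b) y in the last integral.
   It shows that an approximate identity acts on w as b tends to t. *)
Definition stieltjes_frac (t b : R) : R :=
  (Gamma rho)^-1 * \int[mu]_y (stieltjes_ker rho y * cut w (b - (t - b) * y)).

Lemma by_parts_cstD (psi dpsi f : R -> R) (c a b t : R) :
  (forall x, x < t -> is_derive x 1 psi (dpsi x)) ->
  (forall x, x < t -> {for x, continuous dpsi}) -> continuous f -> a <= b < t ->
  by_parts psi dpsi (fun x => c + f x) a b = by_parts psi dpsi f a b.
Proof.
move=> h1 h2 cf abt; have /andP[ab bt] := abt; rewrite /by_parts.
under eq_Rintegral do rewrite mulrDr [dpsi _ * c]mulrC.
rewrite RintegralD //; last 2 first.
- exact: (integrable_weightc h2).
- exact: (integrable_weight h2).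
rewrite RintegralZl //; last exact: (integrable_weight1 h2).
by rewrite (Rintegral_weight1 h1 h2 abt); ring.
Qed.

Lemma rstieltjes_frac_int (c b t : R) : 0 < b < t ->
  rstieltjes (phi t) (fun s => c + frac_int rho w s) 0 b (stieltjes_frac t b).
Proof.
move=> bt; rewrite /stieltjes_frac -by_parts_frac_int //.
have d1 x : x < t -> is_derive x 1 (phi t) (dweight rho t x) by exact: is_derive_weight.
have d2 x : x < t -> {for x, continuous (dweight rho t)} by exact: dweight_continuous.
rewrite -(@by_parts_cstD _ _ _ c 0 b t d1 d2 frac_int_continuous); last lra.
apply: (rstieltjes_by_parts d1 d2) => //; last lra.
  by move=> x _; exact: dweight_ge0.
by move=> x; apply: cvgD; [exact: cvg_cst | exact: frac_int_continuous].
Qed.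

Section Lt1.
Hypothesis rho1 : rho < 1.

Let rho01 : 0 < rho < 1. Proof. by rewrite rho0. Qed.

Lemma integrable_stieltjes_ker : mu.-integrable setT (EFin \o stieltjes_ker rho).
Proof.
apply/integrableP; split; first by apply/measurable_EFinP; exact: measurable_stieltjes_ker.
have -> : (\int[mu]_x `|(EFin \o stieltjes_ker rho) x| = (Gamma rho * Gamma (1 - rho))%:E)%E.
  rewrite -integral_stieltjes_ker //; apply: eq_integral => y _.
  by rewrite gee0_abs // lee_fin stieltjes_ker_ge0.
by rewrite ltry.
Qed.

Lemma Rintegral_stieltjes_ker : \int[mu]_y stieltjes_ker rho y = Gamma rho * Gamma (1 - rho).
Proof. by rewrite /Rintegral integral_stieltjes_ker. Qed.

Let integrable_bound : mu.-integrable setT (EFin \o (fun y => D * stieltjes_ker rho y)).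
Proof. by apply: integrableZ; exact: integrable_stieltjes_ker. Qed.

Let measurable_integrand (b t : R) :
  measurable_fun [set: R] (fun y => stieltjes_ker rho y * cut w (b - (t - b) * y)).
Proof.
apply: measurable_funM; first exact: measurable_stieltjes_ker.
apply: (measurableT_comp mcw); apply: measurable_funB => //; exact: measurable_funM.
Qed.

Let integrand_le (b t y : R) :
  `|stieltjes_ker rho y * cut w (b - (t - b) * y)| <= D * stieltjes_ker rho y.
Proof.
rewrite normrM ger0_norm ?stieltjes_ker_ge0 // mulrC ler_wpM2r ?stieltjes_ker_ge0 //.
rewrite /cut; case: ltP => _; first by rewrite mul1r.
by rewrite mul0r normr0.
Qed.

(** The bound involves neither [b] nor [t], so it is uniform over all modes whose densities share
    the bound [D]. *)
Lemma stieltjes_frac_bound (t b : R) : `|stieltjes_frac t b| <= D * Gamma (1 - rho).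
Proof.
have G0 := Gamma_gt0 rho0.
rewrite /stieltjes_frac normrM normfV (gtr0_norm G0) ler_pdivrMl // mulrCA.
rewrite -Rintegral_stieltjes_ker -RintegralZl //; last exact: integrable_stieltjes_ker.
have ii : mu.-integrable setT (EFin \o (fun y => stieltjes_ker rho y * cut w (b - (t - b) * y))).
  apply: (le_integrable measurableT _ _ integrable_bound).
    by apply/measurable_EFinP; exact: measurable_integrand.
  by move=> y _; rewrite lee_fin; apply: le_trans (ler_norm _); exact: integrand_le.
apply: le_trans (le_normr_Rintegral _ ii) _ => //.
by apply: le_Rintegral => //; first exact: integrable_norm.
Qed.

Lemma stieltjes_frac_cvg (t : R) : 0 < t ->
  (Gamma (1 - rho))^-1 * stieltjes_frac t b @[b --> t^'-] --> w t.
Proof.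
move=> t0; have G0 := Gamma_gt0 rho0.
have G1 : 0 < Gamma (1 - rho) by rewrite Gamma_gt0 // subr_gt0.
have -> : w t = (Gamma (1 - rho))^-1 * ((Gamma rho)^-1 *
    \int[mu]_y (stieltjes_ker rho y * cut w t)).
  rewrite RintegralZr //; last exact: integrable_stieltjes_ker.
  rewrite Rintegral_stieltjes_ker cut_pos //.
  move: (Gamma rho) (Gamma _) (w t) G0 G1 => x y z x0 y0.
  by field; rewrite !gt_eqF.
apply: cvgM; first exact: cvg_cst.
apply: cvgM; first exact: cvg_cst.
apply/cvg_at_leftP => u [ut cu].
apply: (@Rdominated_cvg _ _ _ (fun y => D * stieltjes_ker rho y)) => //.
- by apply: measurable_funM => //; exact: measurable_stieltjes_ker.
(* For fixed y the argument b - (t - b) y tends to t, and [t > 0] makes it a continuity point of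
   [cut w]. *)
- apply: aeW => y; apply: cvgM; first exact: cvg_cst.
  apply: (cvg_comp (fun n => u n - (t - u n) * y) (cut w)); last first.
    by apply: cut_continuous; [rewrite gt_eqF | exact: cw].
  have : u n - (t - u n) * y @[n --> \oo] --> t - (t - t) * y.
    by apply: cvgB => //; apply: cvgM; [apply: cvgB => //; exact: cvg_cst | exact: cvg_cst].
  by rewrite subrr mul0r subr0.
Qed.
End Lt1.

End Fractional.

Lemma quotient_close (a b c e x : R) : x != 0 ->
  `|a - b - c * x| <= e * `|x| -> `|c - x^-1 * (a - b)| <= e.
Proof.
move=> x0 h; rewrite (_ : c - _ = - (x^-1 * (a - b - c * x))); last by field.
by rewrite normrN normrM normfV ler_pdivrMl ?normr_gt0 // [leRHS]mulrC.
Qed.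

(** * The case of order one, where the fractional integral is an ordinary primitive *)

Section Ordinary.
Variables (D : R) (w : R -> R).
Hypotheses (cw : continuous w) (wD : forall x, `|w x| <= D).

Let mw : measurable_fun [set: R] w.
Proof. exact: continuous_measurable_fun. Qed.

Let iw (u v : R) : mu.-integrable `[u, v] (EFin \o w).
Proof.
apply: continuous_compact_integrable; first exact: segment_compact.
exact: continuous_subspaceT.
Qed.

Lemma frac_int1 (t : R) : 0 <= t -> frac_int 1 w t = \int[mu]_(x in `[0, t]) w x.
Proof.
move=> t0; rewrite /frac_int Gamma1 invr1 mul1r /conv.
rewrite -Rintegral_itv_bndo_bndc; last first.
  by apply: integrableS (iw 0 t) => // x /=; rewrite !in_itv /= => /andP[-> /ltW ->].
rewrite -Rintegral_itv_obnd_cbnd; last first.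
  by apply: integrableS (iw 0 t) => // x /=; rewrite !in_itv /= => /andP[/ltW -> /ltW ->].
rewrite [in RHS]Rintegral_mkcond; apply: eq_Rintegral => s _.
rewrite patchE mem_setE in_itv /=; case: ifPn.
  move=> /andP[s0 st]; rewrite cut_pos // pow_kerE ?subr_gt0 //.
  by rewrite subrr powRr0 mul1r.
rewrite negb_and -!leNgt => /orP[s0|ts]; first by rewrite cut_neg // mulr0.
by rewrite pow_ker0 ?mul0r // subr_le0.
Qed.

Lemma frac_int1_incr (c e u v : R) : 0 <= u <= v ->
  (forall x, u <= x <= v -> `|w x - c| <= e) ->
  `|frac_int 1 w v - frac_int 1 w u - c * (v - u)| <= e * (v - u).
Proof.
move=> /andP[u0 uv] h; have v0 := le_trans u0 uv.
rewrite !frac_int1 // (@Rintegral_itv_split _ w 0 u v) ?u0 //.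
rewrite [_ + _ - \int[mu]_(x in `[0, u]) w x]addrAC subrr add0r.
(* The identity serves as a weight with derivative 1; [v + 1] is only an end point beyond [v]. *)
have d1 x : x < v + 1 -> is_derive x 1 id (cst 1 x : R) by move=> _; exact: is_derive_id.
have d2 x : x < v + 1 -> {for x, continuous (cst (1 : R))} by move=> _; exact: cvg_cst.
have d3 x : x < v + 1 -> 0 <= cst 1 x :> R by [].
have uv1 : u <= v < v + 1 by lra.
have := Rintegral_weight_le d1 d2 d3 cw uv1 h.
by under eq_Rintegral do rewrite mul1r.
Qed.

Lemma frac_int1_lipschitz (s t : R) : 0 <= s -> 0 <= t ->
  `|frac_int 1 w s - frac_int 1 w t| <= D * `|s - t|.
Proof.
wlog st : s t / s <= t.
  move=> H s0 t0; have [st|ts] := leP s t; first exact: H.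
  by rewrite distrC [`|s - t|]distrC; apply: H => //; exact: ltW.
move=> s0 t0; have := @frac_int1_incr 0 D s t; rewrite s0 st mul0r subr0 => h.
rewrite distrC [`|s - t|]distrC (ger0_norm (_ : 0 <= t - s)) ?subr_ge0 //.
by apply: h => // x _; rewrite subr0.
Qed.

Lemma frac_int1_derivative (T t : R) : 0 < t ->
  (s - t)^-1 * (frac_int 1 w s - frac_int 1 w t) @[s --> within `[0, T] t^'] --> w t.
Proof.
move=> t0; apply/cvgrPdist_le => e e0.
have /cvgrPdist_le /(_ _ e0) [d /= d0 H] := cw (x := t).
have : \forall s \near t^', 0 < s /\ `|t - s| < d.
  exists (Num.min d t) => /=; first by rewrite lt_min d0.
  move=> s /=; rewrite lt_min => /andP[h1 h2] _; split => //.
  by move: h2; rewrite ltr_norml; lra.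
move=> near_s; have near_t : \forall s \near t^', s != t by exact: nbhs_dnbhs_neq.
suff : \forall s \near t^', `|w t - (s - t)^-1 * (frac_int 1 w s - frac_int 1 w t)| <= e.
  exact: cvg_within.
near=> s.
have st : s != t by near: s.
have [s0 std] : 0 < s /\ `|t - s| < d by near: s.
have st0 : s - t != 0 by rewrite subr_eq0.
apply: quotient_close => //.
have hx x : `|t - x| < d -> `|w x - w t| <= e by move=> h; rewrite distrC; exact: H.
move: st; rewrite neq_lt => /orP[st|ts].
  have := @frac_int1_incr (w t) e s t; rewrite (ltW s0) (ltW st) => /(_ isT).
  rewrite (ltr0_norm (_ : s - t < 0)) ?subr_lt0 // opprB.
  move: (frac_int 1 w s) (frac_int 1 w t) => a b h.
  have -> : a - b - w t * (s - t) = - (b - a - w t * (t - s)) by ring.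
  by rewrite normrN; apply: h => x xI; apply: hx; move: std; rewrite !ltr_norml; lra.
have := @frac_int1_incr (w t) e t s; rewrite (ltW t0) (ltW ts) => /(_ isT).
rewrite (gtr0_norm (_ : 0 < s - t)) ?subr_gt0 //.
by apply => x xI; apply: hx; move: std; rewrite !ltr_norml; lra.
Unshelve. all: by end_near. Qed.
End Ordinary.

Lemma rcaputo_frac_int (T rho D c t : R) (w : R -> R) : 0 < rho <= 1 -> 0 < t ->
  continuous w -> (forall x, `|w x| <= D) ->
  rcaputo T rho (fun s => c + frac_int rho w s) t (w t).
Proof.
move=> /andP[rho0 rho1] t0 cw wD; rewrite /rcaputo; case: ifPn => [/eqP ->|rn1].
  under eq_fun do rewrite opprD addrACA subrr add0r.
  exact: frac_int1_derivative.
have r1 : rho < 1 by rewrite lt_neqAle rn1.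
exists (stieltjes_frac rho w t).
  by move=> b bt; exact: rstieltjes_frac_int wD _ _ _ bt.
exact: stieltjes_frac_cvg wD _ _ _.
Qed.
End CaputoOfIntegral.

(** * The scalar problem *)

Section Clamp.
Variables (R : realType) (T : R).
Hypothesis T0 : 0 <= T.

(* Composing with [clamp] turns functions on [0, T] into functions on R. *)
Definition clamp (x : R) : R := Num.max 0 (Num.min x T).

Lemma clamp_id x : 0 <= x <= T -> clamp x = x.
Proof. by move=> /andP[x0 xT]; rewrite /clamp min_l // max_r. Qed.

Lemma clamp_itv x : 0 <= clamp x <= T.
Proof. by rewrite /clamp le_max lexx /= ge_max T0 ge_min lexx orbT. Qed.

Lemma clamp_continuous : continuous clamp.
Proof.
move=> x; apply: (@continuous_max _ _ (cst 0 : R -> R^o) (fun y : R => Num.min y T)).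
  exact: cvg_cst.
by apply: (@continuous_min _ _ (id : R -> R^o) (cst T)); [exact: cvg_id | exact: cvg_cst].
Qed.

Lemma clamp_comp_continuous (V : topologicalType) (g : R -> V) :
  {within `[0, T], continuous g} -> continuous (g \o clamp).
Proof.
move=> /subspace_continuousP cg x; suff : g (clamp y) @[y --> x] --> g (clamp x) by [].
have xI : `[0, T]%classic (clamp x) by rewrite /= in_itv /= clamp_itv.
have h := cg _ xI.
have cc : clamp y @[y --> x] --> within `[0, T] (nbhs (clamp x)).
  move=> P P1; have : nbhs x (clamp @^-1` [set y | `[0, T]%classic y -> P y]).
    exact: (@clamp_continuous x _ P1).
  by apply: (@filterS _ (nbhs x)) => y /= hy; apply: hy; rewrite in_itv /= clamp_itv.
exact: cvg_comp cc h.
Qed.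
End Clamp.

Section FracIntLinear.
Variables (R : realType) (rho : R).
Hypothesis rho0 : 0 < rho.

Lemma frac_int_lin (w1 w2 : R -> R) (D1 D2 p q t : R) :
  continuous w1 -> continuous w2 -> (forall x, `|w1 x| <= D1) -> (forall x, `|w2 x| <= D2) ->
  frac_int rho (fun x => p * w1 x + q * w2 x) t = p * frac_int rho w1 t + q * frac_int rho w2 t.
Proof.
move=> c1 c2 h1 h2; have m1 := continuous_measurable_fun c1; have m2 := continuous_measurable_fun c2.
have mp := @measurable_pow_ker R rho.
have i1 := integrable_conv rho0 ltr01 mp (measurable_cut m1) (@dominated_pow_ker R rho t) (fun x => norm_cut_le x h1).
have i2 := integrable_conv rho0 ltr01 mp (measurable_cut m2) (@dominated_pow_ker R rho t) (fun x => norm_cut_le x h2).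
rewrite /frac_int [p * _]mulrCA [q * _]mulrCA -mulrDr -convDr //.
by congr (_ * conv _ _ t); apply/funext => s; rewrite /cut; ring.
Qed.

Lemma mild_lin (lam : R) (w1 w2 : R -> R) (D1 D2 p q t : R) : 0 < lam ->
  continuous w1 -> continuous w2 -> (forall x, `|w1 x| <= D1) -> (forall x, `|w2 x| <= D2) ->
  mild rho lam (fun x => p * w1 x + q * w2 x) t = p * mild rho lam w1 t + q * mild rho lam w2 t.
Proof.
move=> lam0 c1 c2 h1 h2; have m1 := continuous_measurable_fun c1; have m2 := continuous_measurable_fun c2.
have mp := measurable_ml_ker lam rho0.
have i1 := integrable_conv rho0 ltr01 mp (measurable_cut m1) (dominated_ml_ker rho0 lam0 (T := t)) (fun x => norm_cut_le x h1).
have i2 := integrable_conv rho0 ltr01 mp (measurable_cut m2) (dominated_ml_ker rho0 lam0 (T := t)) (fun x => norm_cut_le x h2).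
rewrite /mild -convDr //.
by congr (conv _ _ t); apply/funext => s; rewrite /cut; ring.
Qed.

Lemma eq_frac_int (w1 w2 : R -> R) (T t : R) : t <= T ->
  (forall x, 0 <= x <= T -> w1 x = w2 x) -> frac_int rho w1 t = frac_int rho w2 t.
Proof.
move=> tT h; rewrite /frac_int /conv; congr (_ * _); apply: eq_Rintegral => s _.
have [s0|s0] := leP s 0; first by rewrite !cut_neg // !mulr0.
have [ts|st] := leP t s; first by rewrite pow_ker0 ?mul0r ?subr_le0.
by rewrite !cut_pos // h //; lra.
Qed.
End FracIntLinear.

(** * A single eigenvalue: relaxation function, comparison bounds and uniqueness *)

Section Mode.
Variables (R : realType) (rho T lam : R).
Hypotheses (rho01 : 0 < rho <= 1) (T0 : 0 < T) (lam0 : 0 < lam).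

Let rho0 : 0 < rho. Proof. by case/andP: rho01. Qed.

Lemma mild_frac_int (g : R -> R) (D t : R) : continuous g -> (forall x, `|g x| <= D) ->
  mild rho lam g t = frac_int rho (fun s => g s - lam * mild rho lam g s) t.
Proof.
move=> cg gD; have [t0|t0] := ltP 0 t; first exact: mild_resolvent gD _ t0.
rewrite mild0 // /frac_int /conv.
rewrite (_ : (fun s => _) = cst 0) ?Rintegral_cst ?mul0r ?mulr0 //.
apply/funext => s; have [s0|s0] := leP s 0; first by rewrite cut_neg // mulr0.
by rewrite pow_ker0 ?mul0r //; lra.
Qed.

Lemma bounded_clamp (f : R -> R) : continuous f ->
  exists2 D : R, 0 <= D & forall x, `|f (clamp T x)| <= D.
Proof.
move=> cf; have [D [D0 hD]] := @bounded_itv R f 0 T (continuous_subspaceT cf).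
by exists D => // x; apply: hD; apply: clamp_itv; exact: ltW.
Qed.

(** [rcaputo_frac_int] asks for a bounded density on the whole line. Composing with [clamp] provides
    one without changing the fractional integral on [0, T]. *)
Lemma rcaputo_cst_frac_int (c t : R) (w h : R -> R) : 0 < t <= T -> continuous w ->
  (forall s, 0 <= s <= T -> h s = c + frac_int rho w s) -> rcaputo T rho h t (w t).
Proof.
move=> tT cw hh.
have cc := clamp_comp_continuous (ltW T0) (continuous_subspaceT cw).
have [D D0 hD] := bounded_clamp cw.
have -> : w t = (w \o clamp T) t by rewrite /= clamp_id //; lra.
apply: (@rcaputo_ext _ _ _ (fun s => c + frac_int rho (w \o clamp T) s)) => //.
  move=> s sT; rewrite hh //; congr (_ + _).
  apply: (@eq_frac_int _ rho _ _ T) => [|x xT]; first by case/andP: sT.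
  by rewrite /= clamp_id.
by apply: (@rcaputo_frac_int _ _ _ D) => //; case/andP: tT.
Qed.

Lemma rcaputo_mild (g : R -> R) (D t : R) : continuous g -> (forall x, `|g x| <= D) ->
  0 < t <= T -> rcaputo T rho (mild rho lam g) t (g t - lam * mild rho lam g t).
Proof.
move=> cg gD tT.
apply: (@rcaputo_cst_frac_int 0 _ (fun s => g s - lam * mild rho lam g s)) => //.
  move=> x; apply: cvgB; first exact: cg.
  by apply: cvgM; [exact: cvg_cst | exact: (mild_continuous rho0 lam0 cg gD)].
by move=> s _; rewrite add0r; exact: mild_frac_int gD.
Qed.

(* This is E_rho (- lam t^rho), by [E_rho_mild]. *)
Definition relax (t : R) : R := 1 - lam * mild rho lam (cst 1) t.

Let c1 : continuous (cst 1 : R -> R). Proof. by move=> x; exact: cvg_cst. Qed.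
Let h1 : forall x : R, `|cst 1 x| <= (1 : R). Proof. by move=> x; rewrite normr1. Qed.

Lemma relax_continuous : continuous relax.
Proof.
move=> x; apply: cvgB; first exact: cvg_cst.
by apply: cvgM; [exact: cvg_cst | exact: (mild_continuous rho0 lam0 c1 h1)].
Qed.

Lemma relax0 : relax 0 = 1.
Proof. by rewrite /relax mild0 // mulr0 subr0. Qed.

Lemma rcaputo_relax (t : R) : 0 < t <= T -> rcaputo T rho relax t (- lam * relax t).
Proof.
move=> tT; have a := rcaputo_mild c1 h1 tT.
have b : rcaputo T rho (cst 1) t 0.
  apply: (@rcaputo_cst_frac_int 1 _ (cst 0)) => //; first by move=> x; exact: cvg_cst.
  move=> s _; rewrite /frac_int /conv (_ : (fun s => _) = cst 0) ?Rintegral_cst ?mul0r ?mulr0 ?addr0 //.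
  by apply/funext => y; rewrite /cut !mulr0.
have := rcaputo_lin 1 (- lam) b a.
rewrite mulr0 add0r.
by apply: rcaputo_ext => // s _; rewrite /relax /=; ring.
Qed.

(** Wherever the mild solution b is negative, its Caputo derivative g - lam b is positive, so the
    maximum principle applies to - b. *)
Lemma mild_ge0 (g : R -> R) (D : R) : continuous g -> (forall x, `|g x| <= D) ->
  (forall t, 0 <= t <= T -> 0 <= g t) -> forall t, 0 <= t <= T -> 0 <= mild rho lam g t.
Proof.
move=> cg gD g0 t tT; rewrite -oppr_le0.
have cm := mild_continuous rho0 lam0 cg gD.
apply: (@caputo_weak_max _ T rho (fun t => - mild rho lam g t)
  (fun t => - (g t - lam * mild rho lam g t))) => //.
- by move=> x; apply: cvgN; exact: cm.
- by rewrite mild0 // oppr0.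
- move=> s sT; have m := rcaputo_mild cg gD sT.
  have := rcaputo_lin (-1) 0 m m; rewrite mul0r addr0 mulN1r.
  by apply: rcaputo_ext => // y _; ring.
- move=> s sT; rewrite oppr_gt0 => ms; have : 0 <= g s by apply: g0; lra.
  have : lam * mild rho lam g s < 0 by rewrite pmulr_rlt0.
  by lra.
Qed.

Lemma relax_ge0 (t : R) : 0 <= t <= T -> 0 <= relax t.
Proof.
move=> tT; rewrite -oppr_le0.
apply: (@caputo_weak_max _ T rho (fun t => - relax t) (fun t => lam * relax t)) => //.
- by move=> x; apply: cvgN; exact: relax_continuous.
- by rewrite relax0; lra.
- move=> s sT; have m := rcaputo_relax sT.
  have := rcaputo_lin (-1) 0 m m; rewrite mul0r addr0 mulN1r mulNr opprK.
  by apply: rcaputo_ext => // y _; ring.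
- by move=> s sT; rewrite oppr_gt0 => ms; rewrite pmulr_rlt0.
Qed.

Lemma relax_le1 (t : R) : 0 <= t <= T -> relax t <= 1.
Proof.
move=> tT; rewrite /relax gerBl mulr_ge0 ?(ltW lam0) //.
by apply: mild_ge0 tT.
Qed.

Lemma relax_lt1 (t : R) : 0 < t <= T -> relax t < 1.
Proof.
move=> tT; rewrite lt_neqAle relax_le1 ?andbT; last lra.
(* If the value 1 were attained, [t] would be a maximum point with derivative [- lam < 0]. *)
apply/eqP => e; have := rcaputo_max rho01 tT relax_continuous _ (rcaputo_relax tT).
rewrite e mulr1 oppr_ge0 => h.
have : lam <= 0 by apply: h => s sT; apply: relax_le1; lra.
by rewrite leNgt lam0.
Qed.

Lemma mild1E (t : R) : mild rho lam (cst 1) t = (1 - relax t) / lam.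
Proof. by rewrite /relax opprB addrCA subrr addr0 mulrAC mulfV ?mul1r // gt_eqF. Qed.

(** Comparison with the constant source [m]: the mild solution for [g - m] is nonnegative, and the
    one for the constant 1 is explicit by [mild1E]. *)
Lemma mild_ge (g : R -> R) (D m t : R) : continuous g -> (forall x, `|g x| <= D) ->
  (forall t, 0 <= t <= T -> m <= g t) -> 0 <= t <= T ->
  m * ((1 - relax t) / lam) <= mild rho lam g t.
Proof.
move=> cg gD gm tT; rewrite -mild1E -subr_ge0.
have := mild_lin rho0 1 (- m) t lam0 cg c1 gD h1; rewrite mul1r mulNr => <-.
apply: (@mild_ge0 _ (D + `|m|)) => //.
- move=> x; apply: cvgD; apply: cvgM; try exact: cvg_cst; exact: cg.
- move=> x; rewrite mul1r mulr1; apply: le_trans (ler_normB _ _) _; exact: lerD.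
- by move=> s sT; rewrite mul1r mulr1 subr_ge0 gm.
Qed.

Lemma mildN (g : R -> R) (D t : R) : continuous g -> (forall x, `|g x| <= D) ->
  mild rho lam (fun x => - g x) t = - mild rho lam g t.
Proof.
move=> cg gD; have := mild_lin rho0 (-1) 0 t lam0 cg cg gD gD.
rewrite mulN1r mul0r addr0 => <-; congr (mild _ _ _ t); apply/funext => x; ring.
Qed.

Lemma mild_le (g : R -> R) (D t : R) : continuous g -> (forall x, `|g x| <= D) ->
  0 <= t <= T -> `|mild rho lam g t| <= D * ((1 - relax t) / lam).
Proof.
move=> cg gD tT; rewrite ler_norml; apply/andP; split.
  rewrite -mulNr; apply: (mild_ge cg gD) => // s _.
  by have := gD s; rewrite ler_norml => /andP[].
rewrite -lerN2 -(mildN t cg gD) -mulNr; apply: (@mild_ge _ D) => //.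
- by move=> x; apply: cvgN; exact: cg.
- by move=> x; rewrite normrN.
- by move=> s _; rewrite lerN2; have := gD s; rewrite ler_norml => /andP[].
Qed.

(** Used with x = E(T) and y = E(t0): as (1 - x) (1 - y) + y (1 - x) = 1 - x, the dependence on t0
    drops out. *)
Lemma convex_bound (m l x y a b : R) : 0 <= 1 - x -> 0 <= y ->
  m * ((1 - y) / l) <= a -> m * ((1 - x) / l) <= b ->
  m * ((1 - x) / l) <= (1 - x) * a + y * b.
Proof.
move=> x1 y0 ha hb.
have -> : m * ((1 - x) / l) = (1 - x) * (m * ((1 - y) / l)) + y * (m * ((1 - x) / l)) by ring.
exact: lerD (ler_wpM2l x1 ha) (ler_wpM2l y0 hb).
Qed.

Section WithSource.
Variables (g : R -> R) (D m t0 : R).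
Hypotheses (cg : continuous g) (gD : forall x, `|g x| <= D).

(* [coef_denominator] and [u_mode] in terms of [mild]. *)
Definition denom : R := (1 - relax T) * mild rho lam g t0 + relax t0 * mild rho lam g T.

Definition mode (t : R) : R := mild rho lam g t + mild rho lam g T / (1 - relax T) * relax t.

Let TT : 0 < T <= T. Proof. by rewrite T0 lexx. Qed.

Let TT' : 0 <= T <= T. Proof. by rewrite (ltW T0) lexx. Qed.

Lemma one_relax_gt0 (t : R) : 0 < t <= T -> 0 < 1 - relax t.
Proof. by move=> tT; rewrite subr_gt0 relax_lt1. Qed.

Let qT : 0 < 1 - relax T. Proof. exact: one_relax_gt0. Qed.

Let D0 : 0 <= D. Proof. by apply: le_trans (gD 0). Qed.

Lemma denom_lower : 0 < t0 < T -> 0 < m ->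
  (forall t, 0 <= t <= T -> m <= g t) \/ (forall t, 0 <= t <= T -> g t <= - m) ->
  m * ((1 - relax T) / lam) <= `|denom|.
Proof.
move=> t0T m0.
have t0T' : 0 <= t0 <= T by lra.
have aux (f : R -> R) : continuous f -> (forall x, `|f x| <= D) -> (forall t, 0 <= t <= T -> m <= f t) ->
    m * ((1 - relax T) / lam) <= (1 - relax T) * mild rho lam f t0 + relax t0 * mild rho lam f T.
  move=> cf fD fm.
  have a := mild_ge cf fD fm t0T'; have b := mild_ge cf fD fm TT'.
  exact: (convex_bound (ltW qT) (relax_ge0 t0T') a b).
case=> gm; first by apply: le_trans (ler_norm _); exact: aux.
have cN : continuous (fun x => - g x) by move=> x; apply: cvgN; exact: cg.
have := aux (fun x => - g x) cN.
rewrite !(mildN _ cg gD) => h; rewrite -normrN; apply: le_trans (ler_norm _).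
rewrite !mulrN -opprD in h; apply: h => [x|t tT]; first by rewrite normrN.
by rewrite lerNr gm.
Qed.

(** The bound of [mild_le] at [T] carries the factor [1 - relax T], which cancels the small
    denominator in [mode]. The result depends on [D] alone. *)
Lemma mode_bound (t : R) : 0 <= t <= T -> `|lam * mode t| <= 2 * D.
Proof.
move=> tT; rewrite /mode mulrDr mulr_natl mulr2n.
have h s : 0 <= s <= T -> `|lam * mild rho lam g s| <= D * (1 - relax s).
  move=> sT; have := mild_le cg gD sT; rewrite normrM (gtr0_norm lam0) => a.
  by move: a; rewrite mulrA ler_pdivlMr // [lam * _]mulrC.
apply: le_trans (ler_normD _ _) _; apply: lerD.
  apply: le_trans (h t tT) _; rewrite ler_piMr // gerBl relax_ge0 //.
rewrite !mulrA 2!normrM normfV (gtr0_norm qT) (ger0_norm (relax_ge0 tT)).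
apply: (@le_trans _ _ (D * relax t)).
  by rewrite ler_wpM2r ?relax_ge0 // ler_pdivrMr // h.
by rewrite ler_piMr // relax_le1.
Qed.

Lemma mode_continuous : continuous mode.
Proof.
move=> x; apply: cvgD; first exact: (mild_continuous rho0 lam0 cg gD).
by apply: cvgM; [exact: cvg_cst | exact: relax_continuous].
Qed.

(** The Caputo derivative of [mode] on ]0, T], extended to a bounded continuous function on the
    line. *)
Definition mode_source (s : R) : R := g (clamp T s) - lam * mode (clamp T s).

Lemma mode_source_continuous : continuous mode_source.
Proof.
apply: (clamp_comp_continuous (ltW T0) (g := fun s => g s - lam * mode s)).
apply: continuous_subspaceT => x; apply: cvgB; first exact: cg.
by apply: cvgM; [exact: cvg_cst | exact: mode_continuous].
Qed.

Lemma mode_source_bound (s : R) : `|mode_source s| <= 3 * D.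
Proof.
apply: le_trans (ler_normB _ _) _.
have := mode_bound (clamp_itv (ltW T0) s); have := gD (clamp T s).
by rewrite -[3]/(1 + 2); lra.
Qed.

(** [mild] is the fractional integral of g - lam b, and for the source 1 that density is [relax]
    itself, so relax = 1 - lam J relax. Linearity of the fractional integral gives the rest. *)
Lemma mode_frac_int (t : R) : 0 <= t <= T ->
  mode t = mild rho lam g T / (1 - relax T) + frac_int rho mode_source t.
Proof.
move=> /andP[_ tT]; set k := _ / _.
pose w1 s := g s - lam * mild rho lam g s.
have cw1 : continuous w1.
  move=> x; apply: cvgB; first exact: cg.
  by apply: cvgM; [exact: cvg_cst | exact: (mild_continuous rho0 lam0 cg gD)].
have [D1 _ hD1] := bounded_clamp cw1.
have [D2 _ hD2] := bounded_clamp relax_continuous.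
have cc1 := clamp_comp_continuous (ltW T0) (continuous_subspaceT cw1).
have cc2 := clamp_comp_continuous (ltW T0) (continuous_subspaceT relax_continuous).
have L := frac_int_lin rho0 1 (- (k * lam)) t cc1 cc2 hD1 hD2.
have -> : frac_int rho mode_source t = 
  frac_int rho (fun x => 1 * (w1 \o clamp T) x + - (k * lam) * (relax \o clamp T) x) t.
  congr frac_int; apply/funext => s; rewrite /mode_source /mode /w1 /= -/k; ring.
rewrite L.
have -> : frac_int rho (w1 \o clamp T) t = mild rho lam g t.
  rewrite (mild_frac_int t cg gD); apply: (eq_frac_int _ tT) => x xT.
  by rewrite /= clamp_id.
have -> : frac_int rho (relax \o clamp T) t = mild rho lam (cst 1) t.
  rewrite (mild_frac_int t c1 h1); apply: (eq_frac_int _ tT) => x xT.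
  by rewrite /= clamp_id.
by rewrite /mode -/k /relax; ring.
Qed.

(** The difference of the two sides starts at 0 and has Caputo derivative - lam times itself; the
    maximum principle applies to it and to its opposite. *)
Lemma scalar_unique (h : R -> R) (F : R) : continuous h ->
  (forall t, 0 < t <= T -> rcaputo T rho h t (F * g t - lam * h t)) ->
  forall t, 0 <= t <= T -> h t = h 0 * relax t + F * mild rho lam g t.
Proof.
move=> ch hE t tT.
pose d s := h s - (h 0 * relax s + F * mild rho lam g s).
have cd : continuous d.
  move=> x; apply: cvgB; first exact: ch.
  apply: cvgD; apply: cvgM; [exact: cvg_cst | exact: relax_continuous | exact: cvg_cst |].
  exact: (mild_continuous rho0 lam0 cg gD).
have d0 : d 0 = 0 by rewrite /d relax0 mild0 // mulr0 addr0 mulr1 subrr.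
have dE s : 0 < s <= T -> rcaputo T rho d s (- lam * d s).
  move=> sT.
  have A := rcaputo_lin (h 0) F (rcaputo_relax sT) (rcaputo_mild cg gD sT).
  have B := rcaputo_lin 1 (-1) (hE s sT) A.
  have -> : - lam * d s = 1 * (F * g s - lam * h s) + -1 *
    (h 0 * (- lam * relax s) + F * (g s - lam * mild rho lam g s)) by rewrite /d; ring.
  by apply: rcaputo_ext B => // y _; rewrite /d; ring.
have dN s : 0 < s <= T -> rcaputo T rho (fun x => - d x) s (lam * d s).
  move=> sT; have := rcaputo_lin (-1) 0 (dE s sT) (dE s sT).
  rewrite mul0r addr0 mulN1r mulNr opprK.
  by apply: rcaputo_ext => // y _; ring.
apply/eqP; rewrite -subr_eq0 eq_le; apply/andP; split.
  apply: (@caputo_weak_max _ T rho d (fun s => - lam * d s)) => //; first by rewrite d0.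
  by move=> s sT ds; rewrite mulNr oppr_lt0 mulr_gt0.
rewrite -oppr_le0.
apply: (@caputo_weak_max _ T rho (fun x => - d x) (fun s => lam * d s)) => //.
- by move=> x; apply: cvgN; exact: cd.
- by rewrite d0 oppr0.
- by move=> s sT; rewrite oppr_gt0 => ds; rewrite pmulr_rlt0.
Qed.

(** The condition [h T = h 0] determines [h 0], since [1 - relax T] is nonzero; evaluation at [t0]
    then gives the equation for [F]. *)
Lemma scalar_solution (h : R -> R) (F : R) : 0 < t0 < T -> continuous h ->
  (forall t, 0 < t <= T -> rcaputo T rho h t (F * g t - lam * h t)) -> h T = h 0 ->
  F * denom = h t0 * (1 - relax T) /\ forall t, 0 <= t <= T -> h t = F * mode t.
Proof.
move=> t0T ch hE hT; have U := scalar_unique ch hE.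
have q0 : 1 - relax T != 0 by rewrite gt_eqF.
have h0E : h 0 = F * (mild rho lam g T / (1 - relax T)).
  have e := U T TT'; rewrite hT in e.
  rewrite mulrA; apply: (mulIf q0); rewrite divfK // mulrBr mulr1 {1}e; ring.
have tE t : 0 <= t <= T -> h t = F * mode t.
  have alg (x y z : R) : F * x * y + F * z = F * (z + x * y) by ring.
  by move=> tT; rewrite (U t tT) h0E; exact: alg.
split => //; rewrite tE; last lra.
have alg (x y a b : R) : 1 - x != 0 ->
    F * ((1 - x) * a + y * b) = F * (a + b / (1 - x) * y) * (1 - x) by move=> x0; field.
exact: alg.
Qed.
End WithSource.

End Mode.

(** * Diagonal operators in a Hilbert space *)

Section RorCTheory.
Variables (R : realType) (cplx : bool).
Notation K := (RorC R cplx).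
Notation rr := (@RorC_real R cplx).
Notation cj := (@RorC_conj R cplx).

Definition RorC_Re : K -> R :=
  match cplx return RorC R cplx -> R with
  | true => fun z : R[i] => complex.Re z
  | false => fun x => x
  end.

Lemma RorC_realD a b : rr (a + b) = rr a + rr b.
Proof. by case: cplx => //=; rewrite rmorphD. Qed.

Lemma RorC_realB a b : rr (a - b) = rr a - rr b.
Proof. by case: cplx => //=; rewrite rmorphB. Qed.

Lemma RorC_realM a b : rr (a * b) = rr a * rr b.
Proof. by case: cplx => //=; rewrite rmorphM. Qed.

Lemma RorC_realV a : rr a^-1 = (rr a)^-1.
Proof. by case: cplx => //=; rewrite fmorphV. Qed.

Lemma RorC_real0 : rr 0 = 0.
Proof. by case: cplx. Qed.

Lemma RorC_real1 : rr 1 = 1.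
Proof. by case: cplx. Qed.

Lemma RorC_real_eq0 a : (rr a == 0) = (a == 0).
Proof.
case: cplx => //=; apply/eqP/eqP => [|-> //].
by move=> /(congr1 (@complex.Re R)).
Qed.

Lemma RorC_real_le a b : (rr a <= rr b) = (a <= b).
Proof. by case: cplx => //=; rewrite lecR. Qed.

Lemma RorC_real_lt a b : (rr a < rr b) = (a < b).
Proof. by case: cplx => //=; rewrite ltcR. Qed.

Lemma RorC_real_norm a : `|rr a| = rr `|a|.
Proof. by case: cplx => //=; rewrite normc_def /= expr0n /= addr0 sqrtr_sqr. Qed.

Lemma RorC_ReK (z : K) : 0 <= z -> rr (RorC_Re z) = z.
Proof.
rewrite /RorC_Re; move: z; case: cplx => //= z z0.
by have /RRe_real := ger0_real z0.
Qed.

Lemma RorC_realK : cancel rr RorC_Re.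
Proof. by rewrite /RorC_Re; case: cplx. Qed.

Lemma RorC_ReD (y z : K) : RorC_Re (y + z) = RorC_Re y + RorC_Re z.
Proof. by rewrite /RorC_Re; move: y z; case: cplx => //= -[? ?] [? ?]. Qed.

Lemma RorC_ReM a (z : K) : RorC_Re (rr a * z) = a * RorC_Re z.
Proof.
rewrite /RorC_Re; move: z; case: cplx => //= -[x y] /=.
by rewrite mul0r subr0.
Qed.

Lemma RorC_Re_norm (z : K) : `|RorC_Re z| <= RorC_Re `|z|.
Proof.
rewrite -RorC_real_le RorC_ReK //.
rewrite /RorC_Re; move: z; case: cplx => //= z; exact: normc_ge_Re.
Qed.

Lemma RorC_conj_real a : cj (rr a) = rr a.
Proof. by case: cplx => //=; rewrite oppr0. Qed.

Lemma mul_RorC_conj (z : K) : z * cj z = `|z| ^+ 2.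
Proof.
by move: z; case: cplx => /= z; rewrite ?sqr_normc// real_normK ?num_real// expr2.
Qed.

Lemma RorC_norm_conj (z : K) : `|cj z| = `|z|.
Proof. by move: z; case: cplx => /= z; rewrite ?normcJ. Qed.

Lemma RorC_conj_eq0 (z : K) : (cj z == 0) = (z == 0).
Proof. by rewrite -normr_eq0 RorC_norm_conj normr_eq0. Qed.

End RorCTheory.

Section RealNorm.
Variables (R : realType) (cplx : bool).
Notation K := (RorC R cplx).
Notation rr := (@RorC_real R cplx).

(** Norms take values in [K]; their real part allows estimates to be made in [R] for both kinds of
    scalars. *)
Definition rnorm (V : normedZmodType K) (x : V) : R := RorC_Re `|x|.

Lemma rnormE (V : normedZmodType K) (x : V) : `|x| = rr (rnorm x).
Proof. by rewrite RorC_ReK. Qed.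

Lemma rnorm_ge0 (V : normedZmodType K) (x : V) : 0 <= rnorm x.
Proof. by rewrite -(RorC_real_le cplx) RorC_real0 -rnormE. Qed.

Lemma rnorm0 (V : normedZmodType K) : rnorm (0 : V) = 0.
Proof. by rewrite /rnorm normr0 -(RorC_real0 _ cplx) RorC_realK. Qed.

Lemma rnorm_eq0 (V : normedZmodType K) (x : V) : (rnorm x == 0) = (x == 0).
Proof. by rewrite -(RorC_real_eq0 cplx) -rnormE normr_eq0. Qed.

Lemma rnormN (V : normedZmodType K) (x : V) : rnorm (- x) = rnorm x.
Proof. by rewrite /rnorm normrN. Qed.

Lemma rnormD (V : normedZmodType K) (x y : V) :
  rnorm (x + y) <= rnorm x + rnorm y.
Proof. by rewrite -(RorC_real_le cplx) RorC_realD -!rnormE ler_normD. Qed.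

Lemma rnormM (a b : K) : rnorm (a * b) = rnorm a * rnorm b.
Proof.
apply: (can_inj (@RorC_realK R cplx)).
by rewrite RorC_realM -!rnormE normrM.
Qed.

Lemma rnorm_real a : rnorm (rr a) = `|a|.
Proof. by rewrite /rnorm RorC_real_norm RorC_realK. Qed.

Lemma rnormZ (V : normedModType K) (a : K) (x : V) :
  rnorm (a *: x) = rnorm a * rnorm x.
Proof.
apply: (can_inj (@RorC_realK R cplx)).
by rewrite RorC_realM -!rnormE normrZ.
Qed.

Lemma cvg_rnorm (V : normedModType K) (T : Type) (F : set_system T)
    {FF : Filter F} (f : T -> V) (l : V) :
  f @ F --> l <-> forall e, 0 < e -> \forall t \near F, rnorm (l - f t) < e.
Proof.
split=> [/cvgrPdist_lt fl e e0|fl].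
  have /fl : (0 : K) < rr e by rewrite -(RorC_real0 _ cplx) RorC_real_lt.
  by apply: filterS => t; rewrite rnormE RorC_real_lt.
apply/cvgrPdist_lt => e e0.
have E := RorC_ReK (ltW e0); move: e0.
rewrite -E -{1}(RorC_real0 _ cplx) RorC_real_lt => /fl.
by apply: filterS => t; rewrite rnormE RorC_real_lt.
Qed.

End RealNorm.

Section Hilbert.
Variables (R : realType) (cplx : bool).
Notation K := (RorC R cplx).
Notation rr := (@RorC_real R cplx).
Notation cj := (@RorC_conj R cplx).
Variable H : completeNormedModType K.
Variable dot : {dot H for @RorC_conj R cplx}.
Hypothesis hdot : scalar_product_of_norm dot.

Lemma dotDl x y z : dot (x + y) z = dot x z + dot y z.
Proof. exact: linearDl. Qed.

Lemma dotDr x y z : dot x (y + z) = dot x y + dot x z.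
Proof. exact: linearDr. Qed.

Lemma dotBl x y z : dot (x - y) z = dot x z - dot y z.
Proof. exact: linearBl. Qed.

Lemma dotBr x y z : dot x (y - z) = dot x y - dot x z.
Proof. exact: linearBr. Qed.

Lemma dotZl a x y : dot (a *: x) y = a * dot x y.
Proof. exact: linearZl_LR. Qed.

Lemma dotZr a x y : dot x (a *: y) = cj a * dot x y.
Proof. exact: linearZr_LR. Qed.

Lemma dot0r x : dot x 0 = 0.
Proof. exact: linear0r. Qed.

Lemma dot_suml (I : Type) (r : seq I) (F : I -> H) y :
  dot (\sum_(i <- r) F i) y = \sum_(i <- r) dot (F i) y.
Proof. exact: linear_sumlz. Qed.

Lemma dot_sumr (I : Type) (r : seq I) (F : I -> H) x :
  dot x (\sum_(i <- r) F i) = \sum_(i <- r) dot x (F i).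
Proof. exact: linear_sumr. Qed.

Lemma dotC x y : dot x y = cj (dot y x).
Proof. by rewrite (hermitian_subproof (s := dot)) expr0 mul1r. Qed.

Lemma dot_rnorm x : dot x x = rr (rnorm x ^+ 2).
Proof. by rewrite -hdot rnormE !expr2 RorC_realM. Qed.

Lemma pythagoras x y : dot x y = 0 -> rnorm (x + y) ^+ 2 = rnorm x ^+ 2 + rnorm y ^+ 2.
Proof.
move=> xy0; apply: (can_inj (@RorC_realK R cplx)).
have yx0 : dot y x = 0 by apply/eqP; rewrite dotC RorC_conj_eq0 xy0.
by rewrite RorC_realD -!dot_rnorm dotDl !dotDr xy0 yx0 addr0 add0r.
Qed.

Lemma cauchy_schwarz x y : rnorm (dot x y) <= rnorm x * rnorm y.
Proof.
have [->|y0] := eqVneq y 0; first by rewrite dot0r rnorm0 mulr_ge0 ?rnorm_ge0.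
have ny : 0 < rnorm y by rewrite lt_def rnorm_eq0 y0 rnorm_ge0.
have yy : dot y y != 0 by rewrite dot_rnorm RorC_real_eq0 sqrf_eq0 gt_eqF.
(* [a *: y] is the orthogonal projection of [x] on the line of [y], hence no longer than [x]. *)
pose a := dot x y / dot y y.
have o : dot (x - a *: y) (a *: y) = 0.
  by rewrite dotZr dotBl dotZl divfK// subrr mulr0.
have na : rnorm (dot x y) = rnorm a * rnorm y ^+ 2.
  rewrite -[in LHS](divfK yy (dot x y)) rnormM -/a dot_rnorm rnorm_real.
  by rewrite ger0_norm ?sqr_ge0.
have := pythagoras o; rewrite subrK => P.
have {P} : rnorm (a *: y) <= rnorm x.
  rewrite -(ler_pXn2r (n := 2)) ?nnegrE ?rnorm_ge0//.
  by rewrite P lerDr sqr_ge0.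
rewrite rnormZ => h; rewrite na expr2 mulrA.
by rewrite ler_wpM2r ?rnorm_ge0.
Qed.

Variable v : nat -> H.
Hypothesis hv : complete_orthonormal dot v.

Lemma orthonormalE j k : dot (v j) (v k) = (j == k)%:R.
Proof. exact: hv.1. Qed.

Lemma orthonormal_ext x y : (forall k, dot x (v k) = dot y (v k)) -> x = y.
Proof.
move=> xy; apply/eqP; rewrite -subr_eq0; apply/eqP; apply: hv.2 => k.
by rewrite dotBl xy subrr.
Qed.

Lemma rnorm_orthonormal k : rnorm (v k) = 1.
Proof.
have := dot_rnorm (v k); rewrite orthonormalE eqxx -(RorC_real1 _ cplx).
move=> /(can_inj (@RorC_realK R cplx)) /esym /eqP.
by rewrite -[X in _ == X](expr1n _ 2) eqrXn2 ?rnorm_ge0// => /eqP.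
Qed.

Lemma dot_orthonormal_sum a m n j :
  dot (\sum_(m <= k < n) a k *: v k) (v j) = (m <= j < n)%N%:R * a j.
Proof.
rewrite dot_suml.
under eq_bigr do rewrite dotZl orthonormalE.
have [mjn|/negbTE mjn] := boolP (m <= j < n)%N.
  rewrite (bigD1_seq j) ?mem_index_iota ?iota_uniq//= eqxx mulr1 mul1r.
  by rewrite big1 ?addr0// => i /negbTE ->; rewrite mulr0.
rewrite mul0r big_seq big1// => i.
rewrite mem_index_iota; case: eqVneq => [->|]; first by rewrite mjn.
by rewrite mulr0.
Qed.

Lemma rnorm_orthonormal_sum a m n :
  rnorm (\sum_(m <= k < n) a k *: v k) ^+ 2 = \sum_(m <= k < n) rnorm (a k) ^+ 2.
Proof.
apply: (can_inj (@RorC_realK R cplx)); rewrite -dot_rnorm dot_sumr.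
rewrite (big_morph _ (@RorC_realD R cplx) (@RorC_real0 R cplx)).
rewrite big_seq [RHS]big_seq; apply: eq_bigr => k; rewrite mem_index_iota => h.
rewrite dotZr dot_orthonormal_sum h mul1r mulrC mul_RorC_conj rnormE.
by rewrite !expr2 RorC_realM.
Qed.

(** The partial sum s of the expansion satisfies (y, s) = |s|^2, so Cauchy-Schwarz gives |s| <=
    |y|. *)
Lemma bessel y m n : \sum_(m <= k < n) rnorm (dot y (v k)) ^+ 2 <= rnorm y ^+ 2.
Proof.
pose s := \sum_(m <= k < n) dot y (v k) *: v k.
rewrite -(rnorm_orthonormal_sum (fun k => dot y (v k))) -/s.
have E : dot y s = rr (rnorm s ^+ 2).
  rewrite /s rnorm_orthonormal_sum dot_sumr.
  rewrite (big_morph _ (@RorC_realD R cplx) (@RorC_real0 R cplx)).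
  apply: eq_bigr => k _; rewrite dotZr mulrC mul_RorC_conj rnormE.
  by rewrite !expr2 RorC_realM.
have := cauchy_schwarz y s; rewrite E rnorm_real ger0_norm ?sqr_ge0//.
rewrite ler_pXn2r ?nnegrE ?rnorm_ge0//.
have := rnorm_ge0 s; rewrite le_eqVlt => /predU1P[<- _|s0]; first exact: rnorm_ge0.
by rewrite expr2 ler_pM2r.
Qed.

(* The diagonal operator with eigenvalue c k at v k, for bounded c. *)
Definition mult (c : nat -> R) (y : H) : H :=
  limn (series (fun k => (rr (c k) * dot y (v k)) *: v k)).

Lemma bessel_tail y e : 0 < e -> exists N, forall m n, (N <= m)%N ->
  \sum_(m <= k < n) rnorm (dot y (v k)) ^+ 2 < e.
Proof.
move=> e0.
have cv : cvgn (series (fun k => rnorm (dot y (v k)) ^+ 2)).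
  apply: nondecreasing_is_cvgn.
    apply/nondecreasing_seqP => n; rewrite /series/= big_nat_recr//= lerDl.
    exact: sqr_ge0.
  by exists (rnorm y ^+ 2) => _ [n _ <-]; exact: bessel.
move/cauchy_cvgP/cauchy_seriesP/(_ _ e0): cv.
case=> -[P Q] /= [[N1 _ PN] [N2 _ QN]] PQ.
exists (maxn N1 N2) => m n; rewrite geq_max => /andP[h1 h2].
have [mn|nm] := leqP m n; last by rewrite big_geq// ltnW.
have := PQ (m, n) (conj (PN m h1) (QN n (leq_trans h2 mn))).
apply: le_lt_trans; exact: ler_norm.
Qed.

Section Mult.
Variables (B : R) (c : nat -> R) (y : H).
Hypothesis cB : forall k, `|c k| <= B.

Lemma rnorm_mult_partial m n :
  rnorm (\sum_(m <= k < n) (rr (c k) * dot y (v k)) *: v k) ^+ 2 <=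
  B ^+ 2 * \sum_(m <= k < n) rnorm (dot y (v k)) ^+ 2.
Proof.
rewrite rnorm_orthonormal_sum mulr_sumr; apply: ler_sum => k _.
rewrite rnormM rnorm_real exprMn ler_wpM2r ?sqr_ge0//.
by rewrite ler_pXn2r ?nnegrE ?normr_ge0// (le_trans (normr_ge0 (c 0%N))).
Qed.

Lemma mult_cvg : series (fun k => (rr (c k) * dot y (v k)) *: v k) @ \oo --> mult c y.
Proof.
apply/cauchy_cvgP/cauchy_seriesP => e e0.
have E := RorC_ReK (ltW e0).
have re0 : 0 < RorC_Re e by move: e0; rewrite -E -(RorC_real0 _ cplx) RorC_real_lt RorC_realK.
have B0 : 0 <= B := le_trans (normr_ge0 _) (cB 0%N).
have d0 : 0 < RorC_Re e ^+ 2 / (B ^+ 2 + 1).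
  by rewrite divr_gt0 ?exprn_gt0// ltr_wpDl ?sqr_ge0.
have [N hN] := bessel_tail y d0.
exists ([set m | (N <= m)%N], setT) => /=; first by split; [exists N|exact: filterT].
move=> [m n] /= [Nm _]; rewrite -E rnormE RorC_real_lt.
rewrite -(ltr_pXn2r (n := 2)) ?nnegrE ?rnorm_ge0 ?(ltW re0)//.
apply: le_lt_trans (rnorm_mult_partial m n) _.
apply: (@le_lt_trans _ _ ((B ^+ 2 + 1) * \sum_(m <= k < n) rnorm (dot y (v k)) ^+ 2)).
  rewrite ler_wpM2r ?lerDl//; apply: sumr_ge0 => *; exact: sqr_ge0.
rewrite mulrC -ltr_pdivlMr ?ltr_wpDl ?sqr_ge0//; exact: hN.
Qed.

Lemma rnorm_mult_le M : 0 <= M ->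
  (forall n, \sum_(0 <= k < n) (c k * rnorm (dot y (v k))) ^+ 2 <= M ^+ 2) ->
  rnorm (mult c y) <= M.
Proof.
move=> M0 h; apply/ler_addgt0Pr => e e0.
have /cvg_rnorm /(_ e e0) [n _ /(_ n (leqnn n)) /= hn] := mult_cvg.
have hs : rnorm (series (fun k => (rr (c k) * dot y (v k)) *: v k) n) <= M.
  rewrite -(ler_pXn2r (n := 2)) ?nnegrE ?rnorm_ge0//.
  rewrite rnorm_orthonormal_sum; apply: le_trans (h n).
  by apply: ler_sum => k _; rewrite rnormM rnorm_real !exprMn real_normK ?num_real.
rewrite -[mult c y](subrK (series (fun k => (rr (c k) * dot y (v k)) *: v k) n)).
by apply: le_trans (rnormD _ _) _; rewrite addrC lerD// ltW.
Qed.

Lemma dot_mult k : dot (mult c y) (v k) = rr (c k) * dot y (v k).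
Proof.
apply/eqP; rewrite -subr_eq0 -rnorm_eq0 eq_le rnorm_ge0 andbT.
apply/ler_addgt0Pr => e e0; rewrite add0r.
have /cvg_rnorm /(_ e e0) [N _ hN] := mult_cvg.
pose n := maxn N k.+1.
have := hN n (leq_maxl _ _) => /=; set s := series _ n => hn.
have E : dot s (v k) = rr (c k) * dot y (v k).
  by rewrite /s dot_orthonormal_sum /= leq_maxr mul1r.
rewrite -E -dotBl; apply: le_trans (cauchy_schwarz _ _) _.
by rewrite rnorm_orthonormal mulr1 ltW.
Qed.

End Mult.

(** [N] is where the Bessel tail of [y] becomes negligible against [B]. Neither [N] nor [eta]
    depends on the operator: beyond [N] the uniform bound suffices, and only finitely many
    eigenvalues must be small. *)
Lemma mult_small B y e : 0 <= B -> 0 < e -> exists N eta, 0 < eta /\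
  forall d, (forall k, `|d k| <= B) -> (forall k, (k < N)%N -> `|d k| <= eta) ->
    rnorm (mult d y) < e.
Proof.
move=> B0 e0.
have e2 : 0 < (e / 2) ^+ 2 / 2 by rewrite divr_gt0 ?exprn_gt0 ?divr_gt0.
have [N hN] := bessel_tail y (divr_gt0 e2 (ltr_wpDl (sqr_ge0 B) ltr01)).
(* Chosen so that the modes below [N] contribute at most (e / 4)^2 <= (e / 2)^2 / 2; the summand 1
   covers [y = 0]. *)
pose eta := (e / 2) / (2 * (rnorm y + 1)).
have y1 : 0 < rnorm y + 1 by rewrite ltr_wpDl ?rnorm_ge0.
have eta0 : 0 < eta by rewrite !divr_gt0// mulr_gt0.
exists N, eta; split=> // d dB dN.
apply: (@le_lt_trans _ _ (e / 2)); last by rewrite ltr_pdivrMr// ltr_pMr// ltr1n.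
apply: (rnorm_mult_le dB); first by rewrite divr_ge0 ?ltW.
move=> n; set F := fun k => (d k * rnorm (dot y (v k))) ^+ 2.
have F0 k : 0 <= F k by exact: sqr_ge0.
have h1 : \sum_(0 <= k < N) F k <= (e / 2) ^+ 2 / 2.
  apply: (@le_trans _ _ (eta ^+ 2 * \sum_(0 <= k < N) rnorm (dot y (v k)) ^+ 2)).
    rewrite mulr_sumr big_seq [leRHS]big_seq; apply: ler_sum => k.
    rewrite mem_index_iota => /andP[_ kN].
    rewrite /F exprMn ler_wpM2r ?sqr_ge0// -real_normK ?num_real//.
    by rewrite ler_pXn2r ?nnegrE ?(ltW eta0)// dN.
  apply: (@le_trans _ _ (eta ^+ 2 * (rnorm y + 1) ^+ 2)).
    apply: ler_wpM2l; rewrite ?sqr_ge0//; apply: le_trans (bessel _ _ _) _.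
    by rewrite ler_pXn2r ?nnegrE ?rnorm_ge0 ?(ltW y1)// lerDl.
  rewrite -exprMn (_ : eta * _ = e / 2 / 2).
    by rewrite [leLHS]expr_div_n ler_pM2l ?exprn_gt0 ?divr_gt0// lef_pV2 ?posrE// ler_eXnr// ler1n.
  by rewrite /eta; field; rewrite gt_eqF.
have h2 : \sum_(N <= k < n) F k <= (e / 2) ^+ 2 / 2.
  apply: (@le_trans _ _ ((B ^+ 2 + 1) * \sum_(N <= k < n) rnorm (dot y (v k)) ^+ 2)).
    rewrite mulr_sumr; apply: ler_sum => k _.
    rewrite /F exprMn ler_wpM2r ?sqr_ge0// -real_normK ?num_real//.
    by rewrite (@le_trans _ _ (B ^+ 2)) ?lerDl// ler_pXn2r ?nnegrE.
  by rewrite mulrC -ler_pdivlMr ?ltr_wpDl ?sqr_ge0// ltW// hN.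
rewrite [leRHS](splitr).
have [nN|Nn] := leqP n N.
  apply: (@le_trans _ _ (\sum_(0 <= k < N) F k)).
    by rewrite (big_cat_nat (n := n) (p := N))//= lerDl sumr_ge0.
  by rewrite (le_trans h1)// lerDl (ltW e2).
by rewrite (big_cat_nat (n := N))//= ?(ltnW Nn)// lerD.
Qed.

Lemma mult_one y : mult (cst 1) y = y.
Proof.
apply: orthonormal_ext => k.
by rewrite (@dot_mult 1) ?RorC_real1 ?mul1r// => ?; rewrite normr1.
Qed.

Lemma mult_eq B c y x : (forall k, `|c k| <= B) ->
  (forall k, dot x (v k) = rr (c k) * dot y (v k)) -> x = mult c y.
Proof. by move=> cB xE; apply: orthonormal_ext => k; rewrite (dot_mult y cB). Qed.

Lemma multB B c d y : (forall k, `|c k| <= B) -> (forall k, `|d k| <= B) ->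
  mult c y - mult d y = mult (fun k => c k - d k) y.
Proof.
move=> cB dB; apply: (@mult_eq (B + B)) => k.
  by apply: le_trans (ler_normB _ _) _; rewrite lerD.
by rewrite dotBl (dot_mult _ cB) (dot_mult _ dB) -mulrBl RorC_realB.
Qed.

Lemma multZ B a c y : (forall k, `|c k| <= B) ->
  rr a *: mult c y = mult (fun k => a * c k) y.
Proof.
move=> cB; apply: (@mult_eq (`|a| * B)) => k.
  by rewrite normrM ler_wpM2l.
by rewrite dotZl (dot_mult _ cB) mulrA RorC_realM.
Qed.

(** By [mult_small] only the first [N] eigenvalues have to be close at the same time, which is a
    finite intersection in the filter. *)
Lemma cvg_mult (T : Type) (F : set_system T) {FF : Filter F}
    (c : T -> nat -> R) (l : nat -> R) B y :
  (forall k, `|l k| <= B) -> (\forall t \near F, forall k, `|c t k| <= B) ->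
  (forall k, c t k @[t --> F] --> l k) -> mult (c t) y @[t --> F] --> mult l y.
Proof.
move=> lB cB cl; apply/cvg_rnorm => e e0.
have B0 : 0 <= B := le_trans (normr_ge0 _) (lB 0%N).
have [N [eta [eta0 h]]] := mult_small y (addr_ge0 B0 B0) e0.
have sm : F (fun t => forall i : 'I_N, `|l i - c t i| < eta).
  refine (@filter_forall T 'I_N (fun i t => `|l i - c t i| < eta) F FF _) => i.
  by have := cl i => /cvgrPdist_lt; apply.
apply: filterS2 cB sm => t cB sm.
rewrite (multB _ lB cB); apply: h => k.
  by apply: le_trans (ler_normB _ _) _; rewrite lerD.
by move=> kN; apply/ltW/(sm (Ordinal kN)).
Qed.

Section SelfAdjoint.
Variables (D : set H) (A : H -> H) (lam : nat -> R).
Hypothesis hself : self_adjoint dot D A.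
Hypothesis heig : forall k, D (v k) /\ A (v k) = rr (lam k) *: v k.

Lemma dot_self_adjoint x k : D x -> dot (A x) (v k) = rr (lam k) * dot x (v k).
Proof.
move=> Dx; have [Dv Av] := heig k.
by rewrite ((hself.2 (v k) _).2 (conj Dv erefl) x Dx) Av dotZr RorC_conj_real.
Qed.

(** For partial sums pu of u and pz of z, (A x, pu) = (x, pz) holds mode by mode. In the limit (A x,
    u) = (x, z) for all x in the domain, so (u, z) is in the graph of the adjoint, that is, of A. *)
Lemma self_adjoint_graph u z :
  (forall k, dot z (v k) = rr (lam k) * dot u (v k)) -> D u /\ A u = z.
Proof.
move=> zu; apply/(hself.2 u z) => x Dx.
have one (k : nat) : `|(cst 1 : nat -> R) k| <= 1 by rewrite normr1.
apply/eqP; rewrite -subr_eq0 -rnorm_eq0 eq_le rnorm_ge0 andbT.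
apply/ler_addgt0Pr => e e0; rewrite add0r.
pose C := rnorm (A x) + rnorm x + 1.
have C0 : 0 < C by rewrite ltr_wpDl ?addr_ge0 ?rnorm_ge0.
have ec : 0 < e / C by rewrite divr_gt0.
have /cvg_rnorm /(_ _ ec) [N1 _ h1] := @mult_cvg _ _ u one.
have /cvg_rnorm /(_ _ ec) [N2 _ h2] := @mult_cvg _ _ z one.
pose n := maxn N1 N2.
have {h1} := h1 n (leq_maxl _ _); have {h2} := h2 n (leq_maxr _ _).
rewrite /= !mult_one /series/= => hz hu.
set pz := \sum_(0 <= k < n) _ in hz; set pu := \sum_(0 <= k < n) _ in hu.
have E : dot (A x) pu = dot x pz.
  rewrite !dot_sumr; apply: eq_bigr => k _.
  rewrite !dotZr dot_self_adjoint// RorC_real1 !mul1r mulrA; congr (_ * _).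
  rewrite zu; have -> : rr (lam k) * dot u (v k) = dot (rr (lam k) *: u) (v k).
    by rewrite dotZl.
  by rewrite -!(dotC (v k)) dotZr RorC_conj_real mulrC.
have -> : dot (A x) u - dot x z = dot (A x) (u - pu) - dot x (z - pz).
  by rewrite !dotBr E opprB addrA subrK.
apply: le_trans (rnormD _ _) _; rewrite rnormN.
apply: (@le_trans _ _ (C * (e / C))); last by rewrite mulrC divfK ?gt_eqF.
rewrite /C mulrDl mulrDl -[leLHS]addr0; apply: lerD; last by rewrite mul1r ltW.
by apply: lerD; (apply: le_trans (cauchy_schwarz _ _) _); rewrite ler_wpM2l ?rnorm_ge0 ?ltW.
Qed.

End SelfAdjoint.

(* The factor c makes the real part detect every component of the coordinate
   along v k. *)
Definition coord (c : K) k (x : H) : R := RorC_Re (c * dot x (v k)).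

Lemma coordD c k x y : coord c k (x + y) = coord c k x + coord c k y.
Proof. by rewrite /coord dotDl mulrDr RorC_ReD. Qed.

Lemma coord0 c k : coord c k 0 = 0.
Proof. by apply: (addIr (coord c k 0)); rewrite -coordD !add0r. Qed.

Lemma coordB c k x y : coord c k (x - y) = coord c k x - coord c k y.
Proof. by apply: (addIr (coord c k y)); rewrite -coordD !subrK. Qed.

Lemma coordZ c k a x : coord c k (rr a *: x) = a * coord c k x.
Proof. by rewrite /coord dotZl mulrCA RorC_ReM. Qed.

Lemma coord_le c k x : `|coord c k x| <= rnorm c * rnorm x.
Proof.
apply: le_trans (RorC_Re_norm _) _; rewrite -/(rnorm _) rnormM.
by rewrite ler_wpM2l ?rnorm_ge0// (le_trans (cauchy_schwarz _ _))// rnorm_orthonormal mulr1.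
Qed.

Lemma coord_ext x y : (forall c k, coord c k x = coord c k y) -> x = y.
Proof.
move=> xy; apply: orthonormal_ext => k; apply/eqP; rewrite -subr_eq0.
(* With the factor [cj z] the real part becomes |z|^2, which detects z. *)
set z := dot x (v k) - dot y (v k).
have : coord (cj z) k (x - y) = 0 by rewrite coordB xy subrr.
rewrite /coord dotBl -/z mulrC mul_RorC_conj rnormE expr2 -RorC_realM.
by rewrite RorC_realK => /eqP; rewrite mulf_eq0 orbb rnorm_eq0.
Qed.

Lemma cvg_coord (T : Type) (F : set_system T) {FF : Filter F} c k (h : T -> H) l :
  h @ F --> l -> coord c k (h t) @[t --> F] --> coord c k l.
Proof.
move=> /cvg_rnorm hl; apply/(@cvgrPdist_lt _ R^o) => e e0.
have C0 : 0 < rnorm c + 1 by rewrite ltr_wpDl ?rnorm_ge0.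
apply: filterS (hl _ (divr_gt0 e0 C0)) => t ht.
rewrite -coordB; apply: le_lt_trans (coord_le _ _ _) _.
apply: (@le_lt_trans _ _ ((rnorm c + 1) * rnorm (l - h t))).
  by rewrite ler_wpM2r ?rnorm_ge0 ?lerDl.
by rewrite mulrC -ltr_pdivlMr.
Qed.

Lemma coord_stieltjes_sum c k phi h a x y :
  coord c k (stieltjes_sum phi h a x y) = rsum phi (coord c k \o h) a x y.
Proof.
rewrite /stieltjes_sum (big_morph _ (coordD c k) (coord0 c k)).
by apply: eq_bigr => i _; rewrite coordZ coordB.
Qed.

(** A coordinate is a bounded real-linear functional, so it passes through the Stieltjes sums and
    the limits. *)
Lemma is_caputo_coord c k T rho h t w :
  is_caputo T rho h t w -> rcaputo T rho (coord c k \o h) t (coord c k w).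
Proof.
rewrite /is_caputo /rcaputo; case: eqP => _.
  move=> /(@cvg_coord _ _ _ c k); apply: cvg_trans; apply: near_eq_cvg.
  by near=> s; rewrite /= coordZ coordB.
move=> [I hI cvI]; exists (coord c k \o I).
  move=> b /hI hb e e0.
  have C0 : 0 < rnorm c + 1 by rewrite ltr_wpDl ?rnorm_ge0.
  have [d d0 hd] := hb _ (divr_gt0 e0 C0); exists d => // x y xy mesh.
  have := hd x y xy mesh; rewrite rnormE RorC_real_lt => hl.
  rewrite -coord_stieltjes_sum -coordB; apply: le_lt_trans (coord_le _ _ _) _.
  set X := stieltjes_sum _ _ _ _ _ - _ in hl *.
  apply: (@le_lt_trans _ _ ((rnorm c + 1) * rnorm X)).
    by rewrite ler_wpM2r ?rnorm_ge0 ?lerDl.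
  by rewrite mulrC -ltr_pdivlMr.
move: cvI => /(@cvg_coord _ _ _ c k); apply: cvg_trans; apply: near_eq_cvg.
by near=> s; rewrite /= coordZ.
Unshelve. all: end_near. Qed.

Lemma stieltjes_sum_mult (phi : R -> R) (h : nat -> R -> R) a x z y B M :
  (forall k s, `|h k s| <= M) -> (forall k, `|rsum phi (h k) a x z| <= B) ->
  stieltjes_sum phi (fun s => mult (h ^~ s) y) a x z =
  mult (fun k => rsum phi (h k) a x z) y.
Proof.
move=> hM sB; apply: (mult_eq sB) => k.
rewrite /stieltjes_sum dot_suml /rsum.
rewrite (big_morph _ (@RorC_realD R cplx) (@RorC_real0 R cplx)) mulr_suml.
apply: eq_bigr => i _; rewrite dotZl dotBl.
rewrite !(@dot_mult M _ y (fun k => hM k _)) -mulrBl -RorC_realB mulrA.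
by rewrite RorC_realM.
Qed.

(** * Caputo derivatives of families of diagonal operators *)

Section CaputoMult.
Variables (rho T D M : R) (a : nat -> R) (w h : nat -> R -> R).
Hypothesis rho01 : 0 < rho <= 1.
Hypothesis cw : forall k, continuous (w k).
Hypothesis wD : forall k x, `|w k x| <= D.
Hypothesis ch : forall k, continuous (h k).
Hypothesis hM : forall k x, `|h k x| <= M.
Hypothesis hE : forall k s, 0 <= s <= T -> h k s = a k + frac_int rho (w k) s.

(** Sum minus integral is a diagonal operator applied to [y], with eigenvalues bounded uniformly in
    the mode and in the partition by [rsum_bound] and [stieltjes_frac_bound]; [mult_small] leaves
    finitely many modes. *)
Lemma is_stieltjes_mult y t b : rho < 1 -> 0 < b < t -> t <= T ->
  is_stieltjes (fun xi => (t - xi) `^ (- rho)) (fun s => mult (h ^~ s) y) 0 b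
    (mult (fun k => stieltjes_frac rho (w k) t b) y).
Proof.
move=> rho1 bt tT eps eps0; have rho0 : 0 < rho by case/andP: rho01.
have [b0 btt] := andP bt.
set phi := fun xi => (t - xi) `^ (- rho).
have M0 : 0 <= M := le_trans (normr_ge0 _) (hM 0%N 0).
have D0 : 0 <= D := le_trans (normr_ge0 _) (wD 0%N 0).
have fB k : `|stieltjes_frac rho (w k) t b| <= D * Gamma (1 - rho).
  exact: stieltjes_frac_bound.
have phi0 s : 0 <= phi s by exact: powR_ge0.
have sB k x z : tagged_partition 0 b x z -> `|rsum phi (h k) 0 x z| <= 4 * M * phi b.
  move=> xz; have d0 u : u < t -> 0 <= dweight rho t u by move=> _; exact: dweight_ge0.
  apply: (@rsum_bound _ phi (dweight rho t) (h k) t _ _ d0 (@ch k)) btt (phi0 0) (hM k) xz.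
    by move=> u; exact: is_derive_weight.
  by move=> u; exact: dweight_continuous.
pose B := 4 * M * phi b + D * Gamma (1 - rho).
have G0 : 0 <= D * Gamma (1 - rho) by rewrite mulr_ge0// ltW// Gamma_gt0// subr_gt0.
have B0 : 0 <= B by rewrite addr_ge0// mulr_ge0// mulr_ge0.
have [N [eta [eta0 small]]] := mult_small y B0 (eps0 : 0 < eps).
(* A common mesh for the first [N] modes, as a minimum built by induction. *)
have [d d0 hd] : exists2 d, 0 < d & forall k, (k < N)%N -> forall x z,
    tagged_partition 0 b x z -> fine_mesh 0 d x ->
    `|rsum phi (h k) 0 x z - stieltjes_frac rho (w k) t b| < eta.
  elim: N {small} => [|N [d d0 hd]]; first by exists 1.
  have [] := rstieltjes_frac_int rho0 (@cw N) (@wD N) (a N) bt eta0.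
  move=> d' d'0 hd'; exists (Num.min d d'); first by rewrite lt_min d0.
  move=> k; rewrite ltnS leq_eqVlt => /predU1P[->|kN] x z xz mesh.
    rewrite (@rsum_ext _ _ _ (fun s => a N + frac_int rho (w N) s) _ b) //.
      apply: hd' => // i ix; apply: lt_le_trans (mesh i ix) _.
      by rewrite ge_min lexx orbT.
    by move=> s /andP[s0 sb]; apply: hE; rewrite s0 (le_trans sb)// (le_trans (ltW btt)).
  apply: hd => // i ix; apply: lt_le_trans (mesh i ix) _.
  by rewrite ge_min lexx.
exists d => // x z xz mesh.
rewrite rnormE RorC_real_lt.
have sB' k : `|rsum phi (h k) 0 x z| <= B by rewrite (le_trans (sB k x z xz))// lerDl.
have fB' k : `|stieltjes_frac rho (w k) t b| <= B.
  by rewrite (le_trans (fB k))// lerDr mulr_ge0// mulr_ge0.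
rewrite (stieltjes_sum_mult y hM sB') (multB _ sB' fB'); apply: small => k.
  by apply: le_trans (ler_normB _ _) _; rewrite lerD// sB.
by move=> kN; apply/ltW/hd.
Qed.

Lemma is_caputo_mult y t : 0 < T -> 0 < t <= T ->
  is_caputo T rho (fun s => mult (h ^~ s) y) t (mult (w ^~ t) y).
Proof.
move=> T0 tT; have [t0 tT'] := andP tT; have rho0 : 0 < rho by case/andP: rho01.
have D0 : 0 <= D := le_trans (normr_ge0 _) (wD 0%N 0).
rewrite /is_caputo; case: eqP => [rho1|/eqP rho1].
  have near01 : \forall s \near within `[0, T] t^', 0 <= s <= T.
    have : \forall s \near within `[0, T] t^', `[0, T]%classic s by apply: withinT.
    by apply: filterS => s /=; rewrite in_itv.
  have hB k s : 0 <= s <= T -> h k s - h k t = frac_int 1 (w k) s - frac_int 1 (w k) t.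
    move=> sT; rewrite (hE k sT) (hE k (_ : 0 <= t <= T)) ?(ltW t0)// rho1.
    by move: (frac_int _ _ s) (frac_int _ _ t) => p q; rewrite opprD addrACA subrr add0r.
  (* The uniform bound comes from the Lipschitz estimate; at [s = t] it holds because the inverse of
     0 is 0. *)
  have hl k s : 0 <= s <= T -> `|(s - t)^-1 * (h k s - h k t)| <= D.
    move=> sT; have [-> |st] := eqVneq s t; first by rewrite subrr invr0 mul0r normr0.
    rewrite hB// normrM normfV.
    rewrite mulrC ler_pdivrMr ?normr_gt0 ?subr_eq0//.
    by apply: (frac_int1_lipschitz (@cw k) (@wD k)); [case/andP: sT|exact: ltW].
  have -> : (fun s => rr (s - t)^-1 *: (mult (h ^~ s) y - mult (h ^~ t) y)) =
            (fun s => mult (fun k => (s - t)^-1 * (h k s - h k t)) y).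
    apply/funext => s; rewrite (multB _ (fun k => hM k s) (fun k => hM k t)).
    rewrite (@multZ (M + M))// => k.
    by apply: le_trans (ler_normB _ _) _; rewrite lerD.
  apply: (@cvg_mult _ _ _ _ _ D) => [k||k]; first exact: wD.
    by apply: filterS near01 => s sT k; exact: hl.
  apply: cvg_trans (frac_int1_derivative (@cw k) T t0).
  apply: near_eq_cvg; near=> s.
  have sT : 0 <= s <= T.
    near: s; exact: near01.
  by rewrite hB.
have G0 : 0 < Gamma (1 - rho) by exact: Gamma_1rho_gt0.
have {}rho1 : rho < 1 by rewrite lt_neqAle rho1; case/andP: rho01.
exists (fun b => mult (fun k => stieltjes_frac rho (w k) t b) y).
  by move=> b bt; exact: is_stieltjes_mult.
have fB k b : `|stieltjes_frac rho (w k) t b| <= D * Gamma (1 - rho).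
  exact: stieltjes_frac_bound.
have -> : (fun b => rr (Gamma (1 - rho))^-1 *: mult (fun k => stieltjes_frac rho (w k) t b) y) =
    (fun b => mult (fun k => (Gamma (1 - rho))^-1 * stieltjes_frac rho (w k) t b) y).
  by apply/funext => b; rewrite (multZ _ _ (fun k => fB k b)).
apply: (@cvg_mult _ _ _ _ _ D) => [k| |k]; first exact: wD.
  near=> b => k; rewrite normrM normfV (gtr0_norm G0)// mulrC.
  by rewrite ler_pdivrMr ?G0.
exact: (stieltjes_frac_cvg rho0 (@cw k) (@wD k)).
Unshelve. all: end_near. Qed.

End CaputoMult.

End Hilbert.

(** * The inverse problem *)

(** [m] is the minimum of |g|; a change of sign would produce a zero by the intermediate value
    theorem. *)
Lemma nonvanishing_sign (R : realType) (T : R) (g : R -> R) : 0 <= T -> continuous g ->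
  (forall t, 0 <= t <= T -> g t != 0) ->
  exists m : R, 0 < m /\
    ((forall t, 0 <= t <= T -> m <= g t) \/ (forall t, 0 <= t <= T -> g t <= - m)).
Proof.
move=> T0 cg g0.
have cn : continuous (fun s => `|g s|).
  by move=> x; apply: (@cvg_norm _ R^o); exact: cg.
have [c] := EVT_min T0 (continuous_subspaceT cn); rewrite in_itv /= => cI cmin.
have gE t : 0 <= t <= T -> `|g c| <= `|g t| by move=> tI; apply: cmin; rewrite in_itv.
exists `|g c|; split; first by rewrite normr_gt0 g0.
have sgn t v : 0 <= t <= T -> Num.min (g 0) (g t) <= v <= Num.max (g 0) (g t) -> v != 0.
  move=> /andP[t0 tT] vI; have [s] := IVT t0 (continuous_subspaceT cg) vI.
  rewrite in_itv /= => /andP[s0 st] <-; apply: g0.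
  by rewrite s0 (le_trans st).
have [p|n|z] := ltgtP (g 0) 0; last by move: (g0 0); rewrite z lexx T0 eqxx => /(_ isT).
- right=> t tI; have := gE t tI.
  have [gt0|gt0] := leP (g t) 0; first by rewrite (ler0_norm gt0) lerNr.
  have := @sgn t 0 tI; rewrite eqxx ge_min (ltW p) le_max (ltW gt0) orbT.
  by move=> /(_ isT).
- left=> t tI; have := gE t tI.
  have [gt0|gt0] := leP 0 (g t); first by rewrite (ger0_norm gt0).
  have := @sgn t 0 tI; rewrite eqxx ge_min (ltW gt0) orbT le_max (ltW n).
  by move=> /(_ isT).
Qed.

Section InverseProblem.
Variables (R : realType) (cplx : bool).
Notation K := (RorC R cplx).
Notation rr := (@RorC_real R cplx).
Variables (H : completeNormedModType K) (dot : {dot H for @RorC_conj R cplx}).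
Variables (D : set H) (A : H -> H) (v : nat -> H) (lam : nat -> R).
Variables (rho T t0 : R) (g : R -> R) (psi : H).
Hypothesis hdot : scalar_product_of_norm dot.
Hypothesis hself : self_adjoint dot D A.
Hypothesis hv : complete_orthonormal dot v.
Hypothesis heig : forall k, D (v k) /\ A (v k) = rr (lam k) *: v k.
Hypothesis hlam0 : 0 < lam 0%N.
Hypothesis hlam_mono : {homo lam : j k / (j <= k)%N >-> j <= k}.
Hypothesis hrho : 0 < rho <= 1.
Hypothesis hT : 0 < T.
Hypothesis ht0 : 0 < t0 < T.
Hypothesis hg : {within `[0, T], continuous g}.
Hypothesis hpsi : D psi.

Let gc := g \o clamp T.

Let gcE t : 0 <= t <= T -> gc t = g t.
Proof. by move=> tT; rewrite /gc /= clamp_id. Qed.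

Let cgc : continuous gc.
Proof. by apply: clamp_comp_continuous hg; exact: ltW. Qed.

Variables (B m : R).
Hypothesis gcB : forall x, `|gc x| <= B.
Hypothesis m0 : 0 < m.
Hypothesis gc_sign :
  (forall t, 0 <= t <= T -> m <= gc t) \/ (forall t, 0 <= t <= T -> gc t <= - m).

Let lam_gt0 k : 0 < lam k.
Proof. exact: lt_le_trans (hlam_mono (leq0n k)). Qed.

Let rho0 : 0 < rho.
Proof. by case/andP: hrho. Qed.

Lemma E_rhoE k t : 0 <= t -> E_rho rho lam k t = relax rho (lam k) t.
Proof. exact: E_rho_mild. Qed.

Lemma duhamel_clampE k t : 0 <= t <= T -> duhamel rho (lam k) g t = mild rho (lam k) gc t.
Proof.
move=> tT; rewrite -duhamelE//; last exact: continuous_measurable_fun.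
apply: eq_Rintegral => s; rewrite inE /= in_itv /= => sI; rewrite gcE//.
by case/andP: sI tT => -> /le_trans h /andP[_ /h].
Qed.

Lemma coef_denominatorE k : coef_denominator rho T t0 g lam k = denom rho T (lam k) gc t0.
Proof.
case/andP: ht0 => h1 h2.
rewrite /coef_denominator /denom !E_rhoE ?(ltW hT) ?(ltW h1)//.
by rewrite !duhamel_clampE ?(ltW h1) ?(ltW h2) ?(ltW hT) ?lexx.
Qed.

Lemma u_modeE k t : 0 <= t <= T -> u_mode rho T g lam k t = mode rho T (lam k) gc t.
Proof.
move=> tT; have [h1 _] := andP tT.
by rewrite /u_mode /mode !E_rhoE ?(ltW hT)// !duhamel_clampE ?(ltW hT) ?lexx.
Qed.

Let one_relaxT k : 0 < 1 - relax rho (lam k) T.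
Proof. by apply: (one_relax_gt0 hrho hT (lam_gt0 k)); rewrite hT lexx. Qed.

Lemma denominator_neq0 k : denom rho T (lam k) gc t0 != 0.
Proof.
have := denom_lower hrho hT (lam_gt0 k) cgc gcB ht0 m0 gc_sign.
by apply: contraTneq => ->; rewrite normr0 -ltNge mulr_gt0// divr_gt0.
Qed.

(* f_k = source_coef k * (A psi, v_k), where source_coef is bounded. *)
Definition source_coef k := (1 - relax rho (lam k) T) / (lam k * denom rho T (lam k) gc t0).

(** The factor (1 - relax T) / lam in the numerator also occurs in the lower bound for the
    denominator; after cancellation only [m] remains. *)
Lemma source_coef_bound k : `|source_coef k| <= m^-1.
Proof.
have := denom_lower hrho hT (lam_gt0 k) cgc gcB ht0 m0 gc_sign.
have d0 := denominator_neq0 k.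
rewrite /source_coef normrM normfV normrM (gtr0_norm (one_relaxT k)) (gtr0_norm (lam_gt0 k)).
move: (denom _ _ _ _ _) (1 - _) d0 (one_relaxT k) => d r d0 r0 h.
rewrite ler_pdivrMr ?mulr_gt0 ?normr_gt0// mulrC ler_pdivlMr//.
by move: h; rewrite mulrA ler_pdivrMr// mulrC [_ * lam k]mulrC.
Qed.

Let hT0 : 0 <= T := ltW hT.

Definition source_f : H := mult dot v source_coef (A psi).

Definition solution_mode k s := mode rho T (lam k) gc (clamp T s).

Definition solution_u (t : R) : H := mult dot v (solution_mode ^~ t) source_f.

Lemma lam_solution_mode_bound k s : `|lam k * solution_mode k s| <= 2 * B.
Proof. exact: (mode_bound hrho hT (lam_gt0 k) cgc gcB (clamp_itv hT0 s)). Qed.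

Lemma solution_mode_bound k s : `|solution_mode k s| <= 2 * B / lam 0%N.
Proof.
rewrite ler_pdivlMr// mulrC; apply: le_trans (lam_solution_mode_bound k s).
by rewrite normrM (gtr0_norm (lam_gt0 k)) ler_wpM2r// hlam_mono.
Qed.

Lemma solution_mode_continuous k : continuous (solution_mode k).
Proof.
apply: (clamp_comp_continuous hT0 (g := mode rho T (lam k) gc)).
exact: (continuous_subspaceT (mode_continuous hrho (lam_gt0 k) cgc gcB)).
Qed.

Lemma dot_source_f k : dot source_f (v k) = rr (source_coef k * lam k) * dot psi (v k).
Proof.
rewrite (dot_mult hdot hv _ source_coef_bound) (dot_self_adjoint hself heig)//.
by rewrite mulrA -RorC_realM.
Qed.

Lemma dot_solution_u t k :
  dot (solution_u t) (v k) = rr (solution_mode k t) * dot source_f (v k).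
Proof. exact: (dot_mult hdot hv _ (fun k => solution_mode_bound k t)). Qed.

Lemma solution_u_continuous : continuous solution_u.
Proof.
move=> t; apply: (cvg_mult hdot hv (B := 2 * B / lam 0%N)).
- by move=> k; exact: solution_mode_bound.
- by apply: nearW => s k; exact: solution_mode_bound.
- by move=> k; exact: solution_mode_continuous.
Qed.

(** The eigenvalues [lam k * solution_mode k t] are bounded in [k], so they define a vector;
    [self_adjoint_graph] identifies it as the image of [solution_u t] under [A]. *)
Lemma solution_u_operator t :
  D (solution_u t) /\
  A (solution_u t) = mult dot v (fun k => lam k * solution_mode k t) source_f.
Proof.
apply: (self_adjoint_graph hdot hv hself heig) => k.
rewrite (dot_mult hdot hv _ (fun k => lam_solution_mode_bound k t)).
by rewrite dot_solution_u RorC_realM mulrA.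
Qed.

Lemma solution_u_is_solution : is_solution D A rho T t0 g psi solution_u source_f.
Proof.
pose W k := mode_source rho T (lam k) gc.
have cW k : continuous (W k) := mode_source_continuous hrho hT (lam_gt0 k) cgc gcB.
have WB k s : `|W k s| <= 3 * B by exact: (mode_source_bound hrho hT (lam_gt0 k) cgc gcB).
split; last split.
- exact: (continuous_subspaceT solution_u_continuous).
- exists (fun t => mult dot v (W ^~ t) source_f); split.
  + apply: continuous_subspaceT => t.
    apply: (cvg_mult hdot hv (B := 3 * B)) => [k||k]; first exact: WB.
      by apply: nearW => s k; exact: WB.
    exact: cW.
  + move=> t tT; apply: (is_caputo_mult hdot hv hrho cW WB solution_mode_continuous
      solution_mode_bound _ _ hT tT) => k s sT.
    rewrite /solution_mode clamp_id//.
    exact: (mode_frac_int hrho hT (lam_gt0 k) cgc gcB).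
  + by move=> t _; case: (solution_u_operator t).
  + apply: continuous_subspaceT => t.
    rewrite (_ : (fun t => A (solution_u t)) =
      fun t => mult dot v (fun k => lam k * solution_mode k t) source_f); last first.
      by apply/funext => s; case: (solution_u_operator s).
    apply: (cvg_mult hdot hv (B := 2 * B)) => [k||k].
    * exact: lam_solution_mode_bound.
    * by apply: nearW => s k; exact: lam_solution_mode_bound.
    * by apply: cvgM; [exact: cvg_cst|exact: solution_mode_continuous].
  + move=> t /andP[t1 tT]; case: (solution_u_operator t) => _ ->.
    have tI : 0 <= t <= T by rewrite (ltW t1).
    apply: (orthonormal_ext hv) => k; rewrite dotDl dotZl.
    rewrite (dot_mult hdot hv _ (fun k => WB k t)).
    rewrite (dot_mult hdot hv _ (fun k => lam_solution_mode_bound k t)).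
    rewrite -mulrDl -RorC_realD /W /mode_source /solution_mode clamp_id// subrK.
    by rewrite gcE.
- split.
    (* Each mode is periodic: at both ends its value is b(T) / (1 - E(T)). *)
    suff E : solution_mode ^~ T = solution_mode ^~ 0.
      exact: (congr1 (fun c => mult dot v c source_f) E).
    have c0 : clamp T 0 = 0 by rewrite clamp_id ?hT0 ?lexx.
    have cT : clamp T T = T by rewrite clamp_id ?hT0 ?lexx.
    apply/funext => k; rewrite /solution_mode c0 cT /mode.
    have -> : mild rho (lam k) gc 0 = 0 by exact: mild0.
    rewrite relax0.
    have := one_relaxT k; move: (relax _ _ _) (mild _ _ _ _) => r b r1.
    by field; rewrite gt_eqF.
  apply: (orthonormal_ext hv) => k; rewrite dot_solution_u dot_source_f mulrA -RorC_realM.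
  suff -> : solution_mode k t0 * (source_coef k * lam k) = 1 by rewrite RorC_real1 mul1r.
  have ct0 : clamp T t0 = t0 by apply: clamp_id; case/andP: ht0 => /ltW -> /ltW ->.
  rewrite /solution_mode ct0 /source_coef.
  (* With this factorization the condition at [t0] reads mode(t0) * source_coef * lam = 1 for each
     k. *)
  have denomE : denom rho T (lam k) gc t0 =
      (1 - relax rho (lam k) T) * mode rho T (lam k) gc t0.
    rewrite /denom /mode; have := one_relaxT k.
    move: (relax _ _ T) (relax _ _ t0) (mild _ _ _ T) (mild _ _ _ t0) => r r' b b' r1.
    by field; rewrite gt_eqF.
  have d0 := denominator_neq0 k; have := one_relaxT k; have := lam_gt0 k.
  move: d0; rewrite denomE.
  move: (lam k) (1 - _) (mode _ _ _ _ _) => l r b; rewrite mulf_eq0 negb_or => /andP[r0 b0] l0 _.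
  by field; rewrite r0 b0 gt_eqF.
Qed.

(** As [u t] is in the domain, [A] can be moved onto [v k], where it multiplies by the real number
    [lam k] and commutes with the real part in [coord]. *)
Lemma solution_coord u f c k : is_solution D A rho T t0 g psi u f ->
  coord dot v c k f * denom rho T (lam k) gc t0 =
    coord dot v c k psi * (1 - relax rho (lam k) T) /\
  forall t, 0 <= t <= T ->
    coord dot v c k (u t) = coord dot v c k f * mode rho T (lam k) gc t.
Proof.
move=> [cu [[w [_ wu Du _ eqn]] [uT ut0]]].
pose h s := coord dot v c k (u (clamp T s)).
have hE s : 0 <= s <= T -> h s = coord dot v c k (u s).
  by move=> sT; rewrite /h clamp_id.
have ch : continuous h.
  move=> s; have cus : (u \o clamp T) r @[r --> s] --> (u \o clamp T) s.
    exact: (clamp_comp_continuous hT0 cu).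
  exact: (cvg_coord hdot hv cus).
have E t : 0 < t <= T ->
    rcaputo T rho h t (coord dot v c k f * gc t - lam k * h t).
  move=> tT; have [t1 t2] := andP tT; have tI : 0 <= t <= T by rewrite (ltW t1).
  have -> : coord dot v c k f * gc t - lam k * h t = coord dot v c k (w t).
    rewrite -[w t](addrK (A (u t))) eqn// gcE// hE// coordB coordZ mulrC.
    congr (_ - _); rewrite /coord (dot_self_adjoint hself heig) //; last exact: Du.
    by rewrite mulrCA RorC_ReM.
  apply: (rcaputo_ext tT _ (is_caputo_coord hdot hv c k (wu t tT))) => s sT /=.
  by rewrite hE.
have h0 : h T = h 0 by rewrite !hE ?hT0 ?lexx// uT.
have [F1 F2] := scalar_solution hrho hT (lam_gt0 k) cgc gcB ht0 ch E h0.
have t0T : 0 <= t0 <= T by case/andP: ht0 => /ltW -> /ltW ->.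
split; first by rewrite F1 hE// ut0.
by move=> t tT; rewrite -hE// F2.
Qed.

Lemma solution_unique u f : is_solution D A rho T t0 g psi u f ->
  f = source_f /\ forall t, 0 <= t <= T -> u t = solution_u t.
Proof.
move=> sol.
have fE : f = source_f.
  (* Multiplied by the nonzero denominator, the coordinates of both sources equal the same
     expression in [psi]. *)
  apply: (coord_ext hv) => c k; apply: (mulIf (denominator_neq0 k)).
  have [-> _] := solution_coord c k sol.
  by have [-> _] := solution_coord c k solution_u_is_solution.
split=> // t tT; apply: (coord_ext hv) => c k.
have [_ ->] := solution_coord c k sol => //.
by have [_ ->] := solution_coord c k solution_u_is_solution => //; rewrite fE.
Qed.

Lemma one_E_rho_neq0 k : 1 - E_rho rho lam k T != 0.
Proof. by rewrite E_rhoE// gt_eqF. Qed.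

Lemma f_coefE k :
  f_coef rho T t0 g lam dot v psi k = rr (source_coef k) * dot (A psi) (v k).
Proof.
rewrite (dot_self_adjoint hself heig)// /f_coef coef_denominatorE E_rhoE//.
rewrite mulrA -RorC_realM -mulrA -RorC_realV -RorC_realM mulrC; congr (rr _ * _).
rewrite /source_coef; have := lam_gt0 k; have := denominator_neq0 k.
move: (lam k) (1 - _) (denom _ _ _ _ _) => l r d d0 l0.
by field; rewrite d0 gt_eqF.
Qed.

Lemma series_f_coef :
  series (fun k => f_coef rho T t0 g lam dot v psi k *: v k) @ \oo --> source_f.
Proof.
rewrite (_ : (fun k => _) = fun k => (rr (source_coef k) * dot (A psi) (v k)) *: v k).
  exact: (mult_cvg hdot hv source_coef_bound).
by apply/funext => k; rewrite f_coefE.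
Qed.

Lemma series_u_mode t : 0 <= t <= T ->
  series (fun k => (f_coef rho T t0 g lam dot v psi k *
                    rr (u_mode rho T g lam k t)) *: v k) @ \oo --> solution_u t.
Proof.
move=> tT; rewrite (_ : (fun k => _) =
  fun k => (rr (solution_mode k t) * dot source_f (v k)) *: v k).
  exact: (mult_cvg hdot hv (fun k => solution_mode_bound k t)).
apply/funext => k; congr (_ *: _); rewrite mulrC; congr (rr _ * _).
  by rewrite /solution_mode clamp_id// u_modeE.
by rewrite f_coefE /source_f (dot_mult hdot hv _ source_coef_bound).
Qed.

End InverseProblem.

Unset Implicit Arguments.
Set Strict Implicit.
Set Printing Implicit Defensive.

Theorem theorem3p2 (R : realType) (cplx : bool)
    (H : completeNormedModType (RorC R cplx))
    (dot : {dot H for @RorC_conj R cplx})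
    (D : set H) (A : H -> H) (v : nat -> H) (lam : nat -> R)
    (rho T t0 : R) (g : R -> R) (psi : H)
    (hdot : scalar_product_of_norm dot)
    (hsep : separable H)
    (hlin : linear_operator D A)
    (hself : self_adjoint dot D A)
    (hpos : positive_operator dot D A)
    (hinv : has_compact_inverse D A)
    (hv : complete_orthonormal dot v)
    (heig : forall k, D (v k) /\ A (v k) = RorC_real cplx (lam k) *: v k)
    (hlam0 : 0 < lam 0%N)
    (hlam_mono : {homo lam : j k / (j <= k)%N >-> j <= k})
    (hlam_infty : lam @ \oo --> +oo)
    (hrho : 0 < rho <= 1) (hT : 0 < T) (ht0 : 0 < t0 < T)
    (hg : {within `[0, T], continuous g})
    (hg0 : forall t, 0 <= t <= T -> g t != 0)
    (hpsi : D psi) :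
  exists (u : R -> H) (f : H),
    is_solution D A rho T t0 g psi u f /\
    (forall (u' : R -> H) (f' : H), is_solution D A rho T t0 g psi u' f' ->
       f' = f /\ forall t, 0 <= t <= T -> u' t = u t) /\
    (forall k, 1 - E_rho rho lam k T != 0 /\
               coef_denominator rho T t0 g lam k != 0) /\
    series (fun k => f_coef rho T t0 g lam dot v psi k *: v k) @ \oo --> f /\
    (forall t, 0 <= t <= T ->
       series (fun k => (f_coef rho T t0 g lam dot v psi k
                         * RorC_real cplx (u_mode rho T g lam k t)) *: v k)
         @ \oo --> u t).
Proof.
have gcC : continuous (g \o clamp T) := clamp_comp_continuous (ltW hT) hg.
have gc0 t : 0 <= t <= T -> (g \o clamp T) t != 0 by move=> tT; rewrite /= clamp_id ?hg0.
have [m [m0 gcS]] := nonvanishing_sign (ltW hT) gcC gc0.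
have [B [_ gB]] := bounded_itv hg.
have gcB x : `|(g \o clamp T) x| <= B by apply: gB; apply: clamp_itv; exact: ltW.
exists (solution_u dot A v lam rho T t0 g psi), (source_f dot A v lam rho T t0 g psi).
split; first exact: (solution_u_is_solution hdot hself hv heig hlam0 hlam_mono hrho hT ht0
  hg hpsi gcB m0 gcS).
split.
  by move=> u' f'; exact: (solution_unique hdot hself hv heig hlam0 hlam_mono hrho hT ht0
    hg hpsi gcB m0 gcS).
split; first split.
- exact: (one_E_rho_neq0 hlam0 hlam_mono hrho hT).
- rewrite (coef_denominatorE hlam0 hlam_mono hrho hT ht0 hg).
  exact: (denominator_neq0 hlam0 hlam_mono hrho hT ht0 hg gcB m0 gcS).
split; first exact: (series_f_coef hdot hself hv heig hlam0 hlam_mono hrho hT ht0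
  hg hpsi gcB m0 gcS).
move=> t tT; exact: (series_u_mode hdot hself hv heig hlam0 hlam_mono hrho hT ht0
  hg hpsi gcB m0 gcS tT).
Qed.
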